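(* Let $f$ be a conformal mapping on the unit disk $\mathbb{D}$ with Bergman number $b(f)$, and let $p>0$, $\alpha>-1$. If $\frac{p}{\alpha+2}<b(f)$ then $f\in A_\alpha^p(\mathbb{D})$, and if $\frac{p}{\alpha+2}>b(f)$ then $f\notin A_\alpha^p(\mathbb{D})$.
   Context: A conformal mapping on $\mathbb{D}$ is an injective holomorphic function $f:\mathbb{D}\to\mathbb{C}$. For $p>0$, $\alpha>-1$, the weighted Bergman space $A_\alpha^p(\mathbb{D})$ is the set of holomorphic $f$ on $\mathbb{D}$ with $\int_{\mathbb{D}}|f(z)|^p(1-|z|^2)^\alpha\,dA(z)<\infty$, where $dA$ is Lebesgue area measure. The Bergman number of a conformal mapping $f$ is $$b(f)=\sup\left\{\frac{p}{\alpha+2}:\ p>0,\ \alpha>-1,\ f\in A_\alpha^p(\mathbb{D})\right\}\in(0,\infty].$$ *)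

(* Defs.v *)
From HB Require Import structures.
From mathcomp Require Import all_boot all_order all_algebra.
From mathcomp Require Import all_classical all_reals all_analysis.
From mathcomp Require Import complex.

Set Implicit Arguments.
Unset Strict Implicit.
Unset Printing Implicit Defensive.

Import Order.TTheory GRing.Theory Num.Theory.
Import numFieldNormedType.Exports.

Local Open Scope classical_set_scope.
Local Open Scope ring_scope.

Section BergmanSpaces.
Variable R : realType.

Definition unit_disk : set R[i] := [set z | `|z| < 1].

(* Functions on the disk are represented by total functions on R[i], of which
   only the values on [unit_disk] matter.  [R[i]^o] is R[i] as a normed space
   over itself, so that [derivable f z 1] is complex differentiability. *)
Definition holomorphic_on_disk (f : R[i] -> R[i]) : Prop :=
  forall z : R[i], unit_disk z -> derivable (f : R[i]^o -> R[i]^o) z 1.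

Definition conformal_mapping (f : R[i] -> R[i]) : Prop :=
  holomorphic_on_disk f /\ set_inj unit_disk f.

(* Area measure on R[i] is the product Lebesgue measure on R * R through this
   identification. *)
Definition complex_of_pair (u : R * R) : R[i] := Complex u.1 u.2.

(* [`|z|] lives in R[i]; [Normc.normc z] is the same modulus as an element
   of R. *)
Definition bergman_integral (p alpha : R) (f : R[i] -> R[i]) : \bar R :=
  (\int[(@lebesgue_measure R \x @lebesgue_measure R)%E]_(u in
      complex_of_pair @^-1` unit_disk)
     (Normc.normc (f (complex_of_pair u)) `^ p *
      (1 - Normc.normc (complex_of_pair u) ^+ 2) `^ alpha)%:E)%E.

Definition bergman_space (p alpha : R) : set (R[i] -> R[i]) :=
  [set f | holomorphic_on_disk f /\ (bergman_integral p alpha f < +oo)%E].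

Definition bergman_number (f : R[i] -> R[i]) : \bar R :=
  ereal_sup [set x : \bar R | exists p alpha : R,
    [/\ 0 < p, -1 < alpha, bergman_space p alpha f &
        x = (p / (alpha + 2))%:E]].

End BergmanSpaces.

(* Main.v *)
(* The second claim is the definition of a supremum. For the first, take [q] and [b]
   with [f] in [A^q_b] and [p/(alpha+2) < q/(b+2)]. The mean value property gives the
   growth bound [|f|^q W^(b+2) <= K], where [W = 1 - |z|^2]. A one-dimensional Hardy
   inequality on horizontal and vertical chords bounds [int (1 + |f|^2)^(p/2) W^alpha]
   by the energy [int (1 + |f|^2)^(p/2-1) |f'|^2 W^(alpha+2)]. The growth bound turns
   [W^(alpha+2)] into a negative power of [1 + |f|^2]; by the choice of [q] and [b]
   the energy density is at most a multiple of [h(f) |f'|^2] with [h] integrable over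
   the plane, and since [f] is injective the integral of [h(f) |f'|^2] is at most a
   constant times that of [h]. *)

Require Import Defs.
From HB Require Import structures.
From mathcomp Require Import all_boot all_order all_algebra.
From mathcomp Require Import all_classical all_reals all_analysis.
From mathcomp Require Import measurable_realfun complex ring lra.

Set Implicit Arguments.
Unset Strict Implicit.
Unset Printing Implicit Defensive.

Import Order.TTheory GRing.Theory Num.Theory.
Import numFieldNormedType.Exports.

Local Open Scope classical_set_scope.
Local Open Scope complex_scope.
Local Open Scope ring_scope.

(** * Cauchy theory on squares *)

(** Raising the growth bound to the power [(alpha+2)/(b+2)] makes [W^(alpha+2)] at most a multiple
    of [(1+|f|^2)^(-q(alpha+2)/(2(b+2)))]. The energy density is then at most a multiple of
    [(1+|f|^2)^(-1-e) |f'|^2] with [2e = q(alpha+2)/(b+2) - p]. In the plane [(1+|w|^2)^(-1-e)] is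
    integrable exactly when [e > 0], which is the strict inequality between the two ratios. The base
    [1+|f|^2] instead of [|f|^2] keeps the power [p/2-1] harmless at a zero of [f] when [p < 2].
    Area is a product measure, so everything is set in Cartesian coordinates: squares replace discs,
    so that boundary integrals are one-variable integrals along the sides, and chords replace radii.
    On a chord at distance [s] from the center the Hardy inequality needs [1-s^2] bounded below;
    chords of one direction therefore miss part of the disk, and two directions are used. The change
    of variables is an inequality up to a constant: small squares around good points have images
    containing squares of comparable size, and the areas are compared by Tonelli's theorem. *)

Section ComplexModulus.
Variable R : realType.
Implicit Types z w : R[i].
Local Notation normc := (@Normc.normc R).

Lemma normc_ge0 z : 0 <= normc z.
Proof. by case: z => a b; rewrite sqrtr_ge0. Qed.

Lemma normr_normc z : `|z| = (normc z)%:C%C.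
Proof. by []. Qed.

Lemma normcE2 z : normc z ^+ 2 = complex.Re z ^+ 2 + complex.Im z ^+ 2.
Proof. by case: z => a b /=; rewrite sqr_sqrtr // addr_ge0 // sqr_ge0. Qed.

Lemma normc_eq0 z : (normc z == 0) = (z == 0).
Proof.
apply/eqP/eqP => [/Normc.eq0_normc //|->]; exact: Normc.normc0.
Qed.

Lemma normc_gt0 z : (0 < normc z) = (z != 0).
Proof. by rewrite lt_def normc_ge0 andbT normc_eq0. Qed.

Lemma ler_normcD z w : normc (z + w) <= normc z + normc w.
Proof. exact: (@complex.le_normcD R). Qed.

Lemma normc_opp z : normc (- z) = normc z.
Proof. exact: (@complex.normcN R). Qed.

Lemma normcB z w : normc (z - w) = normc (w - z).
Proof. by rewrite -normc_opp opprB. Qed.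

Lemma ler_normcB z w : normc z - normc w <= normc (z - w).
Proof. by rewrite lerBlDr; have := ler_normcD (z - w) w; rewrite subrK. Qed.

Lemma normc_real (x : R) : normc x%:C%C = `|x|.
Proof. by rewrite /= expr0n /= addr0 sqrtr_sqr. Qed.

Lemma ler_Re_normc z : `|complex.Re z| <= normc z.
Proof.
rewrite -ler_sqr ?nnegrE ?normc_ge0// normcE2 real_normK ?num_real//.
by rewrite lerDl sqr_ge0.
Qed.

Lemma ler_Im_normc z : `|complex.Im z| <= normc z.
Proof.
rewrite -ler_sqr ?nnegrE ?normc_ge0// normcE2 real_normK ?num_real//.
by rewrite lerDr sqr_ge0.
Qed.

Lemma ler_normc_ReIm z : normc z <= `|complex.Re z| + `|complex.Im z|.
Proof.
rewrite -ler_sqr ?nnegrE ?normc_ge0 ?addr_ge0// normcE2 sqrrD.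
rewrite !real_normK ?num_real// -addrA lerD2l lerDr.
by rewrite mulrn_wge0 // mulr_ge0.
Qed.

End ComplexModulus.

Section ComplexDerivative.
Variable R : realType.
Local Notation C := R[i].
Local Notation normc := (@Normc.normc R).
Implicit Types (f g : C -> C) (z w l m : C).

(** Complex differentiability with real [e] and [d], the norm of [R[i]] being complex-valued.
    Written without a quotient, it covers [h = 0] as well. *)
Definition cdiff f z l := forall e : R, 0 < e -> exists2 d : R, 0 < d &
  forall h, normc h < d -> normc (f (z + h) - f z - l * h) <= e * normc h.

Lemma derivable_cdiff f z :
  derivable (f : C^o -> C^o) z 1 -> exists l, cdiff f z l.
Proof.
move=> /cvg_ex[/= l lP]; exists l => e e0.
have e0' : 0 < e%:C%C :> C by rewrite ltcR.
have /cvgrPdist_le/(_ _ e0') := lP.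
rewrite near_withinE => /(@nbhs_norm0P C C^o)[/= d' d'0 dP].
(* The radius of a ball in [R[i]] is itself a complex number; being positive, it is real. *)
have dE : d' = (complex.Re d')%:C%C.
  by rewrite RRe_real // gtr0_real.
exists (complex.Re d'); first by rewrite -ltcR -dE.
move=> h hd.
have [->|h0] := eqVneq h 0.
  by rewrite addr0 subrr mulr0 subr0 !Normc.normc0 mulr0.
have := dP h; rewrite /= normr_normc dE ltcR => /(_ hd h0).
rewrite normr_normc lecR => H.
have := ler_wpM2r (normc_ge0 h) H; rewrite -Normc.normcM.
rewrite [h *: 1]mulr1 [h + z]addrC -normc_opp; congr (normc _ <= _).
rewrite -mulNr opprB mulrBl; congr (_ - _).
by rewrite [X in X * h]mulrC mulfVK.
Qed.

Lemma cdiff_derivable f z l : cdiff f z l -> derivable (f : C^o -> C^o) z 1.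
Proof.
move=> fl; apply/cvg_ex; exists l => /=.
apply/cvgrPdist_le => e e0.
have eE : e = (complex.Re e)%:C%C by rewrite RRe_real // gtr0_real.
have /fl[d d0 dP] : 0 < complex.Re e by rewrite -ltcR -eE.
rewrite near_withinE; apply/(@nbhs_norm0P C C^o); exists d%:C%C => /=.
  by rewrite ltcR.
move=> h /=; rewrite normr_normc ltcR => hd h0.
rewrite normr_normc eE lecR.
rewrite -(ler_pM2r (x := normc h)) ?normc_gt0// -Normc.normcM.
have := dP _ hd.
rewrite [h *: 1]mulr1 [h + z]addrC -normc_opp; congr (normc _ <= _).
rewrite opprB mulrBl; congr (_ - _).
by rewrite [X in X * h]mulrC mulfVK.
Qed.

Definition cderivable f z := exists l, cdiff f z l.

Lemma cderivableP f z : cderivable f z <-> derivable (f : C^o -> C^o) z 1.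
Proof. by split=> [[l /cdiff_derivable]|/derivable_cdiff]. Qed.

Lemma cderivableB f g z : cderivable f z -> cderivable g z ->
  cderivable (fun w => f w - g w) z.
Proof. by move=> /cderivableP ? /cderivableP ?; apply/cderivableP/derivableB. Qed.

Lemma cderivableM f g z : cderivable f z -> cderivable g z ->
  cderivable (fun w => f w * g w) z.
Proof.
move=> /cderivableP ff /cderivableP gg; apply/cderivableP.
exact: (@derivableM C C^o f g z 1 ff gg).
Qed.

Lemma cderivableV f z : f z != 0 -> cderivable f z ->
  cderivable (fun w => (f w)^-1) z.
Proof.
move=> f0 /cderivableP ff; apply/cderivableP.
exact: (@derivableV C C^o f z 1 f0 ff).
Qed.

Lemma cderivable_cst c z : cderivable (fun=> c) z.
Proof. by apply/cderivableP; exact: (@derivable_cst C C^o C^o c z 1). Qed.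

Lemma cderivable_id z : cderivable id z.
Proof. by apply/cderivableP; exact: (@derivable_id C C^o z 1). Qed.

Lemma cdiff_shift f z c l : cdiff f (z + c) l -> cdiff (fun w => f (w + c)) z l.
Proof.
move=> fl e /fl[d d0 dP]; exists d => // h hd.
by have := dP _ hd; rewrite [z + c + h]addrAC.
Qed.

Lemma cdiffB f g z l m : cdiff f z l -> cdiff g z m ->
  cdiff (fun w => f w - g w) z (l - m).
Proof.
move=> fl gm e e0; have e20 : 0 < e / 2 by rewrite divr_gt0.
have [d1 d10 d1P] := fl _ e20; have [d2 d20 d2P] := gm _ e20.
exists (Num.min d1 d2); first by rewrite lt_min d10.
move=> h; rewrite lt_min => /andP[/d1P H1 /d2P H2].
have -> : f (z + h) - g (z + h) - (f z - g z) - (l - m) * h =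
  (f (z + h) - f z - l * h) + - (g (z + h) - g z - m * h) by ring.
apply: (le_trans (ler_normcD _ _)); rewrite normc_opp; lra.
Qed.

Lemma near_cderivable f g z :
  (exists2 d : R, 0 < d & forall w, normc (w - z) < d -> g w = f w) ->
  cderivable f z -> cderivable g z.
Proof.
move=> [d d0 fg] [l fl]; exists l => e /fl[d' d'0 dP].
exists (Num.min d d'); first by rewrite lt_min d0.
move=> h; rewrite lt_min => /andP[hd /dP].
by rewrite !fg// ?subrr ?Normc.normc0// addrAC subrr add0r.
Qed.

Lemma cdiff_Lip f z l : cdiff f z l -> exists2 d : R, 0 < d &
  forall h, normc h < d -> normc (f (z + h) - f z) <= (normc l + 1) * normc h.
Proof.
move=> /(_ 1 ltr01)[d d0 dP]; exists d => // h /dP H.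
have -> : f (z + h) - f z = (f (z + h) - f z - l * h) + l * h by ring.
by apply: (le_trans (ler_normcD _ _)); rewrite Normc.normcM; lra.
Qed.

Definition ccont f z := forall e : R, 0 < e -> exists2 d : R, 0 < d &
  forall w, normc (w - z) < d -> normc (f w - f z) < e.

Lemma cdiff_ccont f z l : cdiff f z l -> ccont f z.
Proof.
move=> /cdiff_Lip[d d0 dP] e e0.
have k0 : 0 < normc l + 1 by rewrite ltr_wpDl ?normc_ge0.
exists (Num.min d (e / (normc l + 1))).
  by rewrite lt_min d0 divr_gt0.
move=> w; rewrite lt_min => /andP[/dP H1].
rewrite ltr_pdivlMr // => H2; move: H1; rewrite [z + _]addrC subrK; lra.
Qed.

Lemma cderivable_ccont f z : cderivable f z -> ccont f z.
Proof. by move=> [l /cdiff_ccont]. Qed.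

End ComplexDerivative.

Section SegmentIntegral.
Variable R : realType.
Implicit Types (a b c e t : R) (g : R -> R).

Definition rint a b g : R := (\int[@lebesgue_measure R]_(t in `[a, b]) g t)%R.

Lemma rint_integrable a b g : {within `[a, b], continuous g} ->
  (@lebesgue_measure R).-integrable `[a, b] (EFin \o g).
Proof.
by move=> gc; apply: continuous_compact_integrable => //; exact: segment_compact.
Qed.

Lemma within_continuousS a b c d g : a <= c -> d <= b ->
  {within `[a, b], continuous g} -> {within `[c, d], continuous g}.
Proof.
move=> ac db; apply: continuous_subspaceW => x /=.
by rewrite !in_itv/= => /andP[? ?]; rewrite (le_trans ac)// (le_trans _ db).
Qed.

Lemma rint_split a m b g : a <= m -> m <= b -> {within `[a, b], continuous g} ->
  rint a b g = rint a m g + rint m b g.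
Proof.
move=> am mb /[dup] gc /rint_integrable gi; rewrite /rint.
rewrite -(Rintegral_itv_obnd_cbnd (r := m)); last first.
  by apply: integrableS (rint_integrable (within_continuousS am (lexx b) gc)) =>
    //; exact: subset_itv_oc_cc.
rewrite -(@Rintegral_itvB _ _ _ _ m gi) ?bnd_simp//.
by rewrite addrC subrK.
Qed.

Lemma rint_cst a b c : a <= b -> rint a b (cst c) = c * (b - a).
Proof.
move=> ab; rewrite /rint Rintegral_cst//= lebesgue_measure_itv/= lte_fin.
by case: ltgtP ab => // -> _; rewrite subrr.
Qed.

Lemma rint_le a b g1 g2 : a <= b -> {within `[a, b], continuous g1} ->
  {within `[a, b], continuous g2} -> (forall t, a <= t <= b -> g1 t <= g2 t) ->
  rint a b g1 <= rint a b g2.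
Proof.
move=> ab g1c g2c g12; apply: le_Rintegral => //; try exact: rint_integrable.
Qed.

Lemma cst_within_continuous (A : set R) c : {within A, continuous (cst c : R -> R)}.
Proof. by apply: continuous_subspaceT => ?; exact: cvg_cst. Qed.

Lemma rint_near_cst a b g c e : a <= b -> {within `[a, b], continuous g} ->
  (forall t, a <= t <= b -> `|g t - c| <= e) ->
  `|rint a b g - c * (b - a)| <= e * (b - a).
Proof.
move=> ab gc H.
rewrite ler_distl -mulrBl -mulrDl -!rint_cst//.
apply/andP; split; apply: rint_le => //; try exact: cst_within_continuous;
  by move=> t /H; rewrite ler_distl/= => /andP[].
Qed.

Lemma rintB a b g1 g2 : {within `[a, b], continuous g1} ->
  {within `[a, b], continuous g2} ->
  rint a b (fun t => g1 t - g2 t) = rint a b g1 - rint a b g2.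
Proof.
by move=> g1c g2c; rewrite /rint RintegralB//; exact: rint_integrable.
Qed.

Lemma within_continuous_sub (A : set R) g1 g2 : {within A, continuous g1} ->
  {within A, continuous g2} -> {within A, continuous (fun t => g1 t - g2 t)}.
Proof. by move=> g1c g2c x; exact: cvgB (g1c x) (g2c x). Qed.

(** The intervals [[x n, x n + w / 2^n]] are nested, so every left endpoint is at most every right
    endpoint, and the supremum of the left endpoints lies in all of them. *)
Lemma nested_halving (x : nat -> R) w : 0 <= w ->
  (forall n, x n <= x n.+1 /\ x n.+1 + w / 2 ^+ n.+1 <= x n + w / 2 ^+ n) ->
  exists l, forall n, x n <= l <= x n + w / 2 ^+ n.
Proof.
move=> w0 H.
have xle n k : x n <= x (n + k)%N.
  by elim: k => [|k IH]; rewrite ?addn0// addnS (le_trans IH)//; case: (H (n + k)%N).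
have yle n k : x (n + k)%N + w / 2 ^+ (n + k) <= x n + w / 2 ^+ n.
  elim: k => [|k IH]; rewrite ?addn0// addnS; apply: le_trans IH.
  by case: (H (n + k)%N).
have xy n m : x m <= x n + w / 2 ^+ n.
  have wn k : 0 <= w / 2 ^+ k by rewrite divr_ge0// exprn_ge0.
  have [nm|mn] := leqP n m.
    have := yle n (m - n)%N; rewrite subnKC// => H1.
    by have := wn m; lra.
  have := xle m (n - m)%N; rewrite subnKC 1?ltnW// => H1.
  by have := wn n; lra.
have xs : has_sup (range x).
  by split; [exists (x 0%N); exists 0%N|exists (x 0%N + w / 2 ^+ 0) => _ [m _ <-]].
exists (sup (range x)) => n; apply/andP; split.
  by apply: ub_le_sup; [case: xs|exists n].
by apply: ge_sup; [case: xs|move=> _ [m _ <-]].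
Qed.

End SegmentIntegral.

Section Goursat.
Variable R : realType.
Local Notation C := R[i].
Local Notation normc := (@Normc.normc R).
Implicit Types (F : C -> C) (phi : C -> R) (a b c d x y : R).

Definition rcont phi z := forall e : R, 0 < e -> exists2 d : R, 0 < d &
  forall w, normc (w - z) < d -> `|phi w - phi z| < e.

Lemma ccont_Re F z : ccont F z -> rcont (fun w => complex.Re (F w)) z.
Proof.
move=> H e /H[d d0 dP]; exists d => // w /dP; apply: le_lt_trans.
by rewrite -raddfB; exact: ler_Re_normc.
Qed.

Lemma ccont_Im F z : ccont F z -> rcont (fun w => complex.Im (F w)) z.
Proof.
move=> H e /H[d d0 dP]; exists d => // w /dP; apply: le_lt_trans.
by rewrite -raddfB; exact: ler_Im_normc.
Qed.

Lemma ccont_normc F z : ccont F z -> rcont (fun w => normc (F w)) z.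
Proof.
move=> H e /H[d d0 dP]; exists d => // w /dP; apply: le_lt_trans.
by rewrite ler_norml ler_normcB andbT lerNl opprB normcB ler_normcB.
Qed.

Lemma normc_hor (x y c : R) : normc ((x +i* c) - (y +i* c)) = `|x - y|.
Proof. by rewrite -normc_real/= subrr. Qed.

Lemma normc_ver (x y c : R) : normc ((c +i* x) - (c +i* y)) = `|x - y|.
Proof. by rewrite /= subrr expr0n/= add0r sqrtr_sqr. Qed.

Lemma rcont_hor phi c a b : (forall x, a <= x <= b -> rcont phi (x +i* c)) ->
  {within `[a, b], continuous (fun x => phi (x +i* c))}.
Proof.
move=> H; apply: continuous_in_subspaceT => x /[!inE]/=; rewrite in_itv/= => xab.
apply/cvgrPdist_lt => e e0; have [d d0 dP] := H _ xab _ e0.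
apply/nbhs_normP; exists d => //= y /=; rewrite distrC -(normc_hor _ _ c) => /dP.
by rewrite distrC; exact.
Qed.

Lemma rcont_ver phi c a b : (forall x, a <= x <= b -> rcont phi (c +i* x)) ->
  {within `[a, b], continuous (fun x => phi (c +i* x))}.
Proof.
move=> H; apply: continuous_in_subspaceT => x /[!inE]/=; rewrite in_itv/= => xab.
apply/cvgrPdist_lt => e e0; have [d d0 dP] := H _ xab _ e0.
apply/nbhs_normP; exists d => //= y /=; rewrite distrC -(normc_ver _ _ c) => /dP.
by rewrite distrC; exact.
Qed.

(* The imaginary part of the integral of [F z dz] along the boundary of the
   rectangle [a, b] x [c, d], counterclockwise. *)
Definition rect_int F a b c d : R :=
  rint a b (fun t => complex.Im (F (t +i* c))) -
  rint a b (fun t => complex.Im (F (t +i* d))) +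
  (rint c d (fun t => complex.Re (F (b +i* t))) -
   rint c d (fun t => complex.Re (F (a +i* t)))).

Lemma rect_int_splitx F a m b c d : a <= m -> m <= b ->
  (forall t, a <= t <= b -> ccont F (t +i* c)) ->
  (forall t, a <= t <= b -> ccont F (t +i* d)) ->
  rect_int F a b c d = rect_int F a m c d + rect_int F m b c d.
Proof.
move=> am mb Fc Fd; rewrite /rect_int.
rewrite (@rint_split _ a m b _ am mb); last first.
  by apply: (rcont_hor (phi := fun w => complex.Im (F w))) => x /Fc/ccont_Im.
rewrite (@rint_split _ a m b (fun t => complex.Im (F (t +i* d))) am mb); last first.
  by apply: (rcont_hor (phi := fun w => complex.Im (F w))) => x /Fd/ccont_Im.
ring.
Qed.

Lemma rect_int_splity F a b c m d : c <= m -> m <= d ->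
  (forall t, c <= t <= d -> ccont F (a +i* t)) ->
  (forall t, c <= t <= d -> ccont F (b +i* t)) ->
  rect_int F a b c d = rect_int F a b c m + rect_int F a b m d.
Proof.
move=> cm md Fa Fb; rewrite /rect_int.
rewrite (@rint_split _ c m d _ cm md); last first.
  by apply: (rcont_ver (phi := fun w => complex.Re (F w))) => x /Fb/ccont_Re.
rewrite (@rint_split _ c m d (fun t => complex.Re (F (a +i* t))) cm md); last first.
  by apply: (rcont_ver (phi := fun w => complex.Re (F w))) => x /Fa/ccont_Re.
ring.
Qed.

Definition rect a b c d : set C :=
  [set z | a <= complex.Re z <= b /\ c <= complex.Im z <= d].

(** Opposite sides are paired pointwise. Paired points differ by a fixed vector, so the difference
    of the values of [F] is a constant multiple of [l] up to twice the error. The constants of the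
    two pairs are [(c - d) * Re l] and [(b - a) * Re l]; integrated over sides of length [b - a] and
    [d - c], they cancel. *)
Lemma rect_int_local F a b c d z l e : a <= b -> c <= d -> rect a b c d z ->
  (forall w, rect a b c d w -> ccont F w) -> 0 <= e ->
  (forall w, rect a b c d w ->
     normc (F w - F z - l * (w - z)) <= e * normc (w - z)) ->
  `|rect_int F a b c d| <= 2 * e * ((b - a) + (d - c)) ^+ 2.
Proof.
move=> ab cd zr Fc e0 H.
have [cc dd] : c <= c <= d /\ c <= d <= d by rewrite !lexx cd.
have [aa bb] : a <= a <= b /\ a <= b <= b by rewrite !lexx ab.
have {}H w : rect a b c d w ->
    normc (F w - F z - l * (w - z)) <= e * ((b - a) + (d - c)).
  move=> wr; apply: (le_trans (H w wr)); apply: ler_wpM2l => //.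
  apply: (le_trans (ler_normc_ReIm _)).
  case: w z zr wr {H} => [w1 w2] [z1 z2] [/= ? ?] [/= ? ?].
  by apply: lerD; rewrite ler_norml; lra.
have Fh y : c <= y <= d ->
    {within `[a, b], continuous (fun x => complex.Im (F (x +i* y)))}.
  move=> yi; apply: (rcont_hor (phi := fun w => complex.Im (F w))) => x xi.
  by apply/ccont_Im/Fc.
have Fv x : a <= x <= b ->
    {within `[c, d], continuous (fun y => complex.Re (F (x +i* y)))}.
  move=> xi; apply: (rcont_ver (phi := fun w => complex.Re (F w))) => y yi.
  by apply/ccont_Re/Fc.
rewrite /rect_int -!rintB; [|exact: Fv|exact: Fv|exact: Fh|exact: Fh].
set E := e * _ in H; set I1 := rint a b _; set I2 := rint c d _.
have near w1 w2 : rect a b c d w1 -> rect a b c d w2 ->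
    normc (F w1 - F w2 - l * (w1 - w2)) <= 2 * E.
  move=> /H H1 /H H2.
  have -> : F w1 - F w2 - l * (w1 - w2) =
    (F w1 - F z - l * (w1 - z)) + - (F w2 - F z - l * (w2 - z)) by ring.
  by apply: (le_trans (ler_normcD _ _)); rewrite normc_opp; lra.
have H1 : `|I1 - ((c - d) * complex.Re l) * (b - a)| <= (2 * E) * (b - a).
  apply: rint_near_cst => //; first by apply: within_continuous_sub; exact: Fh.
  move=> t ti; apply: le_trans (near (t +i* c) (t +i* d) _ _) => //.
  apply: le_trans (ler_Im_normc _); rewrite raddfB raddfB.
  rewrite le_eqVlt; apply/orP; left; apply/eqP; congr `|_ - _|.
  by case: (l) => l1 l2 /=; ring.
have H2 : `|I2 - ((b - a) * complex.Re l) * (d - c)| <= (2 * E) * (d - c).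
  apply: rint_near_cst => //; first by apply: within_continuous_sub; exact: Fv.
  move=> t ti; apply: le_trans (near (b +i* t) (a +i* t) _ _) => //.
  apply: le_trans (ler_Re_normc _); rewrite raddfB raddfB.
  rewrite le_eqVlt; apply/orP; left; apply/eqP; congr `|_ - _|.
  by case: (l) => l1 l2 /=; ring.
have -> : I1 + I2 = (I1 - ((c - d) * complex.Re l) * (b - a)) +
  (I2 - ((b - a) * complex.Re l) * (d - c)) by ring.
apply: (le_trans (ler_normD _ _)); apply: (le_trans (lerD H1 H2)).
by rewrite /E le_eqVlt; apply/orP; left; apply/eqP; ring.
Qed.

(** The inner sides cancel, so the integral is the sum over the four quarters, and one quarter
    carries at least a fourth of its absolute value. *)
Lemma rect_int_quarter F x y w h : 0 <= w -> 0 <= h ->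
  (forall z, rect x (x + w) y (y + h) z -> ccont F z) ->
  exists s : R * R, [/\ s.1 = x \/ s.1 = x + w / 2, s.2 = y \/ s.2 = y + h / 2 &
   `|rect_int F x (x + w) y (y + h)| <=
   4 * `|rect_int F s.1 (s.1 + w / 2) s.2 (s.2 + h / 2)| ].
Proof.
move=> w0 h0 Fc.
have wE : x + w / 2 + w / 2 = x + w by lra.
have hE : y + h / 2 + h / 2 = y + h by lra.
have E : rect_int F x (x + w) y (y + h) =
  rect_int F x (x + w / 2) y (y + h / 2) +
  rect_int F x (x + w / 2) (y + h / 2) (y + h / 2 + h / 2) +
  (rect_int F (x + w / 2) (x + w / 2 + w / 2) y (y + h / 2) +
  rect_int F (x + w / 2) (x + w / 2 + w / 2) (y + h / 2) (y + h / 2 + h / 2)).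
  rewrite wE hE (@rect_int_splitx _ x (x + w / 2)); try lra; last 2 first.
  - by move=> t ti; apply: Fc; split => /=; lra.
  - by move=> t ti; apply: Fc; split => /=; lra.
  by congr (_ + _); apply: rect_int_splity; try lra;
    move=> t ti; apply: Fc; split => /=; lra.
have {E} := congr1 Num.norm E.
set A1 := rect_int F x _ y (y + _ / 2); set A2 := rect_int F x _ (y + _ / 2) _.
set A3 := rect_int F (x + _ / 2) _ y _; set A4 := rect_int F (x + _ / 2) _ (y + _ / 2) _.
move=> E.
have T : `|A1 + A2 + (A3 + A4)| <= `|A1| + `|A2| + (`|A3| + `|A4|).
  by rewrite (le_trans (ler_normD _ _))// lerD// ler_normD.
case: (leP `|rect_int F x (x + w) y (y + h)| (4 * `|A1|)) => [?|B1].
  by exists (x, y); split => //; left.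
case: (leP `|rect_int F x (x + w) y (y + h)| (4 * `|A2|)) => [?|B2].
  by exists (x, y + h / 2); split => //; [left|right].
case: (leP `|rect_int F x (x + w) y (y + h)| (4 * `|A3|)) => [?|B3].
  by exists (x + w / 2, y); split => //; [right|left].
case: (leP `|rect_int F x (x + w) y (y + h)| (4 * `|A4|)) => [?|B4].
  by exists (x + w / 2, y + h / 2); split => //; right.
by exfalso; move: E T B1 B2 B3 B4; clear; lra.
Qed.

(* Goursat's bisection argument. *)
Lemma rect_int_eq0 F a b c d : a <= b -> c <= d ->
  (forall z, rect a b c d z -> cderivable F z) -> rect_int F a b c d = 0.
Proof.
move=> ab cd Fd; pose w := b - a; pose h := d - c.
have w0 : 0 <= w by rewrite subr_ge0.
have h0 : 0 <= h by rewrite subr_ge0.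
pose inv n (s : R * R) := [/\ a <= s.1, s.1 + w / 2 ^+ n <= b, c <= s.2 &
  s.2 + h / 2 ^+ n <= d].
pose I n (s : R * R) := `|rect_int F s.1 (s.1 + w / 2 ^+ n) s.2 (s.2 + h / 2 ^+ n)|.
have half (u : R) n : u / 2 ^+ n / 2 = u / 2 ^+ n.+1.
  by rewrite exprSr invfM mulrA.
have pow0 (u : R) n : 0 <= u -> 0 <= u / 2 ^+ n.
  by move=> ?; rewrite divr_ge0// exprn_ge0.
(* The invariant is a premise under the existential so that [choice] yields a total function; where
   the invariant fails, any point serves. *)
have step (ns : nat * (R * R)) : exists s : R * R, inv ns.1 ns.2 ->
    [/\ s.1 = ns.2.1 \/ s.1 = ns.2.1 + w / 2 ^+ ns.1.+1,
     s.2 = ns.2.2 \/ s.2 = ns.2.2 + h / 2 ^+ ns.1.+1,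
     inv ns.1.+1 s & I ns.1 ns.2 <= 4 * I ns.1.+1 s].
  case: ns => n [x y] /=.
  case: (pselect (inv n (x, y))) => [iv|]; last by move=> ?; exists (x, y).
  have [/= i1 i2 i3 i4] := iv.
  have [|s [s1 s2 s3]] := @rect_int_quarter F x y (w / 2 ^+ n) (h / 2 ^+ n)
      (pow0 _ _ w0) (pow0 _ _ h0).
    by move=> z [z1 z2]; apply/cderivable_ccont/Fd; split; lra.
  exists s => _; rewrite /I -!half; split => //.
  rewrite /inv -!half; have := pow0 w n w0; have := pow0 h n h0.
  by case: s1 => ->; case: s2 => -> ??; split; lra.
have [nxt nxtP] := choice step.
pose s := fix s n := if n is m.+1 then nxt (m, s m) else (a, c).
have invs n : inv n (s n).
  elim: n => [|n IH]; last by case: (nxtP (n, s n) IH).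
  by rewrite /inv/= !expr0 !divr1 /w /h; split => //; lra.
have Is n : I 0%N (s 0%N) <= 4 ^+ n * I n (s n).
  elim: n => [|n IH]; first by rewrite expr0 mul1r.
  apply: (le_trans IH); rewrite exprSr -mulrA ler_wpM2l ?exprn_ge0//.
  by case: (nxtP (n, s n) (invs n)).
have [lx lxP] : exists l, forall n, (s n).1 <= l <= (s n).1 + w / 2 ^+ n.
  apply: nested_halving => // n; rewrite -half; have := pow0 w n w0.
  by case: (nxtP (n, s n) (invs n)) => /= + _ _ _; rewrite -half => -[] ->; lra.
have [ly lyP] : exists l, forall n, (s n).2 <= l <= (s n).2 + h / 2 ^+ n.
  apply: nested_halving => // n; rewrite -half; have := pow0 h n h0.
  by case: (nxtP (n, s n) (invs n)) => /= _ + _ _; rewrite -half => -[] ->; lra.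
have I0 : I 0%N (s 0%N) = `|rect_int F a b c d|.
  by rewrite /I/= !expr0 !divr1 /w /h [a + _]addrC subrK [c + _]addrC subrK.
apply/eqP; rewrite -normr_le0 -I0; apply/ler_addgt0Pl => e e0; rewrite addr0.
(* With precision [e / K] in the derivative, the local bound becomes at most [e]; the [+ 1] keeps
   [K] positive for a degenerate rectangle. *)
pose K := 2 * (w + h) ^+ 2 + 1.
have K0 : 0 < K by rewrite ltr_wpDl// mulr_ge0// sqr_ge0.
have [l lP] : cderivable F (lx +i* ly).
  apply: Fd; have := lxP 0%N; have := lyP 0%N.
  by rewrite /= !expr0 !divr1 /w /h => ??; split => /=; lra.
have [dl dl0 dlP] := lP _ (divr_gt0 e0 K0).
have [n nP] : exists n, (w + h) / 2 ^+ n < dl.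
  have wh0 : 0 <= (w + h) / dl by apply: divr_ge0; [exact: addr_ge0|exact: ltW].
  exists (Num.bound ((w + h) / dl)); rewrite ltr_pdivrMr ?exprn_gt0// mulrC.
  rewrite -ltr_pdivrMr//; apply: lt_le_trans (archi_boundP wh0) _.
  by rewrite -natrX ler_nat ltnW// ltn_expl.
apply: (le_trans (Is n)).
have := invs n; rewrite /inv /I.
have := lxP n; have := lyP n; case: (s n) => x y /= lyP' lxP' [i1 i2 i3 i4].
have e0' : 0 <= e / K by rewrite divr_ge0// ltW.
have H := @rect_int_local F x (x + w / 2 ^+ n) y (y + h / 2 ^+ n) (lx +i* ly) l (e / K).
(* The local bound is quadratic in the side lengths, hence of order [4^-n], which cancels the [4^n]
   accumulated by the bisection. *)
apply: (@le_trans _ _ (4 ^+ n * (2 * (e / K) * ((w + h) / 2 ^+ n) ^+ 2))).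
  apply: ler_wpM2l; first exact: exprn_ge0.
  have -> : (w + h) / 2 ^+ n = (x + w / 2 ^+ n - x) + (y + h / 2 ^+ n - y) by ring.
  have := pow0 w n w0; have := pow0 h n h0 => ??.
  apply: H => //; try lra.
  - by move=> z [z1 z2]; apply/cderivable_ccont/Fd; split; lra.
  - move=> z [z1 z2]; have := dlP (z - (lx +i* ly)).
    rewrite [lx +i* ly + _]addrC subrK; apply.
    apply: (le_lt_trans (ler_normc_ReIm _)); apply: le_lt_trans nP.
    rewrite mulrDl; case: z z1 z2 => z1' z2' /= ??.
    by apply: lerD; rewrite ler_norml; lra.
have -> : (4 : R) ^+ n = 2 ^+ n ^+ 2 by rewrite -exprM mulnC exprM; congr (_ ^+ _); ring.
have p0 : (2 : R) ^+ n != 0 by rewrite expf_neq0.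
have -> : 2 ^+ n ^+ 2 * (2 * (e / K) * ((w + h) / 2 ^+ n) ^+ 2) =
    e * ((2 * (w + h) ^+ 2) / K) :> R.
  by field; rewrite p0 gt_eqF.
by rewrite ler_piMr ?(ltW e0)// ler_pdivrMr// mul1r /K lerDl.
Qed.

End Goursat.

Section CauchySquare.
Variable R : realType.
Local Notation C := R[i].
Local Notation normc := (@Normc.normc R).
Implicit Types (F G : C -> C) (phi : C -> R) (x y r s t : R).

Definition square x y r : set C := rect (x - r) (x + r) (y - r) (y + r).

Definition square_int F x y r := rect_int F (x - r) (x + r) (y - r) (y + r).

Definition perimeter_int phi x y r :=
  rint (x - r) (x + r) (fun t => phi (t +i* (y - r))) +
  rint (x - r) (x + r) (fun t => phi (t +i* (y + r))) +
  (rint (y - r) (y + r) (fun t => phi ((x + r) +i* t)) +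
   rint (y - r) (y + r) (fun t => phi ((x - r) +i* t))).

(** The region between the two squares splits into four rectangles that avoid the center, and
    Goursat's theorem kills the integral around each of them. *)
Lemma square_int_shrink F x y r s : 0 < s -> s <= r ->
  (forall z, square x y r z -> z != x +i* y -> cderivable F z) ->
  square_int F x y r = square_int F x y s.
Proof.
move=> s0 sr Fd.
have {}Fd a b : x - r <= a <= x + r -> y - r <= b <= y + r ->
    (s <= `|a - x|) || (s <= `|b - y|) -> cderivable F (a +i* b).
  move=> ai bi ab; apply: Fd; first by split.
  apply: contraL ab => /eqP[-> ->].
  by rewrite !subrr normr0 orbb -ltNge.
have Fc a b : x - r <= a <= x + r -> y - r <= b <= y + r ->
    (s <= `|a - x|) || (s <= `|b - y|) -> ccont F (a +i* b).
  by move=> *; apply/cderivable_ccont/Fd.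
have nx : `|x - s - x| = s by rewrite addrAC subrr sub0r normrN gtr0_norm.
have px : `|x + s - x| = s by rewrite addrAC subrr add0r gtr0_norm.
have ny : `|y - s - y| = s by rewrite addrAC subrr sub0r normrN gtr0_norm.
have py : `|y + s - y| = s by rewrite addrAC subrr add0r gtr0_norm.
have nr a : `|a - r - a| = r.
  by rewrite addrAC subrr sub0r normrN gtr0_norm// (lt_le_trans s0).
have pr a : `|a + r - a| = r.
  by rewrite addrAC subrr add0r gtr0_norm// (lt_le_trans s0).
rewrite /square_int (@rect_int_splitx _ _ _ (x - s)); try lra; last 2 first.
- by move=> t ti; apply: Fc; [lra|lra|rewrite nr sr orbT].
- by move=> t ti; apply: Fc; [lra|lra|rewrite pr sr orbT].
rewrite (@rect_int_eq0 _ _ (x - r)); try lra; last first.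
  move=> [a b] [/= ai bi]; apply: Fd; try lra.
  by rewrite ler0_norm; [apply/orP; left; lra|lra].
rewrite add0r (@rect_int_splitx _ _ _ (x + s)); try lra; last 2 first.
- by move=> t ti; apply: Fc; [lra|lra|rewrite nr sr orbT].
- by move=> t ti; apply: Fc; [lra|lra|rewrite pr sr orbT].
rewrite [X in _ + X](@rect_int_eq0 _ _ (x + s)); try lra; last first.
  move=> [a b] [/= ai bi]; apply: Fd; try lra.
  by rewrite ger0_norm; [apply/orP; left; lra|lra].
rewrite addr0 (@rect_int_splity _ _ _ _ _ (y - s)); try lra; last 2 first.
- by move=> t ti; apply: Fc; [lra|lra|rewrite nx lexx].
- by move=> t ti; apply: Fc; [lra|lra|rewrite px lexx].
rewrite (@rect_int_eq0 _ _ _ _ (y - r)); try lra; last first.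
  move=> [a b] [/= ai bi]; apply: Fd; try lra.
  by rewrite [`|b - y|]ler0_norm; [apply/orP; right; lra|lra].
rewrite add0r (@rect_int_splity _ _ _ _ _ (y + s)); try lra; last 2 first.
- by move=> t ti; apply: Fc; [lra|lra|rewrite nx lexx].
- by move=> t ti; apply: Fc; [lra|lra|rewrite px lexx].
rewrite [X in _ + X](@rect_int_eq0 _ _ _ _ (y + s)); try lra.
move=> [a b] [/= ai bi]; apply: Fd; try lra.
by rewrite [`|b - y|]ger0_norm; [apply/orP; right; lra|lra].
Qed.

(** A singularity weaker than [1/|h|] is invisible to the integral: on a small square of half-side
    [s] the perimeter is [8 * s] while [|F|] is at most [e / (8 * s)]. Boundary points are at
    distance at most [2 * s <= d / 2] from the center, whence the choice of [d / 4] for [s]. *)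
Lemma square_int_punctured F x y r : 0 < r ->
  (forall z, square x y r z -> z != x +i* y -> cderivable F z) ->
  (forall e, 0 < e -> exists2 d : R, 0 < d & forall h, h != 0 -> normc h < d ->
     normc (F ((x +i* y) + h)) * normc h <= e) ->
  square_int F x y r = 0.
Proof.
move=> r0 Fd Fo; apply/eqP; rewrite -normr_le0.
apply/ler_addgt0Pl => e e0; rewrite addr0.
have [d d0 dP] := Fo _ (divr_gt0 e0 (ltr0n R 8)).
pose s := Num.min r (d / 4).
have s0 : 0 < s by rewrite lt_min r0 divr_gt0.
have sr : s <= r by rewrite ge_min lexx.
have sd : s <= d / 4 by rewrite ge_min lexx orbT.
rewrite (square_int_shrink s0 sr Fd).
have bnd a b : `|a - x| <= s -> `|b - y| <= s ->
    (s <= `|a - x|) || (s <= `|b - y|) -> normc (F (a +i* b)) <= e / 8 / s.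
  move=> ax bY ab; rewrite ler_pdivlMr//.
  have hs : s <= normc ((a - x) +i* (b - y)).
    case/orP: ab => /le_trans; apply; first exact: (ler_Re_normc ((a - x) +i* (b - y))).
    exact: (ler_Im_normc ((a - x) +i* (b - y))).
  have -> : a +i* b = (x +i* y) + ((a - x) +i* (b - y)).
    by apply/eqP; rewrite eq_complex/=; apply/andP; split; apply/eqP; ring.
  apply: le_trans (dP _ _ _).
  - by apply: ler_wpM2l => //; exact: normc_ge0.
  - by rewrite -normc_gt0 (lt_le_trans s0).
  - apply: (le_lt_trans (ler_normc_ReIm _)) => /=; lra.
have Fc a b : `|a - x| <= s -> `|b - y| <= s ->
    (s <= `|a - x|) || (s <= `|b - y|) -> ccont F (a +i* b).
  rewrite !ler_distl => /andP[? ?] /andP[? ?] ab.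
  apply/cderivable_ccont/Fd; first by split => /=; lra.
  apply: contraL ab => /eqP[-> ->].
  by rewrite !subrr normr0 orbb -ltNge.
have nx a : `|a - s - a| = s by rewrite addrAC subrr sub0r normrN gtr0_norm.
have px a : `|a + s - a| = s by rewrite addrAC subrr add0r gtr0_norm.
have Ih v : v = y - s \/ v = y + s ->
    `|rint (x - s) (x + s) (fun t => complex.Im (F (t +i* v)))| <= e / 4.
  move=> vE; have vs : `|v - y| = s by case: vE => ->.
  rewrite -[X in `|X|]subr0 -(mul0r (x + s - (x - s))).
  have -> : e / 4 = (e / 8 / s) * (x + s - (x - s)) by field; rewrite gt_eqF.
  apply: rint_near_cst; first by lra.
    apply: (rcont_hor (phi := fun w => complex.Im (F w))) => t ti.
    by apply/ccont_Im/Fc; rewrite ?vs ?lexx ?orbT// ler_distl.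
  move=> t ti; rewrite subr0; apply: le_trans (ler_Im_normc _) _.
  by apply: bnd; rewrite ?vs ?lexx ?orbT// ler_distl.
have Iv v : v = x - s \/ v = x + s ->
    `|rint (y - s) (y + s) (fun t => complex.Re (F (v +i* t)))| <= e / 4.
  move=> vE; have vs : `|v - x| = s by case: vE => ->.
  rewrite -[X in `|X|]subr0 -(mul0r (y + s - (y - s))).
  have -> : e / 4 = (e / 8 / s) * (y + s - (y - s)) by field; rewrite gt_eqF.
  apply: rint_near_cst; first by lra.
    apply: (rcont_ver (phi := fun w => complex.Re (F w))) => t ti.
    by apply/ccont_Re/Fc; rewrite ?vs ?lexx ?orbT// ler_distl.
  move=> t ti; rewrite subr0; apply: le_trans (ler_Re_normc _) _.
  by apply: bnd; rewrite ?vs ?lexx ?orbT// ler_distl.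
have := Ih _ (or_introl erefl); have := Ih _ (or_intror erefl).
have := Iv _ (or_introl erefl); have := Iv _ (or_intror erefl).
rewrite /square_int /rect_int.
set a1 := rint _ _ _; set a2 := rint _ _ _; set a3 := rint _ _ _.
set a4 := rint _ _ _.
move=> b1 b2 b3 b4.
apply: (le_trans (ler_normD _ _)); apply: (le_trans (lerD (ler_normB _ _) (ler_normB _ _))).
lra.
Qed.

End CauchySquare.

Section MeanValue.
Variable R : realType.
Local Notation C := R[i].
Local Notation normc := (@Normc.normc R).
Implicit Types (f G : C -> C) (phi : C -> R) (x y r s t : R).

Lemma inv_complex (a b : R) :
  ((a +i* b)^-1 : C) = (a / (a ^+ 2 + b ^+ 2)) -i* (b / (a ^+ 2 + b ^+ 2)).
Proof. by []. Qed.

(** On the side [r + it] with [|t| <= r], the kernel has modulus at most [1 / r], while the real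
    part of [A / (r + it)] is [A r / (r^2 + t^2)], at least [A / (2r)]. Integrated over a side of
    length [2r], the latter contributes [A], so the four sides together give the [4 * A] of the mean
    value inequality. *)
Lemma Re_divr_square (u : C) (A r t : R) : 0 < r -> `|t| <= r -> 0 <= A ->
  complex.Re ((u - A%:C) / (r +i* t)) <= normc u / r - A / (2 * r) /\
  - (normc u / r - A / (2 * r)) <= complex.Re ((u - A%:C) / ((- r) +i* t)).
Proof.
move=> r0 tr A0.
have tr2 : t ^+ 2 <= r ^+ 2 by rewrite -real_normK ?num_real// lerXn2r ?nnegrE// ltW.
have D0 : 0 < r ^+ 2 + t ^+ 2 by rewrite ltr_pwDl ?exprn_gt0// sqr_ge0.
have rD (e : R) : e = r \/ e = - r -> normc (u / (e +i* t)) <= normc u / r.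
  move=> eE; rewrite Normc.normcM Normc.normcV ler_wpM2l ?normc_ge0//.
  rewrite lef_pV2 ?posrE//; last first.
    rewrite normc_gt0 eq_complex/= negb_and; case: eE => ->; by rewrite ?oppr_eq0 gt_eqF.
  have <- : `|complex.Re (e +i* t)| = r by case: eE => -> /=; rewrite ?normrN gtr0_norm.
  exact: ler_Re_normc.
have key : A / (2 * r) <= A * (r / (r ^+ 2 + t ^+ 2)).
  apply: ler_wpM2l => //; rewrite ler_pdivlMr// mulrC ler_pdivrMr ?mulr_gt0//.
  by lra.
split.
  rewrite mulrBl raddfB lerB//.
    by apply: le_trans (rD r (or_introl erefl)); apply: le_trans (ler_norm _) (ler_Re_normc _).
  by apply: (le_trans key); rewrite inv_complex/= mul0r subr0.
rewrite opprB addrC mulrBl raddfB lerD//.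
  have := rD (- r) (or_intror erefl); have := ler_Re_normc (u / ((- r) +i* t)).
  by rewrite ler_norml => /andP[? ?] ?; lra.
apply: (le_trans key); rewrite inv_complex/= mul0r subr0 sqrrN.
by rewrite mulNr mulrN opprK.
Qed.

Lemma Im_divr_square (u : C) (A r t : R) : 0 < r -> `|t| <= r -> 0 <= A ->
  complex.Im ((u - A%:C) / (t -i* r)) <= normc u / r - A / (2 * r) /\
  - (normc u / r - A / (2 * r)) <= complex.Im ((u - A%:C) / (t +i* r)).
Proof.
move=> r0 tr A0.
have tr2 : t ^+ 2 <= r ^+ 2 by rewrite -real_normK ?num_real// lerXn2r ?nnegrE// ltW.
have D0 : 0 < t ^+ 2 + r ^+ 2 by rewrite ltr_pwDr ?exprn_gt0// sqr_ge0.
have rD (e : R) : e = r \/ e = - r -> normc (u / (t +i* e)) <= normc u / r.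
  move=> eE; rewrite Normc.normcM Normc.normcV ler_wpM2l ?normc_ge0//.
  rewrite lef_pV2 ?posrE//; last first.
    by rewrite normc_gt0 eq_complex/= negb_and orbC; case: eE => ->; rewrite ?oppr_eq0 gt_eqF.
  have <- : `|complex.Im (t +i* e)| = r by case: eE => -> /=; rewrite ?normrN gtr0_norm.
  exact: ler_Im_normc.
have key : A / (2 * r) <= A * (r / (t ^+ 2 + r ^+ 2)).
  apply: ler_wpM2l => //; rewrite ler_pdivlMr// mulrC ler_pdivrMr ?mulr_gt0//.
  by lra.
split.
  rewrite mulrBl raddfB lerB//.
    by apply: le_trans (rD (- r) (or_intror erefl)); apply: le_trans (ler_norm _) (ler_Im_normc _).
  by apply: (le_trans key); rewrite inv_complex/= mul0r addr0 sqrrN mulNr opprK.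
rewrite opprB addrC mulrBl raddfB lerD//.
  have := rD r (or_introl erefl); have := ler_Im_normc (u / (t +i* r)).
  by rewrite ler_norml => /andP[? ?] ?; lra.
apply: (le_trans key); rewrite inv_complex/= mul0r addr0.
by rewrite mulrN opprK.
Qed.

(* Cauchy's formula for [z |-> G z / (z - z0)], reduced to an inequality: the
   kernel is at most [1 / r] in modulus on the boundary of the square. *)
Lemma mean_value_square G x y r : 0 < r -> ccont G (x +i* y) ->
  (forall z, square x y r z -> z != x +i* y -> cderivable G z) ->
  4 * r * normc (G (x +i* y)) <= perimeter_int (fun z => normc (G z)) x y r.
Proof.
move=> r0 G0 Gd; set z0 := x +i* y in G0 Gd *; set A := normc (G z0).
have A0 : 0 <= A by exact: normc_ge0.
(* The unimodular factor [c] turns the value at the center into its modulus [A]. The numerator of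
   [F] then tends to 0 at the center, so the singularity of [F] does not contribute to the
   integral. *)
have [c c1 cA] : exists2 c : C, normc c = 1 & c * G z0 = A%:C.
  have [E|NE] := eqVneq (G z0) 0.
    by exists 1; [exact: Normc.normc1|rewrite /A E mulr0 Normc.normc0].
  exists (A%:C / G z0); last by rewrite divfK.
  by rewrite Normc.normcM Normc.normcV normc_real ger0_norm// mulfV// normc_eq0.
pose F z := (c * G z - A%:C) / (z - z0).
have Fd z : square x y r z -> z != z0 -> cderivable F z.
  move=> zs zz; apply: cderivableM.
    apply: cderivableB; last exact: cderivable_cst.
    by apply: cderivableM; [exact: cderivable_cst|exact: Gd].
  apply: cderivableV; first by rewrite subr_eq0.
  by apply: cderivableB; [exact: cderivable_id|exact: cderivable_cst].
have : square_int F x y r = 0.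
  apply: square_int_punctured => // e e0.
  have [d d0 dP] := G0 _ e0; exists d => // h h0 hd.
  rewrite /F addrAC subrr add0r Normc.normcM Normc.normcV mulfVK ?normc_eq0//.
  rewrite -cA -mulrBr Normc.normcM c1 mul1r ltW//; apply: dP.
  by rewrite addrAC subrr add0r.
have Gc a b : `|a - x| <= r -> `|b - y| <= r ->
    (r <= `|a - x|) || (r <= `|b - y|) -> ccont G (a +i* b) /\ ccont F (a +i* b).
  rewrite !ler_distl => /andP[? ?] /andP[? ?] ab.
  have ne : a +i* b != z0.
    by apply: contraL ab => /eqP[-> ->]; rewrite !subrr normr0 orbb -ltNge.
  by split; apply/cderivable_ccont; [apply: Gd|apply: Fd] => //; split => /=; lra.
have nx a : `|a - r - a| = r by rewrite addrAC subrr sub0r normrN gtr0_norm.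
have px a : `|a + r - a| = r by rewrite addrAC subrr add0r gtr0_norm.
pose K := 2 * r * (A / (2 * r)).
have KA : K = A by rewrite /K; field; rewrite gt_eqF.
have zE a b : (a +i* b) - z0 = (a - x) +i* (b - y) by [].
have nc z : normc (c * G z) = normc (G z) by rewrite Normc.normcM c1 mul1r.
have kc a b : {within `[a, b], continuous (fun t : R => A / (2 * r))}.
  exact: cst_within_continuous.
have Hb v (vE : v = y - r \/ v = y + r) :
    {within `[x - r, x + r], continuous (fun t => normc (G (t +i* v)))} /\
    {within `[x - r, x + r], continuous (fun t => complex.Im (F (t +i* v)))}.
  have vs : `|v - y| = r by case: vE => ->.
  split.
    apply: (rcont_hor (phi := fun w => normc (G w))) => t ti.
    apply/ccont_normc; apply: (Gc t v _ _ _).1; rewrite ?vs ?lexx ?orbT//.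
    by rewrite ler_distl.
  apply: (rcont_hor (phi := fun w => complex.Im (F w))) => t ti.
  apply/ccont_Im; apply: (Gc t v _ _ _).2; rewrite ?vs ?lexx ?orbT//.
  by rewrite ler_distl.
have Vb v (vE : v = x - r \/ v = x + r) :
    {within `[y - r, y + r], continuous (fun t => normc (G (v +i* t)))} /\
    {within `[y - r, y + r], continuous (fun t => complex.Re (F (v +i* t)))}.
  have vs : `|v - x| = r by case: vE => ->.
  split.
    apply: (rcont_ver (phi := fun w => normc (G w))) => t ti.
    apply/ccont_normc; apply: (Gc v t _ _ _).1; rewrite ?vs ?lexx ?orbT//.
    by rewrite ler_distl.
  apply: (rcont_ver (phi := fun w => complex.Re (F w))) => t ti.
  apply/ccont_Re; apply: (Gc v t _ _ _).2; rewrite ?vs ?lexx ?orbT//.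
  by rewrite ler_distl.
have bnd (h g : R -> R) u : {within `[u - r, u + r], continuous h} ->
    {within `[u - r, u + r], continuous g} ->
    (forall t, u - r <= t <= u + r -> h t <= g t / r - A / (2 * r)) ->
    rint (u - r) (u + r) h <= rint (u - r) (u + r) g / r - A.
  move=> hc gc hg.
  have gr : {within `[u - r, u + r], continuous (fun t => g t / r)}.
    by move=> t; apply: cvgMl; exact: gc.
  have uu : u - r <= u + r by lra.
  apply: le_trans (rint_le uu hc (within_continuous_sub gr (kc _ _)) hg) _.
  have cE : rint (u - r) (u + r) (fun=> A / (2 * r)) = A.
    by rewrite (rint_cst _ uu) -{2}KA /K; ring.
  by rewrite rintB// cE lerD2r /rint RintegralZr//; exact: rint_integrable.
rewrite /square_int /rect_int /perimeter_int => E0.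
have [g1 f1] := Hb _ (or_introl erefl); have [g2 f2] := Hb _ (or_intror erefl).
have [g3 f3] := Vb _ (or_introl erefl); have [g4 f4] := Vb _ (or_intror erefl).
have B1 := bnd _ _ _ f1 g1; have B4 := bnd _ _ _ f4 g4.
have N (h : R -> R) a b : {within `[a, b], continuous h} ->
   {within `[a, b], continuous (fun t => - h t)} /\
   rint a b (fun t => - h t) = - rint a b h.
  move=> hc; split; first by move=> t; apply: cvgN; exact: hc.
  have := rintB (@cst_within_continuous R `[a, b] 0) hc.
  rewrite /rint Rintegral_cst// mul0r sub0r => <-.
  by apply: eq_Rintegral => t _; rewrite sub0r.
have [f2' f2E] := N _ _ _ f2; have [f3' f3E] := N _ _ _ f3.
have B2 := bnd _ _ _ f2' g2; have B3 := bnd _ _ _ f3' g3.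
move: B1 B2 B3 B4; rewrite f2E f3E.
set I1 := rint _ _ _ in E0 *; set I2 := rint _ _ _ in E0 *.
set I3 := rint _ _ _ in E0 *; set I4 := rint _ _ _ in E0 *.
have nr u : u - r - u = - r by ring.
have pr u : u + r - u = r by ring.
have ti u t : u - r <= t <= u + r -> `|t - u| <= r by rewrite ler_distl.
move=> B1; lapply B1 => {B1}; last first.
  move=> t /ti tx.
  by rewrite -nc /F zE nr; apply: (Im_divr_square _ r0 tx A0).1.
move=> B1 B2; lapply B2 => {B2}; last first.
  move=> t /ti tx.
  by rewrite lerNl -nc /F zE pr; apply: (Im_divr_square _ r0 tx A0).2.
move=> B2 B3; lapply B3 => {B3}; last first.
  move=> t /ti ty.
  by rewrite lerNl -nc /F zE nr; apply: (Re_divr_square _ r0 ty A0).2.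
move=> B3 B4; lapply B4 => {B4}; last first.
  move=> t /ti ty.
  by rewrite -nc /F zE pr; apply: (Re_divr_square _ r0 ty A0).1.
move=> B4.
set J1 := rint _ _ _ in B1 *; set J2 := rint _ _ _ in B2 *.
set J4 := rint _ _ _ in B4 *; set J3 := rint _ _ _ in B3 *.
have : 0 <= (J1 + J2 + (J4 + J3)) / r - 4 * A.
  by rewrite !mulrDl; move: B1 B2 B3 B4 E0; clear; lra.
by rewrite subr_ge0 ler_pdivlMr// mulrAC.
Qed.

(** The constant 2 is the perimeter [8 * r] divided by the [4 * r] of the mean value inequality.
    Mere continuity at the center is assumed so that difference quotients, extended by the
    derivative, are admissible. *)
Lemma max_principle_square G x y r M : 0 < r -> ccont G (x +i* y) ->
  (forall z, square x y r z -> z != x +i* y -> cderivable G z) ->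
  (forall z, square x y r z ->
    (`|complex.Re z - x| == r) || (`|complex.Im z - y| == r) -> normc (G z) <= M) ->
  normc (G (x +i* y)) <= 2 * M.
Proof.
move=> r0 G0 Gd GM; have := mean_value_square r0 G0 Gd.
have Gc a b : `|a - x| <= r -> `|b - y| <= r ->
    (`|a - x| == r) || (`|b - y| == r) ->
    rcont (fun z => normc (G z)) (a +i* b) /\ normc (G (a +i* b)) <= M.
  rewrite !ler_distl => /andP[? ?] /andP[? ?] ab.
  have ne : a +i* b != x +i* y.
    by apply: contraL ab => /eqP[-> ->]; rewrite !subrr normr0 orbb lt_eqF.
  have sq : square x y r (a +i* b) by split => /=; lra.
  by split; [apply/ccont_normc/cderivable_ccont/Gd|exact: GM].
have M0 : 0 <= M.
  have [_] : rcont (fun z => normc (G z)) (x +i* (y + r)) /\ normc (G (x +i* (y + r))) <= M.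
    apply: Gc; rewrite ?subrr ?normr0 ?(ltW r0)// addrAC subrr add0r gtr0_norm ?eqxx ?orbT//.
  by apply: le_trans; exact: normc_ge0.
have nx a : `|a - r - a| = r by rewrite addrAC subrr sub0r normrN gtr0_norm.
have px a : `|a + r - a| = r by rewrite addrAC subrr add0r gtr0_norm.
have H v : v = y - r \/ v = y + r ->
    rint (x - r) (x + r) (fun t => normc (G (t +i* v))) <= 2 * r * M.
  move=> vE; have vs : `|v - y| = r by case: vE => ->.
  have P t : x - r <= t <= x + r -> rcont (fun z => normc (G z)) (t +i* v) /\
      normc (G (t +i* v)) <= M.
    by move=> ti; apply: Gc; rewrite ?vs ?lexx ?eqxx ?orbT// ler_distl.
  have -> : 2 * r * M = rint (x - r) (x + r) (cst M) by rewrite rint_cst; lra.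
  apply: rint_le; [lra| |exact: cst_within_continuous|by move=> t /P[]].
  by apply: (rcont_hor (phi := fun w => normc (G w))) => t /P[].
have V v : v = x - r \/ v = x + r ->
    rint (y - r) (y + r) (fun t => normc (G (v +i* t))) <= 2 * r * M.
  move=> vE; have vs : `|v - x| = r by case: vE => ->.
  have P t : y - r <= t <= y + r -> rcont (fun z => normc (G z)) (v +i* t) /\
      normc (G (v +i* t)) <= M.
    by move=> ti; apply: Gc; rewrite ?vs ?lexx ?eqxx ?orbT// ler_distl.
  have -> : 2 * r * M = rint (y - r) (y + r) (cst M) by rewrite rint_cst; lra.
  apply: rint_le; [lra| |exact: cst_within_continuous|by move=> t /P[]].
  by apply: (rcont_ver (phi := fun w => normc (G w))) => t /P[].
rewrite /perimeter_int.
have := H _ (or_introl erefl); have := H _ (or_intror erefl).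
have := V _ (or_introl erefl); have := V _ (or_intror erefl).
set J1 := rint _ _ _; set J2 := rint _ _ _; set J3 := rint _ _ _.
set J4 := rint _ _ _ => b1 b2 b3 b4 J.
by rewrite -(ler_pM2l r0); lra.
Qed.

(** The maximum principle is applied to the difference quotient of [f] at the center, extended there
    by [l]: on the boundary it is at most [2 * M / r], and the principle doubles this. *)
Lemma cauchy_estimate f x y r M l : 0 < r -> cdiff f (x +i* y) l ->
  (forall z, square x y r z -> cderivable f z) ->
  (forall z, square x y r z -> normc (f z) <= M) ->
  normc l <= 4 * M / r.
Proof.
move=> r0 fl fd fM; set z0 := x +i* y.
pose G z := if z == z0 then l else (f z - f z0) / (z - z0).
have z0s : square x y r z0 by split => /=; lra.
have -> : l = G z0 by rewrite /G eqxx.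
have -> : 4 * M / r = 2 * (2 * M / r) by ring.
apply: (max_principle_square r0).
- move=> e e0; have [d d0 dP] := fl _ (divr_gt0 e0 (ltr0n R 2)).
  exists d => // w wd; rewrite /G eqxx; case: eqVneq => [_|wz].
    by rewrite subrr Normc.normc0.
  have nz : w - z0 != 0 by rewrite subr_eq0.
  have := dP _ wd; rewrite [_ + (w - _)]addrC subrK => H.
  rewrite -(ltr_pM2r (x := normc (w - z0))) ?normc_gt0// -Normc.normcM mulrBl divfK//.
  apply: (le_lt_trans H); rewrite ltr_pM2r ?normc_gt0//; lra.
- move=> z zs zz; apply: (@near_cderivable _ (fun z => (f z - f z0) / (z - z0))).
    exists (normc (z - z0)) => [|w]; first by rewrite normc_gt0 subr_eq0.
    move=> H; rewrite /G; case: eqVneq => // wz; move: H.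
    by rewrite wz normcB ltxx.
  apply: cderivableM.
    by apply: cderivableB; [exact: fd|exact: cderivable_cst].
  apply: cderivableV; first by rewrite subr_eq0.
  by apply: cderivableB; [exact: cderivable_id|exact: cderivable_cst].
- move=> z zs zb; rewrite /G; case: eqVneq => [E|zz].
    move: zb; rewrite E/= !subrr normr0 orbb => /eqP r00.
    by move: r0; rewrite -r00 ltxx.
  have rz : r <= normc (z - z0).
    case: z zs zb zz => a b _ /= /orP[] /eqP <- _.
      exact: (ler_Re_normc ((a +i* b) - z0)).
    exact: (ler_Im_normc ((a +i* b) - z0)).
  rewrite Normc.normcM Normc.normcV ler_pM ?invr_ge0 ?normc_ge0//.
    apply: (le_trans (ler_normcD _ _)); rewrite normc_opp.
    by have := fM _ zs; have := fM _ z0s; lra.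
  by rewrite lef_pV2 ?posrE// (lt_le_trans r0).
Qed.

(* Otherwise [1 / (f - w)] would violate the maximum principle. *)
Lemma square_image f x y r m w : 0 < r ->
  (forall z, square x y r z -> cderivable f z) ->
  (forall z, square x y r z ->
    (`|complex.Re z - x| == r) || (`|complex.Im z - y| == r) -> m <= normc (f z - w)) ->
  2 * normc (f (x +i* y) - w) < m ->
  exists2 z, square x y r z & f z = w.
Proof.
move=> r0 fd fm fw; apply: contrapT => /forall2NP H.
have fwn z : square x y r z -> f z - w != 0.
  by move=> zs; rewrite subr_eq0; apply/eqP; case: (H z).
have z0s : square x y r (x +i* y) by split => /=; lra.
pose G z := (f z - w)^-1.
have Gd z : square x y r z -> cderivable G z.
  move=> zs; apply: cderivableV; first exact: fwn.
  by apply: cderivableB; [exact: fd|exact: cderivable_cst].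
have f0 : 0 < normc (f (x +i* y) - w) by rewrite normc_gt0 fwn.
have m0 : 0 < m by lra.
have B := @max_principle_square G x y r m^-1 r0 (cderivable_ccont (Gd _ z0s))
  (fun z zs _ => Gd z zs).
lapply B => {B}; last first.
  move=> z zs zb; rewrite /G Normc.normcV lef_pV2 ?posrE//; first exact: fm.
  by rewrite normc_gt0 fwn.
rewrite /G Normc.normcV ler_pdivlMr// mulrC ler_pdivrMr//; lra.
Qed.

End MeanValue.

Section DerivativeContinuous.
Variable R : realType.
Local Notation C := R[i].
Local Notation normc := (@Normc.normc R).
Implicit Types (f df : C -> C) (x y r s t : R) (D : set C).

(** Compactness, with a single parameter [t] made uniform over the rectangle. Taking [|f z| <= t^-1]
    for [P t z] gives boundedness, and taking [t] as a modulus of continuity gives uniform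
    continuity. *)
Lemma rect_compact_near a b c d (P : R -> C -> Prop) :
  (forall z, rect a b c d z -> exists2 e : R, 0 < e &
     forall w t, normc (w - z) < e -> 0 < t < e -> P t w) ->
  exists2 t : R, 0 < t & forall z, rect a b c d z -> P t z.
Proof.
move=> H; pose K : set (R * R) := `[a, b] `*` `[c, d].
have cK : compact K by apply: compact_setX; exact: segment_compact.
have K1 : \forall t \near (0 : R)^'+, K `<=` (fun u => P t (u.1 +i* u.2)).
  apply: ((compact_near_coveringP K).1 cK R (0^'+)%R (fun t u => P t (u.1 +i* u.2))).
  move=> [x y] [/= xab ycd].
  have [|e e0 eP] := H (x +i* y).
    by split; [move: xab|move: ycd]; rewrite in_itv.
  exists ([set u : R * R | `|u.1 - x| < e / 2 /\ `|u.2 - y| < e / 2], [set t | 0 < t < e]).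
    split => /=.
      exists ([set u | `|u - x| < e / 2], [set u | `|u - y| < e / 2]) => //=.
      by split; apply/nbhs_normP; exists (e / 2); rewrite //= ?divr_gt0// => u /=;
        rewrite distrC.
    suff : \forall t \near (0 : R)^'+, 0 < t < e by [].
    near=> t; apply/andP; split; near: t; first exact: nbhs_right_gt.
    exact: nbhs_right_lt.
  move=> [[u v] t] [/= [ux vy] te]; apply: eP => //.
  by apply: (le_lt_trans (ler_normc_ReIm _)) => /=; lra.
have /filter_ex[t [t0 tP]] : \forall t \near (0 : R)^'+, 0 < t /\ K `<=` fun u => P t (u.1 +i* u.2).
  near=> t; split; first by near: t; exact: nbhs_right_gt.
  by near: t; exact: K1.
exists t => // -[u v] [/= ui vi]; apply: (tP (u, v)); split => /=; by rewrite in_itv.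
Unshelve. all: by end_near. Qed.

Lemma rect_bounded f a b c d : (forall z, rect a b c d z -> ccont f z) ->
  exists M, forall z, rect a b c d z -> normc (f z) <= M.
Proof.
move=> fc.
have [z /fc/(_ _ ltr01)[e e0 eP]|t t0 tP] :=
    @rect_compact_near a b c d (fun t z => normc (f z) <= t^-1); last by exists t^-1.
have k0 : 0 < normc (f z) + 1 by rewrite ltr_wpDl ?normc_ge0.
exists (Num.min e (normc (f z) + 1)^-1); first by rewrite lt_min e0 invr_gt0.
move=> w t; rewrite lt_min => /andP[/eP fw _] /andP[t0].
rewrite lt_min => /andP[_ tk].
have : normc (f z) + 1 <= t^-1 by rewrite -[leLHS]invrK lef_pV2 ?posrE ?invr_gt0// ltW.
by have := ler_normcB (f w) (f z); lra.
Qed.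

Lemma rect_uniform f a b c d e : 0 < e -> (forall z, rect a b c d z -> ccont f z) ->
  exists2 t : R, 0 < t & forall z h, rect a b c d z -> normc h < t ->
    normc (f (z + h) - f z) <= e.
Proof.
move=> e0 fc; have e20 : 0 < e / 2 by rewrite divr_gt0.
have [z /fc/(_ _ e20)[d0 d00 dP]|t t0 tP] := @rect_compact_near a b c d
    (fun t z => forall h, normc h < t -> normc (f (z + h) - f z) <= e); last first.
  by exists t => // z h zr; exact: tP.
exists (d0 / 2); first by rewrite divr_gt0.
move=> w t wz /andP[t0 td] h ht.
have := dP w; have := dP (w + h).
have -> : w + h - z = w - z + h by ring.
move=> /(_ _) H1 /(_ _) H2.
have {}H1 : normc (f (w + h) - f z) < e / 2.
  by apply: H1; apply: (le_lt_trans (ler_normcD _ _)); lra.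
have {}H2 : normc (f w - f z) < e / 2 by apply: H2; lra.
have -> : f (w + h) - f w = (f (w + h) - f z) + - (f w - f z) by ring.
by apply: (le_trans (ler_normcD _ _)); rewrite normc_opp; lra.
Qed.

Definition copen D := forall z, D z -> exists2 d : R, 0 < d &
  forall w, normc (w - z) < d -> D w.

(** For a small shift [h], the function [u |-> f (u + h) - f u] is uniformly small on a square
    around the point, and its derivative at the center is [df (z + h) - df z]. Cauchy's estimate
    makes that derivative small too. *)
Lemma derivative_ccont f df D : copen D -> (forall z, D z -> cdiff f z (df z)) ->
  forall z, D z -> ccont df z.
Proof.
move=> Do fd [x y] Dz e e0; have [d d0 dP] := Do _ Dz.
pose r := d / 4; have r0 : 0 < r by rewrite divr_gt0.
have sqD w h : square x y r w -> normc h < r -> D (w + h).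
  case: w => u v [/= uP vP] hr; apply: dP.
  have -> : (u +i* v) + h - (x +i* y) = ((u - x) +i* (v - y)) + h.
    by case: h {hr} => h1 h2; apply/eqP; rewrite eq_complex/=; apply/andP; split; apply/eqP; ring.
  apply: (le_lt_trans (ler_normcD _ _)).
  have := ler_normc_ReIm ((u - x) +i* (v - y)); rewrite /=.
  have : `|u - x| <= r by rewrite ler_distl; lra.
  have : `|v - y| <= r by rewrite ler_distl; lra.
  by rewrite /r in hr *; lra.
have sqD0 w : square x y r w -> D w.
  by move=> ws; rewrite -[w]addr0; apply: sqD => //; rewrite Normc.normc0.
have e'0 : 0 < e * r / 8 by rewrite divr_gt0// mulr_gt0.
have [|t t0 tP] := @rect_uniform f (x - r) (x + r) (y - r) (y + r) _ e'0.
  by move=> z /sqD0/fd/cdiff_ccont.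
exists (Num.min t r); first by rewrite lt_min t0.
move=> w; rewrite lt_min; set h := w - (x +i* y) => /andP[ht hr].
have wE : w = (x +i* y) + h by rewrite /h addrC subrK.
have zs : square x y r (x +i* y) by split => /=; lra.
have := @cauchy_estimate R (fun u => f (u + h) - f u) x y r (e * r / 8)
   (df w - df (x +i* y)) r0.
have -> : 4 * (e * r / 8) / r = e / 2 by field; rewrite gt_eqF.
move=> H; suff : normc (df w - df (x +i* y)) <= e / 2 by lra.
have fD u : square x y r u -> cdiff (fun u => f (u + h) - f u) u (df (u + h) - df u).
  move=> us; apply: cdiffB; last exact/fd/sqD0.
  by apply: cdiff_shift; apply: fd; exact: sqD.
apply: H.
- by rewrite wE; exact: fD.
- by move=> z /fD; exists (df (z + h) - df z).
- by move=> z zs'; exact: tP.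
Qed.

End DerivativeContinuous.

(** * The growth estimate *)

Section PlaneMeasurability.
Variable R : realType.
Local Notation C := R[i].
Local Notation normc := (@Normc.normc R).
Implicit Types (D : set C) (phi : C -> R).

Local Notation cpair := (@complex_of_pair R).

(** Measurability on [R * R] refers to the product sigma-algebra, so the open set is exhibited as
    the countable union of the boxes with rational ends that it contains. *)
Lemma copen_measurable D : copen D -> measurable (cpair @^-1` D).
Proof.
move=> Do.
pose box (q : rat * rat * (rat * rat)) : set (R * R) :=
  `]ratr q.1.1, ratr q.1.2[%classic `*` `]ratr q.2.1, ratr q.2.2[%classic.
pose F q := if `[< box q `<=` cpair @^-1` D >] then box q else set0.
have -> : cpair @^-1` D = \bigcup_q F q.
  apply/seteqP; split => [[x y] /= Dxy|u [q _]]; last first.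
    by rewrite /F; case: asboolP => // H /H.
  have [d d0 dP] := Do _ Dxy; have d20 : 0 < d / 2 by rewrite divr_gt0.
  have e (u : R) : u - d / 2 < u < u + d / 2 by lra.
  have /andP[x1 x2] := e x; have /andP[y1 y2] := e y.
  have [a /[!in_itv]/= /andP[a1 a2]] := rat_in_itvoo x1.
  have [b /[!in_itv]/= /andP[b1 b2]] := rat_in_itvoo x2.
  have [a' /[!in_itv]/= /andP[a'1 a'2]] := rat_in_itvoo y1.
  have [b' /[!in_itv]/= /andP[b'1 b'2]] := rat_in_itvoo y2.
  exists ((a, b), (a', b')) => //; rewrite /F; case: asboolP.
    by move=> _; split; rewrite /= in_itv/=; apply/andP.
  case=> -[u v] [/= /[!in_itv]/= /andP[u1 u2] /andP[v1 v2]]; apply: dP.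
  apply: (le_lt_trans (ler_normc_ReIm _)) => /=.
  have H1 : `|u - x| < d / 2 by rewrite ltr_distl; lra.
  have H2 : `|v - y| < d / 2 by rewrite ltr_distl; lra.
  lra.
apply: countable_bigcupT_measurable => [|q]; first exact: countableP.
rewrite /F; case: asboolP => // _.
by apply: measurableX; exact: measurable_itv.
Qed.

Lemma rcont_measurable_fun D phi : copen D -> (forall z, D z -> rcont phi z) ->
  measurable_fun (cpair @^-1` D) (phi \o cpair).
Proof.
move=> Do pc; apply: (measurability _ (RGenOInfty.measurableE R)) => //.
move=> _ [_ [a ->] <-].
have -> : cpair @^-1` D `&` (phi \o cpair) @^-1` `]a, +oo[ =
    cpair @^-1` (D `&` [set z | a < phi z]).
  by apply/seteqP; split => u /=; rewrite in_itv/= andbT.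
apply: copen_measurable => z [Dz az].
have [d d0 dP] := Do _ Dz; have az0 : 0 < phi z - a by rewrite subr_gt0.
have [d' d'0 d'P] := pc _ Dz _ az0.
exists (Num.min d d'); first by rewrite lt_min d0.
move=> w; rewrite lt_min => /andP[/dP Dw /d'P]; rewrite ltr_distl => /andP[? _].
by split => //=; lra.
Qed.

Lemma unit_diskE z : unit_disk z <-> normc z < 1.
Proof. by rewrite /unit_disk/= normr_normc ltcR. Qed.

Lemma unit_disk_open : copen (@unit_disk R).
Proof.
move=> z /unit_diskE z1; exists (1 - normc z); first by rewrite subr_gt0.
move=> w wz; apply/unit_diskE; have := ler_normcD (w - z) z.
by rewrite subrK; lra.
Qed.

End PlaneMeasurability.

Section LebesgueInvariance.
Variable R : realType.
Local Notation mu := (@lebesgue_measure R).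
Local Open Scope ereal_scope.

Lemma measurable_shift (c : R) :
  measurable_fun [set: measurableTypeR R] (fun s => c + s : measurableTypeR R)%R.
Proof. by apply: measurable_funD => //; exact: measurable_cst. Qed.

Lemma lebesgue_measureD (c : R) (A : set R) : measurable A ->
  pushforward mu (fun s => c + s : measurableTypeR R)%R A = mu A.
Proof.
move=> mA; apply/esym/lebesgue_measure_unique => //=.
  exact: measurable_shift.
move=> mshift _ [[a b]] _ <-.
rewrite /pushforward.
have -> : (fun s => c + s)%R @^-1` `]a, b] = `](a - c)%R, (b - c)%R]%classic.
  apply/seteqP; split => x /=; rewrite !in_itv/=.
    by move=> ?; apply/andP; split; lra.
  by move=> ?; apply/andP; split; lra.
rewrite !lebesgue_measure_itv/= !lte_fin ltrD2r; case: ifP => // _.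
by rewrite -!EFinD; congr (_%:E); lra.
Qed.

Lemma ge0_integral_comp_invariant (phi : measurableTypeR R -> measurableTypeR R)
    (T : R -> \bar R) : measurable_fun setT phi ->
  (forall A, measurable A -> pushforward mu phi A = mu A) ->
  measurable_fun setT T -> (forall s, 0 <= T s) ->
  \int[mu]_s T (phi s) = \int[mu]_s T s.
Proof.
move=> mphi phimu mT T0.
rewrite -[LHS](@ge0_integral_pushforward _ _ (measurableTypeR R)
  (measurableTypeR R) R phi mphi mu setT T)//.
pose m := measure_function_pushforward__canonical__measure_function_Measure mu mphi.
by apply: (@eq_measure_integral _ _ _ _ mu m) => A mA _; exact: phimu.
Qed.

Lemma ge0_integralD_shift (c : R) (T : R -> \bar R) : measurable_fun setT T ->
  (forall s, 0 <= T s) -> \int[mu]_s T (c + s)%R = \int[mu]_s T s.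
Proof.
apply: (ge0_integral_comp_invariant (phi := fun s => c + s)%R).
  exact: measurable_shift.
exact: lebesgue_measureD.
Qed.

Lemma ge0_integralN (T : R -> \bar R) : measurable_fun setT T ->
  (forall s, 0 <= T s) -> \int[mu]_s T (- s)%R = \int[mu]_s T s.
Proof.
apply: (ge0_integral_comp_invariant (phi := fun s => - s)%R).
  exact: measurableT_comp.
exact: lebesgue_measureN.
Qed.

Lemma ge0_integralB_shift (c : R) (T : R -> \bar R) : measurable_fun setT T ->
  (forall s, 0 <= T s) -> \int[mu]_s T (c - s)%R = \int[mu]_s T s.
Proof.
move=> mT T0; rewrite -[RHS](ge0_integralD_shift c)//.
rewrite -(ge0_integralN (T := fun s => T (c + s)%R))//.
by apply: measurableT_comp => //; exact: measurable_shift.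
Qed.

End LebesgueInvariance.

Section AreaMean.
Variable R : realType.
Local Notation C := R[i].
Local Notation normc := (@Normc.normc R).
Local Notation cpair := (@complex_of_pair R).
Local Notation mu := (@lebesgue_measure R).
Local Notation mu2 := ((@lebesgue_measure R) \x (@lebesgue_measure R))%E.
Implicit Types (f : C -> C) (D : set C) (x y r s t : R).

Lemma squareE x y r : cpair @^-1` (square x y r) =
  `[x - r, x + r]%classic `*` `[y - r, y + r]%classic.
Proof. by apply/seteqP; split => -[u v] /=; rewrite !in_itv. Qed.

Lemma measurable_square x y r : measurable (cpair @^-1` (square x y r)).
Proof. by rewrite squareE; apply: measurableX; exact: measurable_itv. Qed.

Lemma square_area x y r : 0 <= r -> mu2 (cpair @^-1` (square x y r)) = (4 * r ^+ 2)%:E.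
Proof.
move=> r0; rewrite squareE.
have I c : mu `[c - r, c + r]%classic = (2 * r)%:E.
  rewrite lebesgue_measure_itv/= lte_fin.
  move: r0; rewrite le_eqVlt => /predU1P[<-|r0].
    by rewrite subr0 addr0 ltxx mulr0.
  have -> : c - r < c + r by lra.
  by rewrite -EFinD; congr (_%:E); ring.
apply: etrans.
  by apply: product_measure1E; exact: measurable_itv.
transitivity ((2 * r)%:E * (2 * r)%:E)%E; first by congr (_ * _)%E; exact: I.
by rewrite -EFinM; congr (_%:E); ring.
Qed.

Lemma rint_EFin a b (h : R -> R) : {within `[a, b], continuous h} ->
  (rint a b h)%:E = (\int[mu]_(t in `[a, b]) (h t)%:E)%E.
Proof.
move=> hc; rewrite /rint /Rintegral fineK//; apply: integrable_fin_num => //.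
exact: rint_integrable.
Qed.

(** The perimeter inequality is integrated over the half-sides [s] from [r / 2] to [r]. Each of the
    four sides sweeps out a part of the square, so by Tonelli's theorem and the invariance of
    Lebesgue measure under [s |-> c + s] and [s |-> c - s] it contributes at most [j]. On the left,
    [4 * s >= 2 * r] over a range of length [r / 2] gives [r^2]. *)
Lemma area_mean f D x y r (j : R) : copen D -> (forall z, D z -> cderivable f z) ->
  square x y r `<=` D -> 0 < r ->
  (\int[mu2]_(u in cpair @^-1` (square x y r)) (normc (f (cpair u)))%:E <= j%:E)%E ->
  r ^+ 2 * normc (f (x +i* y)) <= 4 * j.
Proof.
move=> Do fd SD r0 Hj.
set S := cpair @^-1` _ in Hj.
pose g : R * R -> \bar R := (fun u => (normc (f (cpair u)))%:E) \_ S.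
have mS : measurable S by exact: measurable_square.
have mf : measurable_fun (cpair @^-1` D) (normc \o f \o cpair).
  by apply: rcont_measurable_fun => // z /fd/cderivable_ccont/ccont_normc.
have mg : measurable_fun setT g.
  apply/(measurable_restrictT _ mS)/measurable_EFinP.
  apply: measurable_funS mf; first exact: copen_measurable.
  by move=> u; exact: SD.
have g0 u : (0 <= g u)%E.
  by rewrite /g patchE; case: ifP => // _; rewrite lee_fin normc_ge0.
have {}Hj : (\int[mu2]_u g u <= j%:E)%E by rewrite /g -integral_mkcond.
pose T1 v := (\int[mu]_t g (t, v))%E.
pose T2 v := (\int[mu]_t g (v, t))%E.
have mT1 : measurable_fun setT T1 by exact: measurable_fun_fubini_tonelli_G.
have mT2 : measurable_fun setT T2 by exact: measurable_fun_fubini_tonelli_F.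
have T10 v : (0 <= T1 v)%E by exact: integral_ge0.
have T20 v : (0 <= T2 v)%E by exact: integral_ge0.
have iT1 : (\int[mu]_v T1 v <= j%:E)%E by rewrite /T1 -fubini_tonelli2.
have iT2 : (\int[mu]_v T2 v <= j%:E)%E by rewrite /T2 -fubini_tonelli1.
have fcont z : square x y r z -> rcont (normc \o f) z.
  by move=> /SD/fd/cderivable_ccont/ccont_normc.
have rT1 s v : s <= r -> y - r <= v <= y + r ->
    ((rint (x - s) (x + s) (fun t => normc (f (t +i* v))))%:E <= T1 v)%E.
  move=> sr vi.
  have hc : {within `[x - s, x + s], continuous (fun t => normc (f (t +i* v)))}.
    apply: (rcont_hor (phi := normc \o f)) => t ti.
    by apply: fcont; split => /=; lra.
  rewrite rint_EFin// integral_mkcond; apply: ge0_le_integral => //.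
  - by move=> t _; rewrite patchE; case: ifP => // _; rewrite lee_fin normc_ge0.
  - apply/(measurable_restrictT _ (measurable_itv _)).
    exact: (measurable_int mu (rint_integrable hc)).
  - exact: measurableT_comp mg (pair2_measurable _).
  - move=> t _; rewrite /g !patchE; case: ifPn => [/[!inE]/=|_]; last first.
      by case: ifP => // _; rewrite lee_fin normc_ge0.
    rewrite in_itv/= => ti; rewrite mem_set//; split => /=; lra.
have rT2 s v : s <= r -> x - r <= v <= x + r ->
    ((rint (y - s) (y + s) (fun t => normc (f (v +i* t))))%:E <= T2 v)%E.
  move=> sr vi.
  have hc : {within `[y - s, y + s], continuous (fun t => normc (f (v +i* t)))}.
    apply: (rcont_ver (phi := normc \o f)) => t ti.
    by apply: fcont; split => /=; lra.
  rewrite rint_EFin// integral_mkcond; apply: ge0_le_integral => //.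
  - by move=> t _; rewrite patchE; case: ifP => // _; rewrite lee_fin normc_ge0.
  - apply/(measurable_restrictT _ (measurable_itv _)).
    exact: (measurable_int mu (rint_integrable hc)).
  - exact: measurableT_comp mg (pair1_measurable _).
  - move=> t _; rewrite /g !patchE; case: ifPn => [/[!inE]/=|_]; last first.
      by case: ifP => // _; rewrite lee_fin normc_ge0.
    rewrite in_itv/= => ti; rewrite mem_set//; split => /=; lra.
have per s : r / 2 <= s <= r -> ((2 * r * normc (f (x +i* y)))%:E <=
    (T1 (y - s)%R + T1 (y + s)%R) + (T2 (x + s)%R + T2 (x - s)%R))%E.
  move=> /andP[rs sr]; have s0 : 0 < s by lra.
  have zs z : square x y s z -> D z.
    by case: z => u v [/= ? ?]; apply: SD; split => /=; lra.
  have z0s : square x y s (x +i* y) by split => /=; lra.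
  have := mean_value_square s0 (cderivable_ccont (fd _ (zs _ z0s))).
  move=> H; lapply H => {H} [H|z /zs/fd //].
  apply: (@le_trans _ _ (perimeter_int (fun z => normc (f z)) x y s)%:E).
    rewrite lee_fin; apply: le_trans H.
    by apply: ler_wpM2r; [exact: normc_ge0|lra].
  rewrite /perimeter_int !EFinD; apply: leeD; apply: leeD.
  - by apply: rT1; lra.
  - by apply: rT1; lra.
  - by apply: rT2; lra.
  - by apply: rT2; lra.
have mB T c : measurable_fun setT T -> measurable_fun setT (fun s => T (c - s) : \bar R).
  move=> mT; apply: measurableT_comp => //.
  by apply: measurable_funB => //; exact: measurable_cst.
have mD T c : measurable_fun setT T -> measurable_fun setT (fun s => T (c + s) : \bar R).
  move=> mT; apply: measurableT_comp => //.
  by apply: measurable_funD => //; exact: measurable_cst.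
rewrite -lee_fin.
apply: (@le_trans _ _ (\int[mu]_(s in `[(r / 2)%R, r]) (2 * r * normc (f (x +i* y)))%:E)%E).
  rewrite integral_cst//= lebesgue_measure_itv/= lte_fin.
  have -> : r / 2 < r by lra.
  rewrite -EFinD -EFinM lee_fin le_eqVlt; apply/orP; left; apply/eqP.
  by field.
apply: (@le_trans _ _ (\int[mu]_s
    ((T1 (y - s)%R + T1 (y + s)%R) + (T2 (x + s)%R + T2 (x - s)%R)))%E).
  rewrite integral_mkcond; apply: ge0_le_integral => //.
  - move=> t _; rewrite patchE; case: ifP => // _.
    by rewrite lee_fin mulr_ge0 ?normc_ge0// mulr_ge0// ltW.
  - by apply/(measurable_restrictT _ (measurable_itv _)); exact: measurable_cst.
  - by apply: emeasurable_funD; apply: emeasurable_funD; [exact: mB|exact: mD|exact: mD|exact: mB].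
  - move=> t _; rewrite patchE; case: ifPn => [/[!inE]/=|_].
      by rewrite in_itv/=; exact: per.
    by apply: adde_ge0; apply: adde_ge0.
clear per rT1 rT2; clearbody T1 T2.
rewrite !ge0_integralD//; first last.
all: try by [exact: mB|exact: mD].
all: try by apply: emeasurable_funD; [exact: mB|exact: mD].
all: try by apply: emeasurable_funD; [exact: mD|exact: mB].
all: try by move=> *; apply: adde_ge0.
rewrite (ge0_integralB_shift y mT1 T10) (ge0_integralD_shift y mT1 T10).
rewrite (ge0_integralB_shift x mT2 T20) (ge0_integralD_shift x mT2 T20).
apply: (@le_trans _ _ ((j%:E + j%:E) + (j%:E + j%:E))%E).
  by apply: leeD; apply: leeD.
by rewrite -!EFinD lee_fin; lra.
Qed.

End AreaMean.

Section Growth.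
Variable R : realType.
Local Notation C := R[i].
Local Notation normc := (@Normc.normc R).
Local Notation cpair := (@complex_of_pair R).
Local Notation mu := (@lebesgue_measure R).
Local Notation mu2 := ((@lebesgue_measure R) \x (@lebesgue_measure R))%E.
Implicit Types (f : C -> C) (D : set C) (x y r s t q : R).

(** Beyond [l] one has [(t / l)^q >= 1], hence [t <= K <= K * (t / l)^q]. This is how a bounded
    quantity is controlled by its [q]-th power for every positive [q], at the price of a small
    constant [l] to be absorbed later. *)
Lemma powR_interp q l K t : 0 < q -> 0 < l -> 0 <= t <= K ->
  t <= l + K * l `^ (- q) * t `^ q.
Proof.
move=> q0 l0 /andP[t0 tK].
have K0 : 0 <= K by apply: le_trans tK.
case: (leP t l) => [tl|lt].
  by rewrite (le_trans tl)// lerDl !mulr_ge0// powR_ge0.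
apply: (le_trans tK); apply: ler_wpDl; first exact: ltW.
rewrite -mulrA ler_peMr// powRN mulrC ler_pdivlMr ?powR_gt0// mul1r.
by apply: ge0_ler_powR; rewrite ?nnegrE ?(ltW q0) ?(ltW l0)// ltW.
Qed.

Lemma powR_comparable (a b e : R) : 0 < a -> a / 4 <= b -> b <= 4 * a ->
  a `^ e <= 4 `^ `|e| * b `^ e.
Proof.
move=> a0 ab ba; have b0 : 0 < b by apply: lt_le_trans ab; rewrite divr_gt0.
have [e0|e0] := leP 0 e.
  rewrite ger0_norm// -powRM ?(ltW b0)//.
  by apply: ge0_ler_powR; rewrite ?nnegrE//; lra.
rewrite ltr0_norm// -[e in a `^ e]opprK -[e in b `^ e]opprK [a `^ _]powRN [b `^ _]powRN.
rewrite ler_pdivlMr ?powR_gt0// mulrC ler_pdivrMr ?powR_gt0//.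
rewrite -powRM ?(ltW a0)//; apply: ge0_ler_powR; rewrite ?nnegrE//; lra.
Qed.

(* A point almost maximizing [|f z| * dist(z, boundary)^(2/q)] has a neighborhood
   on which [|f|] is at most a constant times its value there, so that the mean
   value inequality for [|f|] yields one for [|f|^q], even for [q < 1]. *)
Lemma area_power_mean q : 0 < q -> exists2 c : R, 0 < c &
  forall f D x y r (j : R), copen D -> (forall z, D z -> cderivable f z) ->
  square x y r `<=` D -> 0 < r ->
  (\int[mu2]_(u in cpair @^-1` (square x y r)) (normc (f (cpair u)) `^ q)%:E <= j%:E)%E ->
  r ^+ 2 * normc (f (x +i* y)) `^ q <= c * j.
Proof.
move=> q0; pose s : R := 2 / q; have s0 : 0 < s by rewrite divr_gt0.
have s_neq0 : s != 0 by rewrite gt_eqF.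
have sq2 : s * q = 2%:R by rewrite divfK// gt_eqF.
(* [K] bounds [|f| / M] on the half-size square around the near-maximizer: a factor 2 comes from
   near-maximality and [2^s] from halving the distance to the boundary. That square has area [d^2],
   so after the factor 4 of [area_mean] the term with [l = 1/32] is [M * d^2 / 8], half of the
   left-hand side [(d / 2)^2 * M]. *)
pose K : R := 2 * 2 `^ s; pose l : R := 32^-1; pose c : R := K * l `^ (- q).
have l0 : 0 < l by rewrite invr_gt0.
have c0 : 0 < c by rewrite !mulr_gt0// powR_gt0.
exists (2 `^ q * (32 * c)); first by rewrite !mulr_gt0// powR_gt0.
move=> f D x y r j Do fd SD r0 Hj.
have j0 : 0 <= j.
  rewrite -lee_fin; apply: le_trans Hj; apply: integral_ge0 => u _.
  by rewrite lee_fin powR_ge0.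
have [fz0|fz0] := eqVneq (normc (f (x +i* y))) 0.
  by rewrite fz0 powR0 ?gt_eqF// mulr0 !mulr_ge0// ?powR_ge0// ltW.
(* The sup-norm distance to the center, so that [r - m z] is the distance to the boundary of the
   square. *)
pose m (z : C) := Num.max `|complex.Re z - x| `|complex.Im z - y|.
have msq z : square x y r z <-> m z <= r.
  case: z => u v; rewrite /m ge_max !ler_distl; split => /= [[-> ->]//|/andP[]].
  by [].
pose phi z := normc (f z) * (r - m z) `^ s.
pose E := [set phi z | z in square x y r].
have [B BP] : exists B, forall z, square x y r z -> normc (f z) <= B.
  by apply: rect_bounded => z zs; apply/cderivable_ccont/fd/SD.
have m0 z : 0 <= m z by rewrite le_max normr_ge0.
have z0s : square x y r (x +i* y) by split => /=; lra.
have mz0 : m (x +i* y) = 0 by rewrite /m/= !subrr normr0 maxxx.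
have phi0 : 0 < phi (x +i* y).
  rewrite /phi mz0 subr0 mulr_gt0 ?powR_gt0//.
  by rewrite lt_def fz0 normc_ge0.
have sE : has_sup E.
  split; first by exists (phi (x +i* y)), (x +i* y).
  exists (B * r `^ s) => _ [z zs <-]; rewrite /phi ler_pM ?normc_ge0 ?powR_ge0 ?BP//.
  move/msq in zs; have := m0 z => mz.
  by apply: ge0_ler_powR; rewrite ?nnegrE ?(ltW s0) ?(ltW r0)//; lra.
pose N := sup E.
have leN z : square x y r z -> phi z <= N.
  by move=> zs; apply: ub_le_sup; [case: sE|exists z].
have N0 : 0 < N by apply: lt_le_trans (leN _ z0s).
have N20 : 0 < N / 2 by rewrite divr_gt0.
have [_ [[a b] zs <-] zN] := sup_adherent N20 sE.
set zeta := a +i* b in zs zN.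
have {}zN : N < 2 * phi zeta by rewrite -/N in zN; lra.
pose M := normc (f zeta); pose d := r - m zeta.
have d0 : 0 < d.
  rewrite lt_def subr_ge0 -/(_ <= _) (msq zeta).1// andbT.
  apply/eqP => d0; move: zN; rewrite /phi -/d d0 powR0// mulr0 mulr0.
  by apply/negP; rewrite -leNgt ltW.
have M0 : 0 < M.
  rewrite lt_def normc_ge0 andbT; apply/eqP => M0; move: zN.
  by rewrite /phi -/M M0 mul0r mulr0; apply/negP; rewrite -leNgt ltW.
have d20 : 0 < d / 2 by rewrite divr_gt0.
have mw w : square a b (d / 2) w -> d / 2 <= r - m w.
  case: w => u v [/= ua vb]; rewrite lerBrDr -lerBrDl.
  have : m zeta = r - d by rewrite /d; ring.
  move=> mE; have : `|a - x| <= m zeta by rewrite /m le_max lexx.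
  have : `|b - y| <= m zeta by rewrite /m le_max lexx orbT.
  by rewrite mE /m ge_max/= !ler_distl => /andP[? ?] /andP[? ?]; apply/andP; split;
    apply/andP; split; lra.
have Ssub w : square a b (d / 2) w -> square x y r w.
  by move=> /mw ws; apply/msq; lra.
have fK w : square a b (d / 2) w -> normc (f w) / M <= K.
  move=> ws; rewrite ler_pdivrMr//.
  have d2s : 0 < (d / 2) `^ s by rewrite powR_gt0.
  rewrite -(ler_pM2r d2s).
  have -> : K * M * (d / 2) `^ s = 2 * (M * d `^ s).
    have -> : d `^ s = 2 `^ s * (d / 2) `^ s.
      by rewrite -powRM// ?(ltW d20)//; congr (_ `^ _); field.
    by rewrite /K; ring.
  apply: le_trans (ltW zN); apply: le_trans (leN w (Ssub w ws)).
  rewrite /phi ler_wpM2l ?normc_ge0//; apply: ge0_ler_powR; rewrite ?nnegrE ?(ltW s0)//.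
  - exact: ltW.
  - by apply: le_trans (mw w ws); exact: ltW.
  - exact: mw.
pose A := c * M / M `^ q.
have A0 : 0 <= A by rewrite divr_ge0 ?powR_ge0// mulr_ge0// ltW.
have fA w : square a b (d / 2) w -> normc (f w) <= l * M + A * normc (f w) `^ q.
  move=> ws; have t0 : 0 <= normc (f w) / M by rewrite divr_ge0 ?normc_ge0// ltW.
  have := @powR_interp q l K (normc (f w) / M) q0 l0.
  rewrite t0 (fK _ ws) => /(_ erefl).
  rewrite -(ler_pM2r M0) divfK ?gt_eqF// => /le_trans; apply.
  rewrite mulrDl lerD2l /A -/c powRM ?normc_ge0 ?invr_ge0 ?(ltW M0)//.
  have -> : M^-1 `^ q = (M `^ q)^-1.
    by rewrite -[M^-1]powR_inv1 ?(ltW M0)// -powRrM mulN1r powRN.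
  by rewrite le_eqVlt; apply/orP; left; apply/eqP; ring.
have mS : measurable (cpair @^-1` (square a b (d / 2))) by exact: measurable_square.
have mf : measurable_fun (cpair @^-1` (square a b (d / 2))) (normc \o f \o cpair).
  apply: (@measurable_funS _ _ _ _ (cpair @^-1` D)).
  - exact: copen_measurable.
  - by move=> u /Ssub /SD.
  - by apply: rcont_measurable_fun => // z /fd/cderivable_ccont/ccont_normc.
have mfq : measurable_fun (cpair @^-1` (square a b (d / 2)))
    (fun u => normc (f (cpair u)) `^ q).
  by apply: (measurableT_comp (measurable_powR q)) => //.
have SD' : square a b (d / 2) `<=` D by move=> w /Ssub /SD.
have := @area_mean _ f D a b (d / 2) (l * M * d ^+ 2 + A * j) Do fd SD' d20.
move=> H; lapply H => {H} [H|]; last first.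
  apply: (@le_trans _ _ (\int[mu2]_(u in cpair @^-1` (square a b (d / 2)))
     ((l * M)%:E + A%:E * (normc (f (cpair u)) `^ q)%:E))%E).
    apply: ge0_le_integral => //.
    - by move=> u _; rewrite lee_fin normc_ge0.
    - exact/measurable_EFinP.
    - apply: emeasurable_funD; first exact: measurable_cst.
      by apply: emeasurable_funM; [exact: measurable_cst|exact/measurable_EFinP].
    - by move=> u us; rewrite -EFinM -EFinD lee_fin; exact: fA.
  rewrite ge0_integralD//; last 3 first.
  - by move=> u _; rewrite lee_fin mulr_ge0// ltW.
  - by move=> u _; rewrite -EFinM lee_fin mulr_ge0// powR_ge0.
  - by apply: emeasurable_funM; [exact: measurable_cst|exact/measurable_EFinP].
  rewrite EFinD; apply: leeD.
    apply: (@le_trans _ _ ((l * M)%:E * mu2 (cpair @^-1` (square a b (d / 2))))%E).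
      by rewrite integral_cst.
    rewrite square_area ?(ltW d20)// -EFinM lee_fin.
    by rewrite le_eqVlt; apply/orP; left; apply/eqP; field.
  rewrite ge0_integralZl//; last 2 first.
  - exact/measurable_EFinP.
  - by move=> u _; rewrite lee_fin powR_ge0.
  rewrite (EFinM A j); apply: lee_wpmul2l; first by rewrite lee_fin.
  apply: le_trans Hj; apply: ge0_subset_integral => //.
  - exact: measurable_square.
  - apply/measurable_EFinP; apply: (measurableT_comp (measurable_powR q)).
    apply: (@measurable_funS _ _ _ _ (cpair @^-1` D)).
    + exact: copen_measurable.
    + by move=> u /SD.
    + by apply: (rcont_measurable_fun (phi := normc \o f)) => // z /fd/cderivable_ccont/ccont_normc.
  - by move=> u _; rewrite lee_fin powR_ge0.
  - by move=> u /Ssub.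
have {H} Md : M `^ q * d ^+ 2 <= 32 * c * j.
  have Mq : 0 < M `^ q by rewrite powR_gt0.
  rewrite mulrC -ler_pdivlMr//.
  rewrite -(ler_pM2l M0).
  have -> : M * (32 * c * j / M `^ q) = 32 * (A * j) by rewrite /A; ring.
  by move: H; rewrite -/zeta -/M /l; nra.
(* Since [s * q = 2], the [q]-th power of [phi] is [|f|^q] times the squared distance to the
   boundary; the estimate at [zeta] thus passes to the center through the supremum [N]. *)
have -> : r ^+ 2 * normc (f (x +i* y)) `^ q = phi (x +i* y) `^ q.
  rewrite /phi mz0 subr0 powRM ?normc_ge0 ?powR_ge0// -powRrM sq2 powR_mulrn ?(ltW r0)//.
  by rewrite mulrC.
apply: (@le_trans _ _ ((2 * (M * d `^ s)) `^ q)).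
  apply: ge0_ler_powR; rewrite ?nnegrE ?(ltW q0) ?(ltW phi0)//.
    by rewrite !mulr_ge0// ?powR_ge0// ltW.
  by apply: (le_trans (leN _ z0s)); exact: ltW.
rewrite powRM// ?mulr_ge0 ?powR_ge0 ?(ltW M0)// powRM ?powR_ge0 ?(ltW M0)//.
rewrite -[(d `^ s) `^ q]powRrM sq2 powR_mulrn ?(ltW d0)// -mulrA.
by rewrite ler_wpM2l ?powR_ge0.
Qed.

Definition dweight (z : C) : R := 1 - normc z ^+ 2.

Lemma dweight_gt0 z : unit_disk z -> 0 < dweight z.
Proof.
by move=> /unit_diskE z1; rewrite subr_gt0 expr_lt1 ?normc_ge0.
Qed.

Lemma dweight_le1 z : dweight z <= 1.
Proof. by rewrite /dweight lerBlDr lerDl sqr_ge0. Qed.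

Lemma dweightE x y : dweight (x +i* y) = 1 - x ^+ 2 - y ^+ 2.
Proof. by rewrite /dweight normcE2/= opprD addrA. Qed.

Lemma unit_diskW z : 0 < dweight z -> unit_disk z.
Proof.
by rewrite subr_gt0 expr_lt1 ?normc_ge0// => H; apply/unit_diskE.
Qed.

(** Within the square each squared coordinate changes by at most [(W / 8) * (9 / 4) = 9 W / 32], so
    the weight changes by at most [9 W / 16]. *)
Lemma dweight_square x y : unit_disk (x +i* y) -> forall w,
  square x y (dweight (x +i* y) / 8) w ->
  dweight (x +i* y) / 4 <= dweight w /\ dweight w <= 4 * dweight (x +i* y).
Proof.
move=> /dweight_gt0; set W := dweight _ => W0 [u v] [/= uP vP].
have WE : W = 1 - x ^+ 2 - y ^+ 2 by exact: dweightE.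
rewrite dweightE.
have x1 : -1 <= x <= 1 by have := sqr_ge0 y; nra.
have y1 : -1 <= y <= 1 by have := sqr_ge0 x; nra.
have W1 : W <= 1 by exact: dweight_le1.
have step (a b : R) : -1 <= a <= 1 -> a - W / 8 <= b <= a + W / 8 ->
    - (W * 9 / 32) <= b ^+ 2 - a ^+ 2 <= W * 9 / 32.
  move=> a1 bP; have -> : b ^+ 2 - a ^+ 2 = (b - a) * (b - a + 2 * a) by ring.
  have : `|b - a| <= W / 8 by rewrite ler_distl.
  have : `|b - a + 2 * a| <= 9 / 4 by rewrite ler_norml; lra.
  move=> h2 h1; rewrite -ler_norml normrM.
  apply: le_trans (ler_pM _ _ h1 h2) _ => //; lra.
have := step _ _ x1 uP; have := step _ _ y1 vP.
by move=> /andP[? ?] /andP[? ?]; split; lra.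
Qed.

(** On the square of half-side [W / 8] the weight is within a factor 4 of [W], so the integral of
    [|f|^q] there is at most a multiple of [J / W^b]; the squared half-side supplies the remaining
    [W^2] and the constant 64. The constant [c] depends on [q] alone, which makes the bound uniform
    in [z]. *)
Lemma bergman_growth f q (b : R) : 0 < q -> holomorphic_on_disk f ->
  (bergman_integral q b f < +oo)%E ->
  exists2 K : R, 0 < K & forall z, unit_disk z ->
    normc (f z) `^ q * dweight z `^ (b + 2) <= K.
Proof.
move=> q0 fh fint; have [c c0 cP] := area_power_mean q0.
set J := bergman_integral q b f in fint.
have J0 : (0 <= J)%E.
  by apply: integral_ge0 => u _; rewrite lee_fin mulr_ge0// powR_ge0.
have JE : J = (fine J)%:E by rewrite fineK// ge0_fin_numE.
set j := fine J in JE.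
have j0 : 0 <= j by rewrite -lee_fin -JE.
exists (64 * c * 4 `^ `|b| * j + 1).
  by rewrite ltr_wpDl// !mulr_ge0// ?powR_ge0// ltW.
move=> [x y] zD; have W0 := dweight_gt0 zD; set W := dweight _ in W0 *.
have fd z : unit_disk z -> cderivable f z by move=> /fh/cderivableP.
have r0 : 0 < W / 8 by rewrite divr_gt0.
have SD : square x y (W / 8) `<=` @unit_disk R.
  move=> w /(dweight_square zD)[w1 _]; apply: unit_diskW; apply: lt_le_trans w1.
  by rewrite divr_gt0.
have mf : measurable_fun (cpair @^-1` @unit_disk R) (fun u => normc (f (cpair u)) `^ q).
  apply: (measurableT_comp (measurable_powR q)).
  apply: (rcont_measurable_fun (phi := normc \o f)); first exact: unit_disk_open.
  by move=> z /fd/cderivable_ccont/ccont_normc.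
have mw : measurable_fun (cpair @^-1` @unit_disk R) (fun u => dweight (cpair u) `^ b).
  apply: (measurableT_comp (measurable_powR b)).
  apply: measurable_funB; first exact: measurable_cst.
  apply: measurable_funX; apply: (rcont_measurable_fun (phi := normc)).
    exact: unit_disk_open.
  move=> z _; apply: (ccont_normc (F := id)).
  by apply: cderivable_ccont; exact: cderivable_id.
have mD := copen_measurable (@unit_disk_open R).
pose A : R := 4 `^ `|b| / W `^ b.
have A0 : 0 <= A by rewrite divr_ge0 ?powR_ge0.
have := cP f _ x y (W / 8) (A * j) (@unit_disk_open R) fd SD r0.
move=> H; lapply H => {H} [H|]; last first.
  have JA : (\int[mu2]_(u in cpair @^-1` @unit_disk R)
     (A%:E * (normc (f (cpair u)) `^ q * dweight (cpair u) `^ b)%:E) = A%:E * J)%E.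
    rewrite ge0_integralZl//.
    - by apply/measurable_EFinP; apply: measurable_funM.
    - by move=> u _; rewrite lee_fin mulr_ge0// powR_ge0.
  rewrite (EFinM A j) -JE -JA.
  apply: (@le_trans _ _ (\int[mu2]_(u in cpair @^-1` (square x y (W / 8)))
     (A%:E * (normc (f (cpair u)) `^ q * dweight (cpair u) `^ b)%:E))%E).
    apply: ge0_le_integral => //.
    - exact: measurable_square.
    - by move=> u _; rewrite lee_fin powR_ge0.
    - apply/measurable_EFinP; apply: measurable_funS mf => //.
      by move=> u /SD.
    - apply: emeasurable_funM; first exact: measurable_cst.
      apply/measurable_EFinP; apply: measurable_funS (measurable_funM mf mw) => //.
      by move=> u /SD.
    - move=> u us; rewrite -EFinM lee_fin.
      have [w1 w2] := dweight_square zD us.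
      have H := powR_comparable b W0 w1 w2.
      rewrite mulrCA ler_peMr ?powR_ge0// /A mulrAC ler_pdivlMr ?powR_gt0//.
      by rewrite mul1r.
  apply: ge0_subset_integral => //.
  - exact: measurable_square.
  - apply: emeasurable_funM; first exact: measurable_cst.
    by apply/measurable_EFinP; exact: measurable_funM.
  - by move=> u _; rewrite -EFinM lee_fin mulr_ge0// mulr_ge0// powR_ge0.
  - by move=> u /SD.
rewrite mulrC powRD; last by rewrite (gt_eqF W0) implybT.
rewrite powR_mulrn ?(ltW W0)//.
apply: (@le_trans _ _ (64 * c * 4 `^ `|b| * j)); last by rewrite lerDl.
have Wb : 0 < W `^ b by rewrite powR_gt0.
have -> : 64 * c * 4 `^ `|b| * j = W `^ b * (64 * (c * (A * j))).
  by rewrite /A; field; rewrite gt_eqF.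
rewrite -mulrA; apply: ler_wpM2l; first exact: ltW.
by move: H; rewrite -/W; nra.
Qed.

End Growth.

(** * The area of the image *)

Section PlaneMeasure.
Variable R : realType.

(* A name for the product measure, so that it can carry the sigma-finiteness
   instance which Tonelli's theorem for pairs of points of the plane requires. *)
Definition plane_measure := (@lebesgue_measure R \x @lebesgue_measure R)%E.
HB.instance Definition _ := Measure.on plane_measure.

Lemma plane_measure_sigma_finite : sigma_finite setT plane_measure.
Proof.
exists (fun n => @complex_of_pair R @^-1` (square 0 0 n%:R)).
  apply/esym/seteqP; split => // -[x y] _.
  exists (Num.bound (`|x| + `|y|)) => //.
  have := archi_boundP (addr_ge0 (normr_ge0 x) (normr_ge0 y)).
  set n := _%:R => xyn.
  rewrite /square/=; have := normr_ge0 x; have := normr_ge0 y.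
  have := ler_norm x; have := ler_norm y.
  by have := ler_norm (- x); have := ler_norm (- y); rewrite !normrN; split => /=; lra.
move=> n; split; first exact: measurable_square.
apply: (@le_lt_trans _ _ (4 * n%:R ^+ 2)%:E); last exact: ltry.
by rewrite -(square_area 0 0 (ler0n _ n)).
Qed.

HB.instance Definition _ := Measure_isSigmaFinite.Build _ _ _ plane_measure
  plane_measure_sigma_finite.

Lemma plane_measure_square (x y r : R) : 0 <= r ->
  plane_measure (@complex_of_pair R @^-1` (square x y r)) = (4 * r ^+ 2)%:E.
Proof. exact: square_area. Qed.

Lemma ge0_integral_bigcup_le d (T : measurableType d)
    (mu : {measure set T -> \bar R}) (S : (set T)^nat) (g : T -> \bar R) M :
  nondecreasing_seq S -> (forall n, measurable (S n)) ->
  (forall n, measurable_fun (S n) g) -> (forall n x, S n x -> (0 <= g x)%E) ->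
  (forall n, \int[mu]_(x in S n) g x <= M)%E ->
  (\int[mu]_(x in \bigcup_n S n) g x <= M)%E.
Proof.
move=> ndS mS mg g0 SM.
have cv := @ge0_nondecreasing_set_cvg_integral _ _ _ S g mu ndS mS mg g0.
rewrite -(cvg_lim _ cv)//; apply: lime_le; first by apply/cvg_ex; eexists; exact: cv.
by apply: nearW.
Qed.

Lemma measurable_le_set d (T : measurableType d) (a b : T -> R) :
  measurable_fun setT a -> measurable_fun setT b ->
  measurable [set x | a x <= b x].
Proof.
move=> ma mb; have := measurable_fun_ler ma mb measurableT (Y := [set true]).
rewrite setTI; apply => //.
Qed.

Lemma measurable_lt_set d (T : measurableType d) (a b : T -> R) :
  measurable_fun setT a -> measurable_fun setT b ->
  measurable [set x | a x < b x].
Proof.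
move=> ma mb; have := measurable_fun_ltr ma mb measurableT (Y := [set true]).
rewrite setTI; apply => //.
Qed.

End PlaneMeasure.

Section ChangeOfVariables.
Variable R : realType.
Local Notation C := R[i].
Local Notation normc := (@Normc.normc R).
Local Notation cpair := (@complex_of_pair R).
Local Notation mu2 := (@plane_measure R).
Implicit Types (f df : C -> C) (phi : C -> R) (D : set C) (x y r s t : R).

Lemma rcontB phi1 phi2 z : rcont phi1 z -> rcont phi2 z ->
  rcont (fun w => phi1 w - phi2 w) z.
Proof.
move=> c1 c2 e e0; have e20 : 0 < e / 2 by rewrite divr_gt0.
have [d1 d10 H1] := c1 _ e20; have [d2 d20 H2] := c2 _ e20.
exists (Num.min d1 d2); first by rewrite lt_min d10.
move=> w; rewrite lt_min => /andP[/H1 + /H2]; rewrite !ltr_distl.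
by move=> /andP[? ?] /andP[? ?]; apply/andP; split; lra.
Qed.

Lemma rcontZ (c : R) phi z : rcont phi z -> rcont (fun w => c * phi w) z.
Proof.
move=> H e e0; have k0 : 0 < `|c| + 1 by rewrite ltr_wpDl.
have [d d0 dP] := H _ (divr_gt0 e0 k0); exists d => // w /dP.
rewrite -mulrBr normrM ltr_pdivlMr//.
have := normr_ge0 (phi w - phi z); nra.
Qed.

Lemma rcont_gt phi z (a : R) : rcont phi z -> a < phi z -> exists2 d : R, 0 < d &
  forall w, normc (w - z) < d -> a < phi w.
Proof.
move=> H az; have az0 : 0 < phi z - a by rewrite subr_gt0.
have [d d0 dP] := H _ az0; exists d => // w /dP.
by rewrite ltr_distl => /andP[? _]; lra.
Qed.

Lemma ccont_shift f z h : ccont f (z + h) -> ccont (fun w => f (w + h)) z.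
Proof.
move=> H e /H[d d0 dP]; exists d => // w wd; apply: dP.
by rewrite opprD addrACA subrr addr0.
Qed.

Lemma ccontB f g z : ccont f z -> ccont g z -> ccont (fun w => f w - g w) z.
Proof.
move=> c1 c2 e e0; have e20 : 0 < e / 2 by rewrite divr_gt0.
have [d1 d10 H1] := c1 _ e20; have [d2 d20 H2] := c2 _ e20.
exists (Num.min d1 d2); first by rewrite lt_min d10.
move=> w; rewrite lt_min => /andP[/H1 + /H2].
have -> : f w - g w - (f z - g z) = (f w - f z) + - (g w - g z) by ring.
by move=> ? ?; apply: (le_lt_trans (ler_normcD _ _)); rewrite normc_opp; lra.
Qed.

Lemma dweight_rcont z : rcont (@dweight R) z.
Proof.
move=> e e0; have N0 := normc_ge0 z.
have k0 : 0 < 2 * normc z + 1 by lra.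
exists (Num.min 1 (e / (2 * normc z + 1))).
  by rewrite lt_min ltr01 divr_gt0.
move=> w; rewrite lt_min ltr_pdivlMr// => /andP[w1 we].
have -> : dweight w - dweight z = (normc z - normc w) * (normc z + normc w).
  by rewrite /dweight; ring.
rewrite normrM [X in _ * X]ger0_norm ?addr_ge0 ?normc_ge0//.
have H1 : `|normc z - normc w| <= normc (w - z).
  rewrite ler_norml; have := ler_normcB w z; have := ler_normcB z w.
  by rewrite (normcB z w) => ? ?; apply/andP; split; lra.
have H2 : normc z + normc w <= 2 * normc z + 1.
  by have := ler_normcB w z; lra.
apply: le_lt_trans we; apply: ler_pM => //.
by rewrite addr_ge0 ?normc_ge0.
Qed.

Section GoodPoints.
Variables f df : C -> C.
Hypothesis fd : forall z, unit_disk z -> cdiff f z (df z).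

Let rad (n : nat) : R := n.+1%:R^-1.

Let rad_gt0 n : 0 < rad n. Proof. by rewrite invr_gt0. Qed.

Let radS m n : (m <= n)%N -> rad n <= rad m.
Proof. by move=> mn; rewrite lef_pV2 ?posrE// ler_nat ltnS. Qed.

(* The points near which [f] is already well approximated, at the scale [rad n],
   by its derivative. *)
Definition good n : set C := [set z | [/\ 16 * rad n <= dweight z,
  rad n * normc (df z) <= 1 & forall h, normc h <= 2 * rad n ->
  normc (df z) * normc h <= 2 * normc (f (z + h) - f z)]].

Lemma good_disk n z : good n z -> unit_disk z.
Proof.
by move=> [zW _ _]; apply: unit_diskW; apply: lt_le_trans zW; rewrite mulr_gt0.
Qed.

(** The 16 in the definition of [good] is chosen for this: it makes [2 * rad n] at most an eighth of
    the weight, the half-side that [dweight_square] allows. *)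
Lemma good_square n x y z : good n (x +i* y) -> square x y (2 * rad n) z -> unit_disk z.
Proof.
move=> g; have xyD := good_disk g; case: g => zW _ _ zs.
have [|+ _] := dweight_square xyD (w := z).
  by case: z zs => u v [/= ? ?]; split => /=; lra.
by move=> H; apply: unit_diskW; apply: lt_le_trans H; rewrite divr_gt0 ?dweight_gt0.
Qed.

Lemma square_mono x y r s : r <= s -> square x y r `<=` square x y s.
Proof. by move=> rs [u v] [/= ? ?]; split => /=; lra. Qed.

Lemma normc_square x y r z : square x y r z -> normc (z - (x +i* y)) <= 2 * r.
Proof.
case: z => u v [ui vi]; apply: (le_trans (ler_normc_ReIm _)); rewrite /= in ui vi *.
have H1 : `|u - x| <= r by rewrite ler_distl.
have H2 : `|v - y| <= r by rewrite ler_distl.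
lra.
Qed.

Lemma square_normc x y r h : normc h <= r -> square x y r ((x +i* y) + h).
Proof.
move=> hr; have := le_trans (ler_Re_normc h) hr; have := le_trans (ler_Im_normc h) hr.
by case: h {hr} => u v; rewrite !ler_norml /= => /andP[? ?] /andP[? ?]; split => /=; lra.
Qed.

Lemma good_nd m n : (m <= n)%N -> good m `<=` good n.
Proof.
move=> /radS mn z [zW zd zh]; split.
- by apply: le_trans zW; rewrite ler_pM2l.
- by apply: le_trans zd; rewrite ler_wpM2r ?normc_ge0.
- by move=> h hn; apply: zh; apply: (le_trans hn); rewrite ler_pM2l.
Qed.

Lemma good_cover z : unit_disk z -> exists n, good n z.
Proof.
move=> zD; have W0 := dweight_gt0 zD.
have [d d0 dP] : exists2 d : R, 0 < d & forall h, normc h < d ->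
    normc (df z) * normc h <= 2 * normc (f (z + h) - f z).
  have [df0|df0] := eqVneq (normc (df z)) 0.
    by exists 1 => // h _; rewrite df0 mul0r mulr_ge0// normc_ge0.
  have df0' : 0 < normc (df z) / 2 by rewrite divr_gt0// lt_def df0 normc_ge0.
  have [d d0 dP] := fd zD df0'; exists d => // h /dP.
  have := ler_normcB (df z * h) (f (z + h) - f z).
  by rewrite (normcB (df z * h)) Normc.normcM; lra.
have N0 : 0 <= 16 / dweight z + normc (df z) + 2 / d.
  by rewrite !addr_ge0 ?normc_ge0 ?divr_ge0// ltW.
have := archi_boundP N0; set n := Num.bound _ => nP.
have {}nP : 16 / dweight z + normc (df z) + 2 / d < n.+1%:R.
  by apply: (lt_le_trans nP); rewrite ler_nat.
have a0 : 0 < 16 / dweight z by rewrite divr_gt0.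
have b0 : 0 < 2 / d by rewrite divr_gt0.
have c0 := normc_ge0 (df z).
exists n; split.
- by rewrite /rad ler_pdivrMr// mulrC -ler_pdivrMr//; lra.
- by rewrite /rad mulrC ler_pdivrMr// mul1r; lra.
- move=> h hn; apply: dP; apply: (le_lt_trans hn).
  by rewrite /rad ltr_pdivrMr// mulrC -ltr_pdivrMr//; lra.
Qed.

(** The good points are closed in the disk: each of the three conditions fails by a strict
    inequality, which persists nearby by continuity of [dweight], [f] and [df]. For the third, the
    same offending [h] serves at neighboring points, the first condition ensuring that [z + h] is
    still in the disk. *)
Lemma good_measurable n : measurable (cpair @^-1` good n).
Proof.
have -> : cpair @^-1` good n = cpair @^-1` (@unit_disk R) `\`
    cpair @^-1` (@unit_disk R `\` good n).
  apply/seteqP; split => u /=; first by move=> g; split; [exact: good_disk g|case].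
  by move=> [uD ng]; apply: contrapT => g; apply: ng.
apply: measurableD; first exact: copen_measurable (@unit_disk_open R).
apply: copen_measurable => z [zD ng].
have [d0 d00 D0] := unit_disk_open zD.
suff [d d_gt0 dP] : exists2 d : R, 0 < d & forall w, normc (w - z) < d ->
    unit_disk w -> ~ good n w.
  exists (Num.min d0 d); first by rewrite lt_min d00.
  by move=> w; rewrite lt_min => /andP[/D0 wD /dP/(_ wD)]; split.
have dfc w : unit_disk w -> ccont df w.
  exact: (derivative_ccont (@unit_disk_open R) fd).
have [zW|Wz] := leP (16 * rad n) (dweight z); last first.
  have H := rcontZ (-1) (@dweight_rcont z).
  have [|d d_gt0 dP] := rcont_gt (a := - (16 * rad n)) H; first by rewrite mulN1r ltrN2.
  exists d => // w /dP; rewrite mulN1r ltrN2 => ww _ [].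
  by rewrite leNgt ww.
have [zd|dz] := leP (rad n * normc (df z)) 1; last first.
  have [d d_gt0 dP] := rcont_gt (rcontZ (rad n) (ccont_normc (dfc _ zD))) dz.
  by exists d => // w /dP ww _ [_ H _]; move: ww; rewrite ltNge H.
have [h hn hz] : exists2 h, normc h <= 2 * rad n &
    2 * normc (f (z + h) - f z) < normc (df z) * normc h.
  apply: contrapT => /forall2NP H; apply: ng; split => // h hn.
  by case: (H h) => // /negP; rewrite -leNgt.
have zhD : unit_disk (z + h).
  case: z zD zW {ng D0 zd hz} => x y xyD xyW.
  have [|+ _] := dweight_square xyD (w := (x +i* y) + h).
    by apply: square_normc; lra.
  by move=> H; apply: unit_diskW; apply: lt_le_trans H; rewrite divr_gt0 ?dweight_gt0.
have fc w : unit_disk w -> ccont f w by move=> /fd/cdiff_ccont.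
have c1 := rcontZ (normc h) (ccont_normc (dfc _ zD)).
have c2 := rcontZ 2 (ccont_normc (ccontB (ccont_shift (fc _ zhD)) (fc _ zD))).
have [|d d_gt0 dP] := rcont_gt (a := 0) (rcontB c1 c2).
  by rewrite subr_gt0 [X in _ < X]mulrC.
exists d => // w /dP; rewrite subr_gt0 => ww _ [_ _ /(_ _ hn)].
by rewrite mulrC leNgt ww.
Qed.

(** Boundary points of the square are at distance between [rad n] and [2 * rad n] from the center,
    so with [k = rad n * |f'|] the third condition of [good] keeps [f] at distance at least [k / 2]
    from [f z0]. As [w] is within [k / 8] of [f z0], it is at least [3 k / 8] away from the boundary
    values, more than twice its distance to [f z0]; [square_image] applies. *)
Lemma good_image n x y w : good n (x +i* y) -> 0 < normc (df (x +i* y)) ->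
  square (complex.Re (f (x +i* y))) (complex.Im (f (x +i* y)))
    (rad n * normc (df (x +i* y)) / 16) w ->
  exists2 z, square x y (rad n) z & f z = w.
Proof.
move=> g df0 ws; set z0 := x +i* y in g df0 ws *.
have r0 := rad_gt0 n.
have := normc_square ws.
have -> : complex.Re (f z0) +i* complex.Im (f z0) = f z0 by case: (f z0).
set k := rad n * normc (df z0) in ws *.
have k0 : 0 < k by rewrite mulr_gt0.
move=> wk; apply: (@square_image _ f x y (rad n) (3 / 8 * k)) => //.
- move=> z zs; exists (df z); apply: fd; apply: (good_square g).
  by apply: square_mono zs; lra.
- move=> z zs zb; have := normc_square zs; set h := z - z0 => hr.
  have zE : z0 + h = z by rewrite /h addrC subrK.
  have [_ _ /(_ _ hr)] := g; rewrite zE.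
  have rh : rad n <= normc h.
    case/orP: zb => /eqP <-.
      by have := ler_Re_normc h; rewrite [complex.Re h]raddfB.
    by have := ler_Im_normc h; rewrite [complex.Im h]raddfB.
  have : k <= normc (df z0) * normc h by rewrite /k mulrC ler_pM2l.
  have := ler_normcB (f z - f z0) (w - f z0).
  have -> : f z - f z0 - (w - f z0) = f z - w by ring.
  by lra.
- by rewrite -/z0 normcB; lra.
Qed.

End GoodPoints.
End ChangeOfVariables.

Section ImageArea.
Variable R : realType.
Local Notation C := R[i].
Local Notation normc := (@Normc.normc R).
Local Notation cpair := (@complex_of_pair R).
Local Notation mu2 := (@plane_measure R).

Variables (f df : C -> C) (h : C -> R) (c : R).
Hypothesis fd : forall z, unit_disk z -> cdiff f z (df z).
Hypothesis finj : set_inj (@unit_disk R) f.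
Hypothesis c0 : 0 < c.
Hypothesis h0 : forall w, 0 <= h w.
Hypothesis mh : measurable_fun [set: R * R] (h \o cpair).
Hypothesis hc : forall w w', `|complex.Re w' - complex.Re w| <= 1 ->
  `|complex.Im w' - complex.Im w| <= 1 -> c * h w <= h w'.

Let rad (n : nat) : R := n.+1%:R^-1.
Let rad_gt0 n : 0 < rad n. Proof. by rewrite invr_gt0. Qed.

Let dens u := h (f (cpair u)) * normc (df (cpair u)) ^+ 2.

Let dens_ge0 u : 0 <= dens u.
Proof. by rewrite mulr_ge0// exprn_ge0// normc_ge0. Qed.

Let fcont z : unit_disk z -> ccont f z. Proof. by move=> /fd/cdiff_ccont. Qed.

Let dfcont z : unit_disk z -> ccont df z.
Proof. exact: (derivative_ccont (@unit_disk_open R) fd). Qed.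

Let mRe : measurable_fun (cpair @^-1` @unit_disk R) (fun u => complex.Re (f (cpair u))).
Proof.
apply: (rcont_measurable_fun (phi := fun z => complex.Re (f z))).
  exact: unit_disk_open.
by move=> z /fcont/ccont_Re.
Qed.

Let mIm : measurable_fun (cpair @^-1` @unit_disk R) (fun u => complex.Im (f (cpair u))).
Proof.
apply: (rcont_measurable_fun (phi := fun z => complex.Im (f z))).
  exact: unit_disk_open.
by move=> z /fcont/ccont_Im.
Qed.

Let mdf : measurable_fun (cpair @^-1` @unit_disk R) (fun u => normc (df (cpair u))).
Proof.
apply: (rcont_measurable_fun (phi := fun z => normc (df z))).
  exact: unit_disk_open.
by move=> z /dfcont/ccont_normc.
Qed.

Let mD : measurable (cpair @^-1` @unit_disk R).
Proof. exact: copen_measurable (@unit_disk_open R). Qed.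

Lemma measurable_density : measurable_fun (cpair @^-1` @unit_disk R)
  (fun u => h (f (cpair u)) * normc (df (cpair u)) ^+ 2).
Proof.
apply: measurable_funM; last exact: measurable_funX.
(* The measurability of [h] is known on the whole plane and that of [f] on the disk only, so the
   coordinates of [f] are extended by zero. *)
pose T := cpair @^-1` @unit_disk R.
apply: (eq_measurable_fun (fun u => (h \o cpair)
  (((fun u => complex.Re (f (cpair u))) \_ T) u, ((fun u => complex.Im (f (cpair u))) \_ T) u))).
  move=> u uT; rewrite /= !patchE uT /complex_of_pair/=.
  by case: (f _).
apply: measurable_funTS; apply: (measurableT_comp mh).
by apply: measurable_fun_pair; apply/(measurable_restrictT _ mD).
Qed.

Let mdens : measurable_fun (cpair @^-1` @unit_disk R) dens.
Proof. exact: measurable_density. Qed.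

Let S n := cpair @^-1` (good f df n).

Let mS n : measurable (S n). Proof. exact: good_measurable. Qed.

Let SD n : S n `<=` cpair @^-1` @unit_disk R.
Proof. by move=> u /good_disk. Qed.

(** Extended by zero, these functions are measurable on the whole plane, so [E] below can be cut out
    by inequalities between measurable functions on the product. *)
Let F1 n := (fun u => complex.Re (f (cpair u))) \_ (S n).
Let F2 n := (fun u => complex.Im (f (cpair u))) \_ (S n).
Let Dn n := (fun u => normc (df (cpair u))) \_ (S n).

(* [E n] consists of the pairs (u, v) with [u] in [good n] and [v] in the square of
   half-side [rad n * |f'(u)| / 16] around [f u].  For fixed [u] the fibre has area of
   order [rad n ^ 2 * |f'(u)|^2]; for fixed [v] injectivity confines [u] to a square of
   half-side [rad n] around the only preimage of [v]. *)
Let E n : set ((R * R) * (R * R)) := (S n `*` setT) `&`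
  ([set p | 0 < Dn n p.1] `&`
  (([set p | F1 n p.1 - rad n * Dn n p.1 / 16 <= p.2.1] `&`
   [set p | p.2.1 <= F1 n p.1 + rad n * Dn n p.1 / 16]) `&`
  ([set p | F2 n p.1 - rad n * Dn n p.1 / 16 <= p.2.2] `&`
   [set p | p.2.2 <= F2 n p.1 + rad n * Dn n p.1 / 16]))).

Let EP n u v : E n (u, v) <-> [/\ S n u, 0 < normc (df (cpair u)) &
  square (complex.Re (f (cpair u))) (complex.Im (f (cpair u)))
    (rad n * normc (df (cpair u)) / 16) (cpair v)].
Proof.
split=> [[[/= Su _]]|[Su df0 [v1 v2]]].
  rewrite /F1 /F2 /Dn !patchE mem_set// => -[df0 [[a1 a2] [b1 b2]]].
  by split => //; split => /=; rewrite ?a1 ?a2 ?b1 ?b2.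
rewrite /E /F1 /F2 /Dn; split => //=; rewrite !patchE mem_set//.
by split => //; case/andP: v1 => ? ?; case/andP: v2.
Qed.

Let mE n : measurable (E n).
Proof.
have m1 : measurable_fun [set: (R * R) * (R * R)] (F1 n \o fst).
  apply: measurableT_comp; last exact: measurable_fst.
  by apply/(measurable_restrictT _ (mS n)); exact: measurable_funS (@SD n) mRe.
have m2 : measurable_fun [set: (R * R) * (R * R)] (F2 n \o fst).
  apply: measurableT_comp; last exact: measurable_fst.
  by apply/(measurable_restrictT _ (mS n)); exact: measurable_funS (@SD n) mIm.
have m3 : measurable_fun [set: (R * R) * (R * R)] (Dn n \o fst).
  apply: measurableT_comp; last exact: measurable_fst.
  by apply/(measurable_restrictT _ (mS n)); exact: measurable_funS (@SD n) mdf.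
have m4 : measurable_fun [set: (R * R) * (R * R)] (fun p => rad n * Dn n p.1 / 16).
  apply: measurable_funM; last exact: measurable_cst.
  by apply: measurable_funM => //; exact: measurable_cst.
have p1 : measurable_fun [set: (R * R) * (R * R)] (fun p => p.2.1).
  by apply: measurableT_comp; [exact: measurable_fst|exact: measurable_snd].
have p2 : measurable_fun [set: (R * R) * (R * R)] (fun p => p.2.2).
  by apply: measurableT_comp; [exact: measurable_snd|exact: measurable_snd].
apply: measurableI; first by apply: measurableX => //; exact: mS.
apply: measurableI.
  by apply: measurable_lt_set => //; exact: measurable_cst.
apply: measurableI; apply: measurableI; apply: measurable_le_set => //.
- exact: measurable_funB.
- exact: measurable_funD.
- exact: measurable_funB.
- exact: measurable_funD.
Qed.

Let G n : (R * R) * (R * R) -> \bar R := (fun p => (h (cpair p.2))%:E) \_ (E n).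

Let G_ge0 n p : (0 <= G n p)%E.
Proof. by rewrite /G patchE; case: ifP => // _; rewrite lee_fin. Qed.

Let mG n : measurable_fun setT (G n).
Proof.
apply/(measurable_restrictT _ (mE n))/measurable_EFinP.
apply: (@measurable_funS _ _ _ _ setT) => //.
by apply: (measurableT_comp mh); exact: measurable_snd.
Qed.

(** The fibre over [u] is a square of half-side [k = rad n * |f'(u)| / 16], of area
    [4 k^2 = rad n ^ 2 * |f'(u)|^2 / 64]. As [k <= 1] for a good point, [h] is at least
    [c * h (f u)] on it. *)
Let lower n u :
  ((((fun u => (c / 64 * rad n ^+ 2 * dens u)%:E) \_ (S n)) u) <=
   \int[mu2]_v G n (u, v))%E.
Proof.
rewrite patchE; case: ifPn => [/[!inE] Su|_]; last exact: integral_ge0.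
have [df0|df0] := eqVneq (normc (df (cpair u))) 0.
  by rewrite /dens df0 expr0n/= !mulr0; exact: integral_ge0.
have {}df0 : 0 < normc (df (cpair u)) by rewrite lt_def df0 normc_ge0.
set x := complex.Re (f (cpair u)); set y := complex.Im (f (cpair u)).
set k := rad n * normc (df (cpair u)) / 16.
have k0 : 0 < k by rewrite divr_gt0// mulr_gt0.
have k1 : k <= 1 by rewrite /k; case: Su => _ H _; rewrite -/(rad n) in H; lra.
apply: (@le_trans _ _ (\int[mu2]_(v in cpair @^-1` (square x y k)) (c * h (f (cpair u)))%:E)%E).
  apply: (@le_trans _ _ ((c * h (f (cpair u)))%:E * mu2 (cpair @^-1` (square x y k)))%E).
    rewrite plane_measure_square ?(ltW k0)// -EFinM lee_fin le_eqVlt; apply/orP; left; apply/eqP.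
    by rewrite /dens /k; field.
  by rewrite integral_cst//; exact: measurable_square.
rewrite integral_mkcond; apply: ge0_le_integral => //.
- by move=> v _; rewrite patchE; case: ifP => // _; rewrite lee_fin mulr_ge0// ltW.
- by apply/(measurable_restrictT _ (measurable_square x y k)); exact: measurable_cst.
- exact: measurableT_comp (mG n) (pair1_measurable _).
- move=> v _; rewrite patchE; case: ifPn => [/[!inE]/= vs|_]; last exact: G_ge0.
  rewrite /G patchE mem_set; last by apply/EP.
  case: v vs => v1 v2 [/= vx vy].
  have v1x : `|v1 - x| <= 1 by rewrite ler_distl; lra.
  have v2y : `|v2 - y| <= 1 by rewrite ler_distl; lra.
  by rewrite lee_fin; exact: hc.
Qed.

Let upper n v : (\int[mu2]_u G n (u, v) <= (4 * rad n ^+ 2 * h (cpair v))%:E)%E.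
Proof.
have [[z zD zv]|nz] := pselect (exists2 z, unit_disk z & f z = cpair v); last first.
  rewrite integral0_eq => [|u _].
    by rewrite lee_fin mulr_ge0// mulr_ge0// sqr_ge0.
  rewrite /G patchE; case: ifPn => // /[!inE] /EP[Su df0 vs].
  exfalso; apply: nz.
  have [z zs fz] := good_image fd Su df0 vs; exists z => //.
  apply: (good_square Su); apply: square_mono zs.
  by rewrite ler_peMl ?(ltW (rad_gt0 n))// ler1n.
have [x [y zE]] : exists x y, z = x +i* y by case: (z) => x y; exists x, y.
apply: (@le_trans _ _ (\int[mu2]_(u in cpair @^-1` (square x y (rad n))) (h (cpair v))%:E)%E).
  rewrite [leRHS]integral_mkcond; apply: ge0_le_integral => //.
  - exact: measurableT_comp (mG n) (pair2_measurable _).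
  - by apply/(measurable_restrictT _ (measurable_square x y _)); exact: measurable_cst.
  - move=> u _; rewrite /G !patchE; case: ifPn => [/[!inE] /EP[Su df0 vs]|_]; last first.
      by case: ifP => // _; rewrite lee_fin.
    rewrite mem_set//.
    have [z' zs' fz'] := good_image fd Su df0 vs.
    have zz' : z' = z.
      apply: finj; rewrite ?inE//; last by rewrite fz'.
      apply: (good_square Su); apply: square_mono zs'.
      by rewrite ler_peMl ?(ltW (rad_gt0 n))// ler1n.
    move: zs'; rewrite zz' zE; case: (u) => u1 u2 [/=]; rewrite -/(rad n) => ? ?.
    by split => /=; lra.
apply: (@le_trans _ _ ((h (cpair v))%:E * mu2 (cpair @^-1` (square x y (rad n))))%E).
  by rewrite integral_cst//; exact: measurable_square.
by rewrite plane_measure_square ?(ltW (rad_gt0 n))// -EFinM lee_fin mulrC.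
Qed.

(** Tonelli's theorem compares the two iterated integrals of [G n]. The factor [rad n ^ 2] occurs in
    both the lower and the upper bound and cancels, leaving [4 * 64 / c]; the independence of [n]
    allows the passage to the whole disk. *)
Let good_bound n : (\int[mu2]_(u in S n) (dens u)%:E <=
  (256 / c)%:E * \int[mu2]_v (h (cpair v))%:E)%E.
Proof.
pose a := c / 64 * rad n ^+ 2.
have a0 : 0 < a by rewrite mulr_gt0 ?divr_gt0// exprn_gt0.
have -> : (\int[mu2]_(u in S n) (dens u)%:E =
    (a^-1)%:E * \int[mu2]_(u in S n) (a * dens u)%:E)%E.
  under [in RHS]eq_integral do rewrite EFinM.
  rewrite ge0_integralZl//.
  - by rewrite muleA -EFinM mulVf ?gt_eqF// mul1e.
  - exact: mS.
  - by apply/measurable_EFinP; exact: measurable_funS (@SD n) mdens.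
  - by move=> u _; rewrite lee_fin.
  - by rewrite lee_fin ltW.
have -> : (256 / c)%:E = ((a^-1)%:E * (4 * rad n ^+ 2)%:E)%E.
  rewrite -EFinM; congr (_%:E); rewrite /a; field.
  by rewrite !gt_eqF.
rewrite -muleA; apply: lee_wpmul2l; first by rewrite lee_fin invr_ge0 ltW.
apply: (@le_trans _ _ (\int[mu2]_u \int[mu2]_v G n (u, v))%E).
  rewrite integral_mkcond; apply: ge0_le_integral => //.
  - move=> u _; rewrite patchE; case: ifP => // _.
    by rewrite lee_fin mulr_ge0// ltW.
  - apply/(measurable_restrictT _ (mS n))/measurable_EFinP.
    apply: measurable_funM; first exact: measurable_cst.
    exact: measurable_funS (@SD n) mdens.
  - by apply: measurable_fun_fubini_tonelli_F; [exact: mG|exact: G_ge0].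
have -> : (\int[mu2]_u \int[mu2]_v G n (u, v) = \int[mu2]_v \int[mu2]_u G n (u, v))%E.
  rewrite -[LHS](@fubini_tonelli1 _ _ _ _ R mu2 mu2 (G n)); [|exact: mG|exact: G_ge0].
  by rewrite -[RHS](@fubini_tonelli2 _ _ _ _ R mu2 mu2 (G n)); [|exact: mG|exact: G_ge0].
rewrite -ge0_integralZl//.
- apply: ge0_le_integral => //.
  + by move=> v _; exact: integral_ge0.
  + by apply: measurable_fun_fubini_tonelli_G; [exact: mG|exact: G_ge0].
  + by apply: emeasurable_funM; [exact: measurable_cst|exact/measurable_EFinP].
- exact/measurable_EFinP.
- by move=> v _; rewrite lee_fin.
- by rewrite lee_fin mulr_ge0// sqr_ge0.
Qed.

Lemma image_area_le :
  (\int[mu2]_(u in cpair @^-1` @unit_disk R)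
     (h (f (cpair u)) * normc (df (cpair u)) ^+ 2)%:E <=
   (256 / c)%:E * \int[mu2]_v (h (cpair v))%:E)%E.
Proof.
have -> : cpair @^-1` @unit_disk R = \bigcup_n S n.
  apply/seteqP; split => [u /(good_cover fd)[n g]|u [n _]]; first by exists n.
  exact: SD.
apply: ge0_integral_bigcup_le.
- by move=> m n mn; apply/subsetPset => u; exact: good_nd.
- exact: mS.
- by move=> n; apply/measurable_EFinP; exact: measurable_funS (@SD n) mdens.
- by move=> n u _; rewrite lee_fin; exact: dens_ge0.
- exact: good_bound.
Qed.

End ImageArea.

(** * The Hardy inequality *)

Section OneVariable.
Variable R : realType.
Implicit Types (f g F dF : R -> R) (a b s t x y : R).

Lemma deriv_add f g x df dg : is_derive x 1 f df -> is_derive x 1 g dg ->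
  is_derive x 1 (fun t => f t + g t) (df + dg).
Proof. by move=> ff gg; exact: is_deriveD. Qed.

Lemma deriv_mul f g x df dg : is_derive x 1 f df -> is_derive x 1 g dg ->
  is_derive x 1 (fun t => f t * g t) (df * g x + f x * dg).
Proof.
move=> ff gg; have H := is_deriveM ff gg.
by apply: (is_derive_eq H); rewrite addrC; congr (_ + _); exact: mulrC.
Qed.

Lemma deriv_cst (c : R) x : is_derive x 1 (fun=> c) (0 : R).
Proof. exact: is_derive_cst. Qed.

Lemma deriv_id x : is_derive x 1 (fun t : R => t) (1 : R).
Proof. exact: is_derive_id. Qed.

Lemma deriv_powR f x df s : is_derive x 1 f df -> 0 < f x ->
  is_derive x 1 (fun t => f t `^ s) (s * f x `^ (s - 1) * df).
Proof.
move=> ff fx; have H := is_derive1_powR s fx.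
exact: (is_derive1_comp (f := fun u => u `^ s) (g := f)).
Qed.

Lemma deriv_continuous f x df : is_derive x 1 f df -> {for x, continuous f}.
Proof.
by move=> [fd _]; apply: differentiable_continuous; exact/derivable1_diffP.
Qed.

Lemma powR_continuous s x : 0 < x -> {for x, continuous (fun t => t `^ s)}.
Proof. by move=> x0; exact: deriv_continuous (is_derive1_powR s x0). Qed.

Lemma rint_derive a b F dF : a <= b ->
  (forall x, a <= x <= b -> is_derive x 1 F (dF x)) ->
  {within `[a, b], continuous dF} -> rint a b dF = F b - F a.
Proof.
rewrite le_eqVlt => /predU1P[<- _ _|ab FdF dFc].
  by rewrite /rint set_itv1 Rintegral_set1 subrr.
have Fc x : a <= x <= b -> {for x, continuous F}.
  by move=> /FdF; exact: deriv_continuous.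
apply: EFin_inj; rewrite rint_EFin// EFinB; apply: continuous_FTC2 => //.
- split.
  + move=> x; rewrite in_itv/= => /andP[ax xb].
    by have [] : is_derive x 1 F (dF x) by apply: FdF; rewrite !ltW.
  + by apply: cvg_at_right_filter; apply: Fc; rewrite lexx ltW.
  + by apply: cvg_at_left_filter; apply: Fc; rewrite lexx ltW.
- move=> x; rewrite in_itv/= => /andP[ax xb]; rewrite derive1E.
  by have [] : is_derive x 1 F (dF x) by apply: FdF; rewrite !ltW.
Qed.

Lemma within_continuous_add (A : set R) f g : {within A, continuous f} ->
  {within A, continuous g} -> {within A, continuous (fun t => f t + g t)}.
Proof. by move=> fc gc x; exact: cvgD (fc x) (gc x). Qed.

Lemma within_continuous_mul (A : set R) f g : {within A, continuous f} ->
  {within A, continuous g} -> {within A, continuous (fun t => f t * g t)}.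
Proof. by move=> fc gc x; exact: cvgM (fc x) (gc x). Qed.

Lemma within_continuous_powR a b f s : {within `[a, b], continuous f} ->
  (forall x, a <= x <= b -> 0 < f x) ->
  {within `[a, b], continuous (fun t => f t `^ s)}.
Proof.
move=> fc f0; rewrite continuous_subspace_in => x /[!inE]/=; rewrite in_itv/= => xab.
have H := @powR_continuous s _ (f0 _ xab).
exact: (@continuous_comp (subspace `[a, b]) R R f (fun t => t `^ s) x (fc x) H).
Qed.

(* [kern e x * kern e y] is integrable over the plane by Fubini's theorem and dominates
   a multiple of [(1 + x^2 + y^2)^-(1+e)]. *)
Definition kern e t : R := (1 + `|t|) `^ (- (1 + e)).

Lemma kern_gt0 e t : 0 < kern e t.
Proof. by rewrite powR_gt0// ltr_pwDl. Qed.

Lemma kern_near e s t : 0 <= 1 + e -> `|t - s| <= 1 ->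
  2 `^ (- (1 + e)) * kern e s <= kern e t.
Proof.
move=> e0 st; have s0 := normr_ge0 s; have t0 := normr_ge0 t.
rewrite /kern -powRM ?addr_ge0//.
rewrite !powRN lef_pV2 ?posrE ?powR_gt0//; try lra.
apply: ge0_ler_powR; rewrite ?nnegrE//; try lra.
by have := ler_normD (t - s) s; rewrite subrK; lra.
Qed.

Lemma kern_measurable e : measurable_fun [set: R] (kern e).
Proof.
apply: (measurableT_comp (measurable_powR (- (1 + e)))).
by apply: measurable_funD; [exact: measurable_cst|exact: normr_measurable].
Qed.

Local Notation mu := (@lebesgue_measure R).

Lemma kern_integral_lty e : 0 < e -> (\int[mu]_t (kern e t)%:E < +oo)%E.
Proof.
move=> e0; pose k t : R := (1 + t) `^ (- (1 + e)).
have mk : measurable_fun [set: R] k.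
  apply: (measurableT_comp (measurable_powR (- (1 + e)))).
  by apply: measurable_funD => //; exact: measurable_cst.
have half : (\int[mu]_(t in `[0%R, +oo[) (k t)%:E <= (e^-1)%:E)%E.
  have -> : `[0%R, +oo[%classic = \bigcup_n `[0%R, n%:R]%classic :> set R.
    apply/seteqP; split => x /=; last first.
      by move=> [n _]; rewrite /= !in_itv/= andbT => /andP[].
    rewrite in_itv/= andbT => x0.
    exists (Num.bound x) => //=; rewrite in_itv/= x0/=.
    by rewrite ltW// archi_boundP.
  apply: ge0_integral_bigcup_le.
  - move=> m n mn; apply/subsetPset => x /=; rewrite !in_itv/= => /andP[-> xm].
    by rewrite (le_trans xm)// ler_nat.
  - by move=> n; exact: measurable_itv.
  - by move=> n; apply/measurable_EFinP; exact: measurable_funTS.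
  - by move=> n x _; rewrite lee_fin powR_ge0.
  - move=> n; pose F t : R := - e^-1 * (1 + t) `^ (- e).
    have Fk t : 0 <= t -> is_derive t 1 F (k t).
      move=> t0; have t1 : 0 < 1 + t by lra.
      have H := deriv_mul (deriv_cst (- e^-1) t)
        (deriv_powR (- e) (deriv_add (deriv_cst 1 t) (deriv_id t)) t1).
      apply: (is_derive_eq H); rewrite mul0r !add0r mulr1 /k.
      have -> : - e - 1 = - (1 + e) by ring.
      by field; rewrite gt_eqF.
    have kc : {within `[0, n%:R], continuous k}.
      apply: within_continuous_powR; last by move=> x /andP[? _]; lra.
      apply: continuous_subspaceT => x; apply: (@deriv_continuous _ _ 1).
      by apply: (is_derive_eq (deriv_add (deriv_cst 1 x) (deriv_id x))); rewrite add0r.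
    have FE : rint 0 n%:R k = F n%:R - F 0.
      by apply: rint_derive => // x /andP[x0 _]; exact: Fk.
    rewrite -rint_EFin// lee_fin FE.
    rewrite /F addr0 powR1 mulr1 opprK mulNr gerDr oppr_le0.
    by rewrite mulr_ge0// ?powR_ge0// invr_ge0 ltW.
(* [k] agrees with [kern e] on the nonnegative half-line only, so its restriction together with the
   reflection of that restriction dominates [kern e]. *)
pose g (t : R) : \bar R := ((fun t => (k t)%:E) \_ `[0%R, +oo[) t.
have g0 t : (0 <= g t)%E.
  by rewrite /g patchE; case: ifP => // _; rewrite lee_fin powR_ge0.
have mg : measurable_fun [set: R] g.
  apply/(measurable_restrictT _ (measurable_itv _))/measurable_EFinP.
  exact: measurable_funTS.
have gi : (\int[mu]_t g t <= (e^-1)%:E)%E by rewrite /g -integral_mkcond.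
apply: (@le_lt_trans _ _ (\int[mu]_t (g t + g (- t)%R)%E)%E).
  apply: ge0_le_integral => //.
  - by move=> t _; rewrite lee_fin ltW// kern_gt0.
  - by apply/measurable_EFinP; exact: kern_measurable.
  - by apply: emeasurable_funD => //; apply: measurableT_comp.
  - have gE u : 0 <= u -> g u = (kern e u)%:E.
      by move=> u0; rewrite /g patchE mem_set /= ?in_itv/= ?u0// /kern ger0_norm.
    move=> t _; have [t0|t0] := leP 0 t; first by rewrite gE// leeDl.
    rewrite addeC gE; last by rewrite oppr_ge0 ltW.
    by rewrite /kern normrN leeDl.
rewrite ge0_integralD//; last by apply: measurableT_comp.
rewrite (ge0_integralN mg g0).
by apply: (le_lt_trans (leeD gi gi)); rewrite -EFinD ltry.
Qed.

End OneVariable.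

Section Hardy.
Variable R : realType.
Implicit Types (a p t W c u v du dv : R).

(** Here [Q] stands for [(1 + u^2 + v^2)^(p/2 - 1) * W^al]. Inserting [t^2 = c - W], the terms with
    [Q S W] collect the coefficient [2a + 1], and [2 a c Q S] remains, at least [18/25 a Q S]. Of
    this, [a / 10] pays for the [Q S W] terms and [a / 10] for the cross term, by completing a
    square; what is left exceeds [a / 2]. *)
Lemma hardy_pointwise a p t W c u v du dv Q M : 0 < a -> 0 < Q -> 0 < W ->
  t ^+ 2 = c - W -> 9 / 25 <= c -> c <= 1 ->
  (2 * a + 1) * (Q * (1 + u ^+ 2 + v ^+ 2) * W) <=
    a / 10 * (Q * (1 + u ^+ 2 + v ^+ 2)) + (2 * a + 1) * M ->
  a / 2 * (Q * (1 + u ^+ 2 + v ^+ 2)) <=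
  (- (Q * (1 + u ^+ 2 + v ^+ 2) * W) - t * (p * Q * (u * du + v * dv)) * W +
    2 * a * t ^+ 2 * (Q * (1 + u ^+ 2 + v ^+ 2))) +
  ((2 * a + 1) * M + 5 / 2 * p ^+ 2 / a * (Q * (du ^+ 2 + dv ^+ 2) * W ^+ 2)).
Proof.
move=> a0 Q0 W0 tW c1 c2 H1.
set S := 1 + u ^+ 2 + v ^+ 2 in H1 *.
have t1 : t ^+ 2 <= 1 by rewrite tW; lra.
have u2 := sqr_ge0 u; have v2 := sqr_ge0 v.
have S0 : 0 < S by rewrite /S; lra.
have amgm (b db : R) : t * (p * (b * db)) * W <=
    a / 10 * b ^+ 2 + 5 / 2 * p ^+ 2 / a * (db ^+ 2 * W ^+ 2).
  have -> : a / 10 * b ^+ 2 + 5 / 2 * p ^+ 2 / a * (db ^+ 2 * W ^+ 2) =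
      t * (p * (b * db)) * W +
      (a / 10 * (b - 5 * t * p * db * W / a) ^+ 2 +
       5 / 2 * p ^+ 2 / a * (db ^+ 2 * W ^+ 2) * (1 - t ^+ 2)).
    by field; rewrite gt_eqF.
  rewrite lerDl; apply: addr_ge0; first by apply: mulr_ge0; [lra|exact: sqr_ge0].
  apply: mulr_ge0; last by rewrite subr_ge0.
  apply: mulr_ge0; last by rewrite mulr_ge0 ?sqr_ge0.
  by rewrite divr_ge0 ?(ltW a0)// mulr_ge0 ?sqr_ge0//; lra.
have H2 : t * (p * Q * (u * du + v * dv)) * W <=
    Q * (a / 10 * S + 5 / 2 * p ^+ 2 / a * ((du ^+ 2 + dv ^+ 2) * W ^+ 2)).
  have -> : t * (p * Q * (u * du + v * dv)) * W =
    Q * (t * (p * (u * du)) * W + t * (p * (v * dv)) * W) by ring.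
  rewrite ler_pM2l//; apply: (le_trans (lerD (amgm u du) (amgm v dv))).
  by rewrite /S; lra.
have QS : 0 < Q * S by rewrite mulr_gt0.
have H3 : 9 / 25 * (a * (Q * S)) <= c * (a * (Q * S)).
  by rewrite ler_wpM2r// mulr_ge0// ltW.
have H4 : 0 < a * (Q * S) by rewrite mulr_gt0.
rewrite tW; move: H1 H2 H3 H4; lra.
Qed.

(* On a chord [W = c - t^2].  With [P = (1 + u^2 + v^2)^(p/2)], the function
   [- t P W^(al+1)] is nonnegative at [- X] and nonpositive at [X], and its derivative is
   [- P W^(al+1) - t P' W^(al+1) + 2 (al+1) t^2 P W^al].  The last term controls
   [P W^al] except where [W] is not small, and there [P <= M]. *)
Lemma hardy_segment p al c X M (u v du dv : R -> R) : 0 < p -> -1 < al ->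
  9 / 25 <= c -> c <= 1 -> 0 <= X -> X ^+ 2 < c -> 0 <= M ->
  (forall t, - X <= t <= X -> is_derive t 1 u (du t)) ->
  (forall t, - X <= t <= X -> is_derive t 1 v (dv t)) ->
  {within `[- X, X], continuous du} -> {within `[- X, X], continuous dv} ->
  (forall t, - X <= t <= X -> (al + 1) / 10 / (2 * (al + 1) + 1) <= c - t ^+ 2 ->
     (1 + u t ^+ 2 + v t ^+ 2) `^ (p / 2) <= M) ->
  let V t := (1 + u t ^+ 2 + v t ^+ 2) `^ (p / 2) * (c - t ^+ 2) `^ al in
  let G t := (2 * (al + 1) + 1) * M + 5 / 2 * p ^+ 2 / (al + 1) *
    ((1 + u t ^+ 2 + v t ^+ 2) `^ (p / 2 - 1) * (du t ^+ 2 + dv t ^+ 2) *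
     (c - t ^+ 2) `^ (al + 2)) in
  [/\ {within `[- X, X], continuous V}, {within `[- X, X], continuous G} &
   (al + 1) / 2 * rint (- X) X V <= rint (- X) X G].
Proof.
move=> p0 al1 c1 c2 X0 Xc M0 uD vD duc dvc HM V G.
pose a := al + 1; have a0 : 0 < a by rewrite /a; lra.
pose S t := 1 + u t ^+ 2 + v t ^+ 2.
have S0 t : 0 < S t by rewrite /S; have := sqr_ge0 (u t); have := sqr_ge0 (v t); lra.
pose W t := c - t ^+ 2.
have tX2 t : - X <= t <= X -> t ^+ 2 <= X ^+ 2 by move=> /andP[? ?]; nra.
have W0 t : - X <= t <= X -> 0 < W t by move=> /tX2 ?; rewrite /W; lra.
have uc : {within `[- X, X], continuous u}.
  by apply: continuous_in_subspaceT => t /[!inE]/=; rewrite in_itv/= => /uD/deriv_continuous.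
have vc : {within `[- X, X], continuous v}.
  by apply: continuous_in_subspaceT => t /[!inE]/=; rewrite in_itv/= => /vD/deriv_continuous.
have idc : {within `[- X, X], continuous (fun t : R => t)}.
  by apply: continuous_subspaceT => t; exact: (deriv_continuous (deriv_id t)).
have sq (h : R -> R) : {within `[- X, X], continuous h} ->
    {within `[- X, X], continuous (fun t => h t ^+ 2)}.
  by move=> hc; exact: (within_continuous_mul hc hc).
have kc (k : R) : {within `[- X, X], continuous (fun=> k : R)}.
  exact: cst_within_continuous.
have Sc : {within `[- X, X], continuous S}.
  apply: within_continuous_add; last exact: sq.
  by apply: within_continuous_add; [exact: kc|exact: sq].
have Wc : {within `[- X, X], continuous W}.
  by apply: within_continuous_sub; [exact: kc|exact: sq].
have Sp s : {within `[- X, X], continuous (fun t => S t `^ s)}.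
  by apply: within_continuous_powR => // t _; exact: S0.
have Wp s : {within `[- X, X], continuous (fun t => W t `^ s)}.
  exact: within_continuous_powR.
have Vc : {within `[- X, X], continuous V} by exact: within_continuous_mul.
have Gc : {within `[- X, X], continuous G}.
  apply: within_continuous_add; first exact: kc.
  apply: within_continuous_mul; first exact: kc.
  apply: within_continuous_mul; last exact: Wp.
  apply: within_continuous_mul; first exact: Sp.
  by apply: within_continuous_add; exact: sq.
split => //.
pose F t := - t * (S t `^ (p / 2) * W t `^ a).
pose dF t := - (S t `^ (p / 2) * W t `^ a) -
  t * (p * S t `^ (p / 2 - 1) * (u t * du t + v t * dv t)) * W t `^ a +
  2 * a * t ^+ 2 * (S t `^ (p / 2) * W t `^ al).
have dFc : {within `[- X, X], continuous dF}.
  apply: within_continuous_add; last first.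
    apply: within_continuous_mul; last by apply: within_continuous_mul; [exact: Sp|exact: Wp].
    by apply: within_continuous_mul; [exact: kc|exact: sq].
  apply: within_continuous_sub.
    have H : {within `[- X, X], continuous (fun t => S t `^ (p / 2) * W t `^ a)}.
      by apply: within_continuous_mul; [exact: Sp|exact: Wp].
    by move=> t; apply: cvgN; exact: H.
  apply: within_continuous_mul; last exact: Wp.
  apply: within_continuous_mul; first exact: idc.
  apply: within_continuous_mul; last by apply: within_continuous_add; exact: within_continuous_mul.
  by apply: within_continuous_mul; [exact: kc|exact: Sp].
have FD t : - X <= t <= X -> is_derive t 1 F (dF t).
  move=> tX; have Sd : is_derive t 1 S (2 * (u t * du t + v t * dv t)).
    have H := deriv_add (deriv_add (deriv_cst 1 t) (deriv_mul (uD _ tX) (uD _ tX)))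
      (deriv_mul (vD _ tX) (vD _ tX)).
    by apply: (is_derive_eq H); ring.
  have Wd : is_derive t 1 W (- 2 * t).
    have H := deriv_add (deriv_cst c t) (deriv_mul (deriv_cst (-1) t)
      (deriv_mul (deriv_id t) (deriv_id t))).
    have WE : W = (fun t => c + -1 * (t * t)) by apply/funext => s; rewrite /W; ring.
    by rewrite WE; apply: (is_derive_eq H); ring.
  have H := deriv_mul (deriv_mul (deriv_cst (-1) t) (deriv_id t))
    (deriv_mul (deriv_powR (p / 2) Sd (S0 t)) (deriv_powR a Wd (W0 t tX))).
  have FE : F = (fun t => -1 * t * (S t `^ (p / 2) * W t `^ a)).
    by apply/funext => s; rewrite /F; ring.
  rewrite FE; apply: (is_derive_eq H); rewrite /dF.
  have -> : a - 1 = al by rewrite /a; ring.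
  by field.
have FX : rint (- X) X dF <= 0.
  have -> : rint (- X) X dF = F X - F (- X) by apply: rint_derive => //; lra.
  rewrite /F opprK mulNr subr_le0.
  apply: (@le_trans _ _ 0); last by rewrite mulr_ge0// mulr_ge0 ?powR_ge0.
  by rewrite oppr_le0 mulr_ge0// mulr_ge0 ?powR_ge0.
have XX : - X <= X by lra.
pose k := a / 2.
have kV : {within `[- X, X], continuous (fun t => k * V t)}.
  by apply: within_continuous_mul; [exact: kc|exact: Vc].
have main : rint (- X) X (fun t => k * V t) <= rint (- X) X (fun t => dF t + G t).
  apply: rint_le => //; first exact: within_continuous_add.
  move=> t tX; have Wt := W0 t tX; have Wt1 : W t <= 1.
    by rewrite /W; have := sqr_ge0 t; lra.
  have SE : S t `^ (p / 2) = S t `^ (p / 2 - 1) * S t.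
    by rewrite [RHS]mulrC mulr_powRB1 ?(ltW (S0 t)) ?divr_gt0.
  have WaE : W t `^ a = W t `^ al * W t.
    have -> : al = a - 1 by rewrite /a; ring.
    by rewrite [RHS]mulrC mulr_powRB1 ?(ltW Wt).
  have Wa2E : W t `^ (al + 2) = W t `^ al * W t ^+ 2.
    by rewrite powRD ?(gt_eqF Wt) ?implybT// powR_mulrn// ltW.
  pose Q := S t `^ (p / 2 - 1) * W t `^ al.
  have Q0 : 0 < Q by rewrite mulr_gt0// powR_gt0.
  (* Two regimes. If [W] is at least the threshold, then [Q S W = S^(p/2) * W^a] is at most [M],
     since [W <= 1]. Below the threshold [(2a + 1) * W <= a / 10]. *)
  have H1 : (2 * a + 1) * (Q * (1 + u t ^+ 2 + v t ^+ 2) * W t) <=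
    a / 10 * (Q * (1 + u t ^+ 2 + v t ^+ 2)) + (2 * a + 1) * M.
    rewrite -/(S t); have [w0|w0] := leP (a / 10 / (2 * a + 1)) (W t).
      have VM := HM t tX w0; rewrite -/(S t) SE in VM.
      apply: ler_wpDl; first by apply: mulr_ge0; [lra|exact/ltW/mulr_gt0].
      rewrite ler_pM2l; last by lra.
      have -> : Q * S t * W t = S t `^ (p / 2 - 1) * S t * W t `^ a.
        by rewrite WaE /Q; ring.
      apply: le_trans VM; rewrite ler_piMr//.
        by rewrite mulr_ge0 ?powR_ge0// ltW.
      apply: (@le_trans _ _ (1 `^ a)); last by rewrite powR1.
      by apply: ge0_ler_powR; rewrite ?nnegrE ?(ltW a0) ?(ltW Wt).
    apply: ler_wpDr; first by apply: mulr_ge0 => //; lra.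
    move: w0; rewrite ltr_pdivlMr; last by lra.
    have -> : (2 * a + 1) * (Q * S t * W t) = W t * (2 * a + 1) * (Q * S t) by ring.
    by move=> w0; apply: ler_wpM2r; [exact/ltW/mulr_gt0|exact: ltW].
  have tWE : t ^+ 2 = c - W t by rewrite /W; ring.
  have := @hardy_pointwise a p t (W t) c (u t) (v t) (du t) (dv t) Q M a0 Q0 Wt tWE c1 c2 H1.
  rewrite /dF /G -/a -/(S t) -/(W t) WaE Wa2E SE /V -/(S t) -/(W t) SE /k /Q.
  by move=> H; apply: le_trans (le_trans H _); rewrite le_eqVlt; apply/orP; left; apply/eqP; ring.
have -> : (al + 1) / 2 * rint (- X) X V = rint (- X) X (fun t => k * V t).
  by rewrite /rint RintegralZl//; exact: rint_integrable.
apply: (le_trans main).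
rewrite [leLHS](_ : _ = rint (- X) X dF + rint (- X) X G); last first.
  by rewrite /rint RintegralD//; exact: rint_integrable.
by rewrite gerDr.
Qed.

End Hardy.

Section Lines.
Variable R : realType.
Local Notation C := R[i].
Local Notation normc := (@Normc.normc R).
Implicit Types (f : C -> C) (g : R -> C) (e z l : C).

(** [L] will be the real or the imaginary part and [g] a horizontal or vertical line with unit
    direction [e], so one argument covers both families of chords. *)
Lemma deriv_line f g e l t (L : C -> R) : normc e = 1 ->
  (forall s h, g (s + h) = g s + h%:C * e) ->
  (forall z w, L (z - w) = L z - L w) -> (forall (h : R) z, L (h%:C * z) = h * L z) ->
  (forall z, `|L z| <= normc z) ->
  cdiff f (g t) l -> is_derive t 1 (fun s => L (f (g s))) (L (l * e)).
Proof.
move=> e1 gD LB LZ Ln fl.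
have H : (fun h : R => h^-1 *: (L (f (g (h *: (1 : R) + t))) - L (f (g t)))) @ 0^' -->
    (L (l * e) : R).
  apply/cvgrPdist_le => eps eps0; have [d d0 dP] := fl _ eps0.
  rewrite near_withinE; apply/(@nbhs_norm0P R R^o); exists d => //= h hd h0.
  have hn : normc (h%:C * e) = `|h| by rewrite Normc.normcM normc_real e1 mulr1.
  have := dP (h%:C * e); rewrite hn => /(_ hd).
  rewrite -gD [t + h]addrC => Hd.
  have -> : h *: (1 : R) + t = h + t by rewrite /GRing.scale/= mulr1.
  have -> : L (l * e) - h^-1 *: (L (f (g (h + t))) - L (f (g t))) =
      - h^-1 * L (f (g (h + t)) - f (g t) - l * (h%:C * e)).
    have -> : l * (h%:C * e) = h%:C * (l * e) by ring.
    by rewrite !LB LZ /GRing.scale/=; field.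
  rewrite normrM normrN normfV mulrC ler_pdivrMr ?normr_gt0//.
  exact: le_trans (Ln _) Hd.
apply: DeriveDef; first by apply/cvg_ex; exists (L (l * e)).
by apply/cvg_lim.
Qed.

Lemma rcont_line (phi : C -> R) g e a b : normc e = 1 ->
  (forall s h, g (s + h) = g s + h%:C * e) ->
  (forall t, a <= t <= b -> rcont phi (g t)) ->
  {within `[a, b], continuous (fun t => phi (g t))}.
Proof.
move=> e1 gD H; apply: continuous_in_subspaceT => x /[!inE]/=; rewrite in_itv/= => xab.
apply/cvgrPdist_lt => eps eps0; have [d d0 dP] := H _ xab _ eps0.
apply/nbhs_normP; exists d => //= y /= xy; rewrite distrC; apply: dP.
have -> : g y = g x + (y - x)%:C * e by rewrite -gD addrC subrK.
by rewrite addrAC subrr add0r Normc.normcM normc_real e1 mulr1 distrC.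
Qed.

Lemma ccontMr f e z : normc e = 1 -> ccont f z -> ccont (fun w => f w * e) z.
Proof.
move=> e1 fc eps /fc[d d0 dP]; exists d => // w /dP.
by rewrite -mulrBl Normc.normcM e1 mulr1.
Qed.

(** Compactness is applied on the whole square [[-1, 1]^2], of which part lies outside the disk:
    near a point with [dweight z < w0] the implication is vacuous, and near any other point [f] is
    continuous. *)
Lemma disk_bounded f (w0 : R) : 0 < w0 -> (forall z, unit_disk z -> ccont f z) ->
  exists2 B : R, 0 <= B & forall z, w0 <= dweight z -> normc (f z) <= B.
Proof.
move=> w00 fc.
have [z zr|t t0 tP] := @rect_compact_near R (-1) 1 (-1) 1
    (fun t z => w0 <= dweight z -> normc (f z) <= t^-1); last first.
  exists t^-1; first by rewrite invr_ge0 ltW.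
  move=> [x y] W; apply: tP => //; move: W; rewrite dweightE.
  by have := sqr_ge0 x; have := sqr_ge0 y; split => /=; nra.
have [zW|zW] := ltP (dweight z) w0.
  have [|d d0 dP] := @rcont_gt R (fun w => -1 * dweight w) z (- w0)
    (rcontZ (-1) (@dweight_rcont R z)).
    by rewrite mulN1r ltrN2.
  by exists d => // w t /dP; rewrite mulN1r ltrN2 ltNge => /negP.
have zD : unit_disk z by apply: unit_diskW; apply: lt_le_trans zW.
have [d d0 dP] := fc _ zD _ ltr01.
have k0 : 0 < normc (f z) + 1 by rewrite ltr_wpDl ?normc_ge0.
exists (Num.min d (normc (f z) + 1)^-1); first by rewrite lt_min d0 invr_gt0.
move=> w t; rewrite lt_min => /andP[/dP fw _] /andP[t0].
rewrite lt_min => /andP[_ tk] _.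
have : normc (f z) + 1 <= t^-1 by rewrite -[leLHS]invrK lef_pV2 ?posrE ?invr_gt0// ltW.
by have := ler_normcB (f w) (f z); lra.
Qed.

End Lines.

Section HardyDisk.
Variable R : realType.
Local Notation C := R[i].
Local Notation normc := (@Normc.normc R).
Local Notation cpair := (@complex_of_pair R).
Local Notation mu := (@lebesgue_measure R).
Local Notation mu2 := (@plane_measure R).
Local Notation D := (@unit_disk R).

Variables (f df : C -> C) (p al : R).
Hypothesis fd : forall z, unit_disk z -> cdiff f z (df z).
Hypotheses (p0 : 0 < p) (al1 : -1 < al).

Definition growth_fun z := (1 + normc (f z) ^+ 2) `^ (p / 2) * dweight z `^ al.

Definition energy_fun z := (1 + normc (f z) ^+ 2) `^ (p / 2 - 1) * normc (df z) ^+ 2 *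
  dweight z `^ (al + 2).

Let a := al + 1.
Let a0 : 0 < a. Proof. by rewrite /a; have := al1; lra. Qed.

(** Cutting off at [eps <= dweight] turns the chord into a compact interval inside the disk, where
    [f] and [df] are continuous up to the ends. The constants are independent of [eps], and
    [|s| <= 4 / 5] gives [c = 1 - s^2 >= 9 / 25]. *)
Lemma hardy_slice (M : R) (g : R -> C) (e : C) (s eps : R) : 0 <= M ->
  (forall z, a / 10 / (2 * a + 1) <= dweight z ->
     (1 + normc (f z) ^+ 2) `^ (p / 2) <= M) ->
  normc e = 1 -> (forall t h, g (t + h) = g t + h%:C * e) ->
  (forall t, dweight (g t) = 1 - s ^+ 2 - t ^+ 2) -> `|s| <= 4 / 5 -> 0 < eps ->
  (\int[mu]_t ((fun t => (a / 2 * growth_fun (g t))%:E) \_ [set t | (eps <= dweight (g t))%R]) t <=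
   \int[mu]_t ((fun t => ((2 * a + 1) * M + 5 / 2 * p ^+ 2 / a * energy_fun (g t))%:E)
     \_ [set t | (eps <= dweight (g t))%R]) t)%E.
Proof.
move=> M0 HM e1 gD gW s1 eps0.
have s2 : s ^+ 2 <= 16 / 25.
  by rewrite -real_normK ?num_real//; have := normr_ge0 s; nra.
have [ce|ce] := ltP (1 - s ^+ 2) eps.
  rewrite !integral0_eq// => t _; rewrite patchE memNset//= gW;
  by apply/negP; rewrite -ltNge; have := sqr_ge0 t; lra.
pose X := Num.sqrt (1 - s ^+ 2 - eps).
have X2 : X ^+ 2 = 1 - s ^+ 2 - eps by rewrite sqr_sqrtr// subr_ge0.
have X0 : 0 <= X by exact: sqrtr_ge0.
have setE : [set t | eps <= dweight (g t)] = `[- X, X]%classic.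
  apply/seteqP; split => t /=; rewrite gW in_itv/= -ler_norml => H.
    rewrite -ler_sqr ?nnegrE// real_normK ?num_real// X2; lra.
  move: H; rewrite -ler_sqr ?nnegrE// real_normK ?num_real// X2; lra.
rewrite setE -!integral_mkcond.
have tD t : - X <= t <= X -> unit_disk (g t).
  move=> tX; apply: unit_diskW; apply: (lt_le_trans eps0).
  have : `[- X, X]%classic t by rewrite /= in_itv.
  by rewrite -setE.
have dfc z : unit_disk z -> ccont df z.
  exact: (derivative_ccont (@unit_disk_open R) fd).
pose u t := complex.Re (f (g t)); pose v t := complex.Im (f (g t)).
pose du t := complex.Re (df (g t) * e); pose dv t := complex.Im (df (g t) * e).
have uvE t : 1 + u t ^+ 2 + v t ^+ 2 = 1 + normc (f (g t)) ^+ 2.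
  by rewrite normcE2 addrA.
have duvE t : du t ^+ 2 + dv t ^+ 2 = normc (df (g t)) ^+ 2.
  by rewrite -normcE2 Normc.normcM e1 mulr1.
have uD t : - X <= t <= X -> is_derive t 1 u (du t).
  move=> /tD/fd; apply: (deriv_line (L := @complex.Re R)) => //.
  - by move=> z w; rewrite raddfB.
  - by move=> h [z1 z2] /=; rewrite mul0r subr0.
  - exact: ler_Re_normc.
have vD t : - X <= t <= X -> is_derive t 1 v (dv t).
  move=> /tD/fd; apply: (deriv_line (L := @complex.Im R)) => //.
  - by move=> z w; rewrite raddfB.
  - by move=> h [z1 z2] /=; rewrite mul0r addr0.
  - exact: ler_Im_normc.
have duc : {within `[- X, X], continuous du}.
  apply: (rcont_line (phi := fun z => complex.Re (df z * e)) e1 gD) => t /tD/dfc.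
  by move=> /(ccontMr e1)/ccont_Re.
have dvc : {within `[- X, X], continuous dv}.
  apply: (rcont_line (phi := fun z => complex.Im (df z * e)) e1 gD) => t /tD/dfc.
  by move=> /(ccontMr e1)/ccont_Im.
have [] := @hardy_segment R p al (1 - s ^+ 2) X M u v du dv p0 al1 _ _ X0 _ M0 uD vD duc dvc.
- lra.
- by have := sqr_ge0 s; lra.
- by rewrite X2; lra.
- by move=> t tX; rewrite -gW uvE; exact: HM.
set V := (fun t => _ * _ `^ al); set G := (fun t => _ + _) => Vc Gc.
have VE : V = (fun t => growth_fun (g t)).
  by apply/funext => t; rewrite /V /growth_fun uvE gW.
have GE : G = (fun t => (2 * a + 1) * M + 5 / 2 * p ^+ 2 / a * energy_fun (g t)).
  by apply/funext => t; rewrite /G /energy_fun uvE duvE gW.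
rewrite -/a -lee_fin (rint_EFin Gc) GE => H; apply: le_trans H.
have kV : {within `[- X, X], continuous (fun t => a / 2 * V t)}.
  by apply: within_continuous_mul => //; exact: cst_within_continuous.
have -> : a / 2 * rint (- X) X V = rint (- X) X (fun t => a / 2 * V t).
  by rewrite /rint RintegralZl//; exact: rint_integrable.
by rewrite (rint_EFin kV) VE.
Qed.

End HardyDisk.

Section HardyPlane.
Variable R : realType.
Local Notation C := R[i].
Local Notation normc := (@Normc.normc R).
Local Notation cpair := (@complex_of_pair R).
Local Notation mu := (@lebesgue_measure R).
Local Notation mu2 := (@plane_measure R).
Local Notation disk := (cpair @^-1` @unit_disk R).

Lemma plane_integral_le_hor (P Q : R * R -> \bar R) :
  measurable_fun setT P -> measurable_fun setT Q ->
  (forall u, 0 <= P u)%E -> (forall u, 0 <= Q u)%E ->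
  (forall y, \int[mu]_x P (x, y) <= \int[mu]_x Q (x, y))%E ->
  (\int[mu2]_u P u <= \int[mu2]_u Q u)%E.
Proof.
move=> mP mQ P0 Q0 PQ.
rewrite [leLHS](@fubini_tonelli2 _ _ _ _ R mu mu P); [|exact: mP|exact: P0].
rewrite [leRHS](@fubini_tonelli2 _ _ _ _ R mu mu Q); [|exact: mQ|exact: Q0].
apply: ge0_le_integral => //.
- by move=> y _; exact: integral_ge0.
- exact: measurable_fun_fubini_tonelli_G.
- exact: measurable_fun_fubini_tonelli_G.
- by move=> y _; exact: PQ.
Qed.

Lemma plane_integral_le_ver (P Q : R * R -> \bar R) :
  measurable_fun setT P -> measurable_fun setT Q ->
  (forall u, 0 <= P u)%E -> (forall u, 0 <= Q u)%E ->
  (forall x, \int[mu]_y P (x, y) <= \int[mu]_y Q (x, y))%E ->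
  (\int[mu2]_u P u <= \int[mu2]_u Q u)%E.
Proof.
move=> mP mQ P0 Q0 PQ.
rewrite [leLHS](@fubini_tonelli1 _ _ _ _ R mu mu P); [|exact: mP|exact: P0].
rewrite [leRHS](@fubini_tonelli1 _ _ _ _ R mu mu Q); [|exact: mQ|exact: Q0].
apply: ge0_le_integral => //.
- by move=> y _; exact: integral_ge0.
- exact: measurable_fun_fubini_tonelli_F.
- exact: measurable_fun_fubini_tonelli_F.
- by move=> y _; exact: PQ.
Qed.

Lemma measurable_disk : measurable disk.
Proof. exact: copen_measurable (@unit_disk_open R). Qed.

Lemma disk_area_le : (mu2 disk <= 4%:E)%E.
Proof.
have -> : (4 : R) = 4 * 1 ^+ 2 by rewrite expr1n mulr1.
rewrite -(plane_measure_square 0 0 ler01); apply: le_measure; rewrite ?inE.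
- exact: measurable_disk.
- exact: measurable_square.
- move=> [x y] /= /unit_diskE xy1.
  have := le_lt_trans (ler_Re_normc _) xy1; have := le_lt_trans (ler_Im_normc _) xy1.
  by rewrite /= !ltr_norml => /andP[? ?] /andP[? ?]; split => /=; lra.
Qed.

Lemma copenT : copen [set: C].
Proof. by move=> z _; exists 1. Qed.

Lemma measurable_plane (phi : C -> R) : (forall z, rcont phi z) ->
  measurable_fun [set: R * R] (phi \o cpair).
Proof. by move=> H; apply: (rcont_measurable_fun copenT). Qed.

Variables (f df : C -> C) (p al : R).
Hypothesis fd : forall z, unit_disk z -> cdiff f z (df z).
Hypotheses (p0 : 0 < p) (al1 : -1 < al).

Let mW : measurable_fun disk (fun u => dweight (cpair u)).
Proof.
apply: (rcont_measurable_fun (phi := @dweight R)); first exact: unit_disk_open.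
by move=> z _; exact: dweight_rcont.
Qed.

Let mf : measurable_fun disk (fun u => normc (f (cpair u))).
Proof.
apply: (rcont_measurable_fun (phi := fun z => normc (f z))).
  exact: unit_disk_open.
by move=> z /fd/cdiff_ccont/ccont_normc.
Qed.

Let mdf : measurable_fun disk (fun u => normc (df (cpair u))).
Proof.
apply: (rcont_measurable_fun (phi := fun z => normc (df z))).
  exact: unit_disk_open.
by move=> z zD; apply: ccont_normc; apply: (derivative_ccont (@unit_disk_open R) fd).
Qed.

Let mS (s : R) : measurable_fun disk (fun u => (1 + normc (f (cpair u)) ^+ 2) `^ s).
Proof.
apply: (measurableT_comp (measurable_powR s)).
by apply: measurable_funD; [exact: measurable_cst|exact: measurable_funX].
Qed.

Lemma measurable_growth_fun : measurable_fun disk (fun u => growth_fun f p al (cpair u)).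
Proof.
apply: measurable_funM; first exact: mS.
exact: (measurableT_comp (measurable_powR al)).
Qed.

Lemma measurable_energy_fun : measurable_fun disk (fun u => energy_fun f df p al (cpair u)).
Proof.
apply: measurable_funM; last exact: (measurableT_comp (measurable_powR (al + 2))).
by apply: measurable_funM; [exact: mS|exact: measurable_funX].
Qed.

Lemma growth_fun_ge0 z : 0 <= growth_fun f p al z.
Proof. by rewrite mulr_ge0// powR_ge0. Qed.

Lemma energy_fun_ge0 z : 0 <= energy_fun f df p al z.
Proof. by rewrite mulr_ge0 ?powR_ge0// mulr_ge0 ?powR_ge0// exprn_ge0 ?normc_ge0. Qed.

(** The slice inequalities are integrated over each of the two families of chords, restricted to
    [dweight >= 1 / (n + 1)], and give the bound [T + T] for every [n]. Here [T] is the integral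
    over the disk of a constant plus a multiple of the energy, finite because the disk has finite
    area. Monotone convergence then removes the cutoff. *)
Lemma hardy_disk :
  (\int[mu2]_(u in disk) (energy_fun f df p al (cpair u))%:E < +oo)%E ->
  (\int[mu2]_(u in disk) (growth_fun f p al (cpair u))%:E < +oo)%E.
Proof.
move=> Elty; pose a := al + 1.
have a0 : 0 < a by rewrite /a; have := al1; lra.
(* The threshold of [hardy_segment]: the points with weight at least [w0] stay away from the unit
   circle, so [f] is bounded there and [M] exists. *)
pose w0 := a / 10 / (2 * a + 1).
have w00 : 0 < w0 by rewrite !divr_gt0//; lra.
have [B B0 BP] : exists2 B : R, 0 <= B & forall z, w0 <= dweight z -> normc (f z) <= B.
  by apply: disk_bounded => // z /fd/cdiff_ccont.
pose M := (1 + B ^+ 2) `^ (p / 2).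
have M0 : 0 <= M by exact: powR_ge0.
have HM z : w0 <= dweight z -> (1 + normc (f z) ^+ 2) `^ (p / 2) <= M.
  move=> /BP fB; apply: ge0_ler_powR; rewrite ?nnegrE ?addr_ge0 ?sqr_ge0//.
    by rewrite divr_ge0// ltW.
  by rewrite lerD2l ler_sqr ?nnegrE ?normc_ge0.
pose k1 := (2 * a + 1) * M; pose k2 := 5 / 2 * p ^+ 2 / a.
have k10 : 0 <= k1 by rewrite mulr_ge0//; lra.
have k20 : 0 <= k2 by rewrite divr_ge0 ?(ltW a0)// mulr_ge0 ?sqr_ge0//; lra.
pose lhs u := (a / 2 * growth_fun f p al (cpair u))%:E.
pose rhs u := (k1 + k2 * energy_fun f df p al (cpair u))%:E.
have lhs0 u : (0 <= lhs u)%E.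
  by rewrite lee_fin mulr_ge0 ?growth_fun_ge0// divr_ge0// ltW.
have rhs0 u : (0 <= rhs u)%E.
  by rewrite lee_fin addr_ge0// mulr_ge0// energy_fun_ge0.
have mlhs : measurable_fun disk lhs.
  apply/measurable_EFinP; apply: measurable_funM; first exact: measurable_cst.
  exact: measurable_growth_fun.
have mrhs : measurable_fun disk rhs.
  apply/measurable_EFinP; apply: measurable_funD; first exact: measurable_cst.
  by apply: measurable_funM; [exact: measurable_cst|exact: measurable_energy_fun].
pose T := (\int[mu2]_(u in disk) rhs u)%E.
have Tlty : (T < +oo)%E.
  have TE : T = (k1%:E * mu2 disk +
      k2%:E * \int[mu2]_(u in disk) (energy_fun f df p al (cpair u))%:E)%E.
    rewrite /T /rhs; under eq_integral do rewrite EFinD (EFinM k2).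
    rewrite ge0_integralD//.
    - congr (_ + _)%E; first by apply: integral_cst; exact: measurable_disk.
      rewrite ge0_integralZl//.
      + exact: measurable_disk.
      + by apply/measurable_EFinP; exact: measurable_energy_fun.
      + by move=> u _; rewrite lee_fin energy_fun_ge0.
    - exact: measurable_disk.
    - by move=> u _; rewrite -EFinM lee_fin mulr_ge0// energy_fun_ge0.
    - by apply: emeasurable_funM; [exact: measurable_cst|apply/measurable_EFinP];
        exact: measurable_energy_fun.
  rewrite TE; apply: lte_add_pinfty.
    apply: (@le_lt_trans _ _ (k1%:E * 4%:E)%E); last by rewrite -EFinM ltry.
    by apply: lee_wpmul2l; [rewrite lee_fin|exact: disk_area_le].
  by apply: lte_mul_pinfty; rewrite ?lee_fin.
(* A point of the disk has a coordinate of modulus at most 4/5; the corresponding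
   chord through it has [c = 1 - s^2 >= 9/25], as required by [hardy_segment]. *)
pose K n : set (R * R) := [set u | n.+1%:R^-1 <= dweight (cpair u)].
pose A n : set (R * R) := K n `&` [set u | `|u.2| <= 4 / 5].
pose B' n : set (R * R) := K n `&` [set u | `|u.1| <= 4 / 5].
have mK n : measurable (K n).
  apply: measurable_le_set; first exact: measurable_cst.
  by apply: measurable_plane => z; exact: dweight_rcont.
have mA n : measurable (A n).
  apply: measurableI => //; apply: measurable_le_set; last exact: measurable_cst.
  by apply: measurableT_comp => //; exact: measurable_snd.
have mB n : measurable (B' n).
  apply: measurableI => //; apply: measurable_le_set; last exact: measurable_cst.
  by apply: measurableT_comp => //; exact: measurable_fst.
have Kd n : K n `<=` disk.
  by move=> u /= ku; apply: unit_diskW; apply: lt_le_trans ku; rewrite invr_gt0.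
have Ad n : A n `<=` disk by move=> u [/Kd].
have Bd n : B' n `<=` disk by move=> u [/Kd].
have restr (E : set (R * R)) (F : R * R -> \bar R) : measurable E -> E `<=` disk ->
    measurable_fun disk F -> measurable_fun setT (F \_ E).
  move=> mE Ed mF; apply/(measurable_restrictT _ mE).
  by apply: measurable_funS mF => //; exact: measurable_disk.
have restr0 (E : set (R * R)) (F : R * R -> \bar R) u : (forall u, 0 <= F u)%E ->
    (0 <= (F \_ E) u)%E.
  by move=> F0; rewrite patchE; case: ifP.
have sub (E : set (R * R)) : measurable E -> E `<=` disk ->
    (\int[mu2]_(u in E) rhs u <= T)%E.
  move=> mE Ed; apply: ge0_subset_integral => //; exact: measurable_disk.
have hor n : (\int[mu2]_(u in A n) lhs u <= T)%E.
  apply: le_trans (sub _ (mA n) (@Ad n)).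
  rewrite integral_mkcond [leRHS]integral_mkcond.
  apply: plane_integral_le_hor; [exact: restr|exact: restr| | |].
  - by move=> u; exact: restr0.
  - by move=> u; exact: restr0.
  move=> y; have [y1|y1] := leP `|y| (4 / 5); last first.
    rewrite integral0_eq; first by apply: integral_ge0 => x _; exact: restr0.
    by move=> x _; rewrite patchE memNset// => -[_ /=]; rewrite leNgt y1.
  have r0 : 0 < n.+1%:R^-1 :> R by rewrite invr_gt0.
  have gD t h : (t + h) +i* y = (t +i* y) + h%:C * 1 :> C.
    by rewrite mulr1; apply/eqP; rewrite eq_complex/= addr0 !eqxx.
  have gW t : dweight (t +i* y) = 1 - y ^+ 2 - t ^+ 2 by rewrite dweightE addrAC.
  have AE F x : (F \_ (A n)) (x, y) = ((fun x => F (x, y)) \_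
      [set t | n.+1%:R^-1 <= dweight (t +i* y)]) x :> \bar R.
    rewrite !patchE; congr (if _ then _ else _).
    by apply/idP/idP; rewrite !inE; [case|move=> H; split].
  have := @hardy_slice R f df p al fd p0 al1 M (fun t => t +i* y) 1 y _ M0 HM
    (Normc.normc1 R) gD gW y1 r0.
  by congr (_ <= _)%E; apply: eq_integral => x _; rewrite AE.
have ver n : (\int[mu2]_(u in B' n) lhs u <= T)%E.
  apply: le_trans (sub _ (mB n) (@Bd n)).
  rewrite integral_mkcond [leRHS]integral_mkcond.
  apply: plane_integral_le_ver; [exact: restr|exact: restr| | |].
  - by move=> u; exact: restr0.
  - by move=> u; exact: restr0.
  move=> x; have [x1|x1] := leP `|x| (4 / 5); last first.
    rewrite integral0_eq; first by apply: integral_ge0 => y _; exact: restr0.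
    by move=> y _; rewrite patchE memNset// => -[_ /=]; rewrite leNgt x1.
  have r0 : 0 < n.+1%:R^-1 :> R by rewrite invr_gt0.
  have gD t h : x +i* (t + h) = (x +i* t) + h%:C * (0 +i* 1) :> C.
    by apply/eqP; rewrite eq_complex/=; apply/andP; split; apply/eqP; ring.
  have gW t : dweight (x +i* t) = 1 - x ^+ 2 - t ^+ 2 by rewrite dweightE.
  have i1 : normc (0 +i* 1) = 1 by rewrite /= expr0n/= expr1n add0r sqrtr1.
  have BE F y : (F \_ (B' n)) (x, y) = ((fun y => F (x, y)) \_
      [set t | n.+1%:R^-1 <= dweight (x +i* t)]) y :> \bar R.
    rewrite !patchE; congr (if _ then _ else _).
    by apply/idP/idP; rewrite !inE; [case|move=> H; split].
  have := @hardy_slice R f df p al fd p0 al1 M (fun t => x +i* t) (0 +i* 1) x _ M0 HM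
    i1 gD gW x1 r0.
  by congr (_ <= _)%E; apply: eq_integral => y _; rewrite BE.
have AB n : (\int[mu2]_(u in K n) lhs u <= T + T)%E.
  apply: (@le_trans _ _ (\int[mu2]_u ((lhs \_ (A n)) u + (lhs \_ (B' n)) u))%E).
    rewrite integral_mkcond; apply: ge0_le_integral => //.
    - by move=> u _; exact: restr0.
    - exact: restr.
    - by apply: emeasurable_funD; exact: restr.
    - move=> u _; rewrite patchE; case: ifPn => [/[!inE] ku|_]; last first.
        by apply: adde_ge0; exact: restr0.
      have [u2|u2] := leP `|u.2| (4 / 5).
        have -> : (lhs \_ (A n)) u = lhs u by rewrite patchE mem_set.
        by rewrite leeDl// restr0.
      have u1 : `|u.1| <= 4 / 5.
        have {}ku : 0 < 1 - u.1 ^+ 2 - u.2 ^+ 2.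
          by move: ku; rewrite /K/= dweightE; apply: lt_le_trans; rewrite invr_gt0.
        rewrite -ler_sqr ?nnegrE//.
        move: u2; rewrite -ltr_sqr ?nnegrE//.
        by rewrite !real_normK ?num_real// => u2; lra.
      have -> : (lhs \_ (B' n)) u = lhs u by rewrite patchE mem_set.
      by rewrite leeDr// restr0.
  rewrite ge0_integralD//; first last.
  all: try exact: restr.
  all: try by move=> u _; exact: restr0.
  by rewrite -!integral_mkcond; apply: leeD; [exact: hor|exact: ver].
have all : (\int[mu2]_(u in disk) lhs u <= T + T)%E.
  have -> : disk = \bigcup_n K n.
    apply/seteqP; split => [u uD|u [n _ /Kd //]].
    have W0 := dweight_gt0 uD.
    have W0' : 0 <= (dweight (cpair u))^-1 by rewrite invr_ge0 ltW.
    exists (Num.bound (dweight (cpair u))^-1) => //=.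
    rewrite /K/= -[leRHS]invrK lef_pV2 ?posrE ?invr_gt0//.
    by rewrite (le_trans (ltW (archi_boundP W0')))// ler_nat.
  apply: ge0_integral_bigcup_le => //.
  - move=> m n mn; apply/subsetPset => u /=; apply: le_trans.
    by rewrite lef_pV2 ?posrE// ler_nat ltnS.
  - by move=> n; apply: measurable_funS mlhs; [exact: measurable_disk|exact: Kd].
have aE : (\int[mu2]_(u in disk) lhs u =
    (a / 2)%:E * \int[mu2]_(u in disk) (growth_fun f p al (cpair u))%:E)%E.
  rewrite /lhs; under eq_integral do rewrite EFinM.
  rewrite ge0_integralZl//.
  - exact: measurable_disk.
  - by apply/measurable_EFinP; exact: measurable_growth_fun.
  - by move=> u _; rewrite lee_fin growth_fun_ge0.
  - by rewrite lee_fin divr_ge0// ltW.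
have a20 : (0 < (a / 2)%:E)%E by rewrite lte_fin divr_gt0.
rewrite ltNge leye_eq; apply/negP => /eqP Goo.
move: all; rewrite aE Goo gt0_muley// leye_eq => /eqP TT.
by have := lte_add_pinfty Tlty Tlty; rewrite TT ltxx.
Qed.

End HardyPlane.

(** * The energy of a conformal mapping and the conclusion *)

Section Energy.
Variable R : realType.
Local Notation C := R[i].
Local Notation normc := (@Normc.normc R).
Local Notation cpair := (@complex_of_pair R).
Local Notation mu := (@lebesgue_measure R).
Local Notation mu2 := (@plane_measure R).
Local Notation disk := (cpair @^-1` @unit_disk R).

Definition plane_kern e (z : C) : R := kern e (complex.Re z) * kern e (complex.Im z).

Lemma plane_kern_ge0 e z : 0 <= plane_kern e z.
Proof. by rewrite mulr_ge0// ltW// kern_gt0. Qed.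

Lemma measurable_plane_kern e : measurable_fun [set: R * R] (plane_kern e \o cpair).
Proof.
apply: measurable_funM.
  by apply: (measurableT_comp (@kern_measurable R e)); exact: measurable_fst.
by apply: (measurableT_comp (@kern_measurable R e)); exact: measurable_snd.
Qed.

Lemma plane_kern_near e w w' : 0 < e -> `|complex.Re w' - complex.Re w| <= 1 ->
  `|complex.Im w' - complex.Im w| <= 1 ->
  (2 `^ (- (1 + e))) ^+ 2 * plane_kern e w <= plane_kern e w'.
Proof.
move=> e0 H1 H2; have e1 : 0 <= 1 + e by lra.
rewrite /plane_kern expr2 mulrACA.
by apply: ler_pM; rewrite ?mulr_ge0 ?powR_ge0 ?kern_near// ltW// kern_gt0.
Qed.

Lemma plane_kern_lty e : 0 < e -> (\int[mu2]_v (plane_kern e (cpair v))%:E < +oo)%E.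
Proof.
move=> e0; have I0 := kern_integral_lty e0.
set I := (\int[mu]_t _)%E in I0.
have Ige : (0 <= I)%E by apply: integral_ge0 => t _; rewrite lee_fin ltW// kern_gt0.
have IE : I = (fine I)%:E by rewrite fineK// ge0_fin_numE.
pose P u : \bar R := (plane_kern e (cpair u))%:E.
have mP : measurable_fun setT P.
  by apply/measurable_EFinP; exact: measurable_plane_kern.
have P0 u : (0 <= P u)%E by rewrite lee_fin plane_kern_ge0.
rewrite [ltLHS](@fubini_tonelli1 _ _ _ _ R mu mu P); [|exact: mP|exact: P0].
have mk : measurable_fun [set: R] (fun t => (kern e t)%:E).
  by apply/measurable_EFinP; exact: kern_measurable.
have FE x : (\int[mu]_y P (x, y) = (kern e x)%:E * I)%E.
  rewrite /P /plane_kern /=; under eq_integral do rewrite EFinM.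
  rewrite ge0_integralZl//.
  - by move=> y _; rewrite lee_fin ltW// kern_gt0.
  - by rewrite lee_fin ltW// kern_gt0.
rewrite /fubini_F; under eq_integral do rewrite FE IE.
rewrite ge0_integralZr//.
- by rewrite -/I IE -EFinM ltry.
- by move=> y _; rewrite lee_fin ltW// kern_gt0.
- by rewrite lee_fin fine_ge0.
Qed.

Lemma powR_sqr_half (x s : R) : 0 <= x -> (x ^+ 2) `^ (s / 2) = x `^ s.
Proof.
by move=> x0; rewrite -powR_mulrn// -powRrM; congr (_ `^ _); field.
Qed.

Lemma powR_le1 (x s : R) : 0 <= x -> x <= 1 -> 0 <= s -> x `^ s <= 1.
Proof.
move=> x0 x1 s0; apply: (@le_trans _ _ (1 `^ s)); last by rewrite powR1.
by apply: ge0_ler_powR; rewrite ?nnegrE.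
Qed.

(* The growth estimate trades the factor [W^(al+2)] for a negative power of
   [1 + |f|^2], which is integrable for the area of the image. *)
Lemma energy_le (n W d h p al q b K e x y : R) : 0 < q -> 0 < b + 2 -> 0 < al + 2 ->
  0 <= n -> n ^+ 2 = x ^+ 2 + y ^+ 2 -> 0 < W -> W <= 1 ->
  n `^ q * W `^ (b + 2) <= K ->
  e = (q * (al + 2) / (b + 2) - p) / 2 -> 0 < e ->
  h = kern e x * kern e y ->
  (1 + n ^+ 2) `^ (p / 2 - 1) * d ^+ 2 * W `^ (al + 2) <=
  (2 `^ (q / 2) * (1 + K)) `^ ((al + 2) / (b + 2)) * 2 `^ (1 + e) * (h * d ^+ 2).
Proof.
move=> q0 b0 al0 n0 nE W0 W1 nK eE e0 ->.
have n2 := sqr_ge0 n; set S := 1 + n ^+ 2; have S0 : 0 < S by rewrite /S; lra.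
pose r := (al + 2) / (b + 2); have r0 : 0 < r by rewrite divr_gt0.
have Wb : 0 <= W `^ (b + 2) by exact: powR_ge0.
(* The growth bound concerns [|f|^q]. To pass to [S = 1 + |f|^2], note that [S] is at most 2 or at
   most [2 |f|^2] according to whether [|f| <= 1]. *)
have K1 : S `^ (q / 2) * W `^ (b + 2) <= 2 `^ (q / 2) * (1 + K).
  have Sq : S `^ (q / 2) <= 2 `^ (q / 2) * (1 + n `^ q).
    rewrite -[n `^ q]powR_sqr_half//.
    have q20 : 0 <= q / 2 by rewrite divr_ge0// ltW.
    have [n1|n1] := leP (n ^+ 2) 1.
      apply: (@le_trans _ _ (2 `^ (q / 2))).
        by apply: ge0_ler_powR; rewrite ?nnegrE ?(ltW S0)//; rewrite /S; lra.
      by rewrite ler_peMr ?powR_ge0// lerDl powR_ge0.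
    apply: (@le_trans _ _ (2 `^ (q / 2) * (n ^+ 2) `^ (q / 2))).
      rewrite -powRM//; apply: ge0_ler_powR; rewrite ?nnegrE ?(ltW S0) ?mulr_ge0//;
        by rewrite /S; lra.
    by apply: ler_wpM2l; [exact: powR_ge0|rewrite lerDr].
  apply: le_trans (ler_wpM2r Wb Sq) _.
  rewrite -mulrA; apply: ler_wpM2l; first exact: powR_ge0.
  rewrite mulrDl mul1r; apply: lerD => //.
  by apply: powR_le1 => //; exact: ltW.
have K2 : S `^ (q / 2 * r) * W `^ (al + 2) <= (2 `^ (q / 2) * (1 + K)) `^ r.
  have -> : al + 2 = (b + 2) * r by rewrite /r; field; rewrite gt_eqF.
  rewrite (powRrM S _ r) (powRrM W _ r) -powRM ?powR_ge0//.
  apply: ge0_ler_powR; rewrite ?nnegrE ?(ltW r0) ?mulr_ge0 ?powR_ge0//.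
  rewrite addr_ge0//; apply: le_trans nK.
  by rewrite mulr_ge0 ?powR_ge0.
(* This amounts to [(1 + |x|) * (1 + |y|) <= 2 * (1 + x^2 + y^2)], a sum of three elementary
   squares. *)
have K3 : S `^ (- (1 + e)) <= 2 `^ (1 + e) * (kern e x * kern e y).
  rewrite /kern -powRM ?addr_ge0// !powRN ler_pdivlMr; last first.
    by rewrite powR_gt0// mulr_gt0// ltr_pwDl.
  rewrite mulrC ler_pdivrMr ?powR_gt0// -powRM ?(ltW S0)//.
  apply: ge0_ler_powR; rewrite ?nnegrE ?mulr_ge0 ?addr_ge0//; try lra.
  rewrite /S nE -(real_normK (num_real x)) -(real_normK (num_real y)).
  have := sqr_ge0 (`|x| - `|y|); have := sqr_ge0 (`|x| - 1); have := sqr_ge0 (`|y| - 1).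
  nra.
(* The exponents match because [e = (q * r - p) / 2]; this identity dictates the choice of [e]. *)
have -> : S `^ (p / 2 - 1) = S `^ (- (1 + e)) * S `^ (q / 2 * r).
  rewrite -powRD; last by rewrite (gt_eqF S0) implybT.
  by congr (_ `^ _); rewrite eE /r; field; rewrite gt_eqF.
have -> : S `^ (- (1 + e)) * S `^ (q / 2 * r) * d ^+ 2 * W `^ (al + 2) =
  (S `^ (q / 2 * r) * W `^ (al + 2)) * (S `^ (- (1 + e)) * d ^+ 2) by ring.
rewrite -[leRHS]mulrA; apply: ler_pM K2 _.
- by rewrite mulr_ge0 ?powR_ge0.
- by rewrite mulr_ge0 ?powR_ge0 ?sqr_ge0.
by rewrite mulrA; apply: ler_wpM2r K3; exact: sqr_ge0.
Qed.

End Energy.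

Lemma bergman_space_of_ratio_lt (R : realType) (f : R[i] -> R[i]) (p al q b : R) :
  conformal_mapping f -> 0 < p -> -1 < al -> 0 < q -> -1 < b ->
  bergman_space q b f -> p / (al + 2) < q / (b + 2) -> bergman_space p al f.
Proof.
move=> [fh finj] p0 al1 q0 b1 [_ fq] pq; split; first exact: fh.
have b2 : 0 < b + 2 by lra.
have al2 : 0 < al + 2 by lra.
(* A derivative is chosen at each point, with 0 as default where there is none; in the disk there
   always is one. *)
pose df z := xget 0 [set l | cdiff f z l].
have fd z : unit_disk z -> cdiff f z (df z).
  by move=> /fh/derivable_cdiff[l fl]; rewrite /df; case: xgetP => // /(_ l).
have [K K0 KP] := bergman_growth q0 fh fq.
(* Up to the positive factor [(al + 2) / 2] this is the gap between the two ratios, so its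
   positivity is the hypothesis [pq]. *)
pose e : R := (q * (al + 2) / (b + 2) - p) / 2.
have e0 : 0 < e.
  rewrite divr_gt0// subr_gt0 mulrAC -ltr_pdivrMr//.
pose c1 := (2 `^ (q / 2) * (1 + K)) `^ ((al + 2) / (b + 2)) * 2 `^ (1 + e).
have c10 : 0 <= c1 by rewrite mulr_ge0 ?powR_ge0.
pose c := (2 `^ (- (1 + e)) : R) ^+ 2.
have c0 : 0 < c by rewrite exprn_gt0// powR_gt0.
have IA := image_area_le fd finj c0 (@plane_kern_ge0 R e) (@measurable_plane_kern R e)
  (fun w w' => @plane_kern_near R e w w' e0).
have mdisk := @measurable_disk R.
have energy_lty : (\int[@plane_measure R]_(u in @complex_of_pair R @^-1` @unit_disk R)
    (energy_fun f df p al (complex_of_pair u))%:E < +oo)%E.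
  have elt u : (@complex_of_pair R @^-1` @unit_disk R) u ->
      energy_fun f df p al (complex_of_pair u) <=
      c1 * (plane_kern e (f (complex_of_pair u)) * Normc.normc (df (complex_of_pair u)) ^+ 2).
    move=> uD; rewrite /energy_fun.
    apply: (@energy_le R _ _ _ (plane_kern e (f (complex_of_pair u))) p al q b K e
      (complex.Re (f (complex_of_pair u))) (complex.Im (f (complex_of_pair u)))
      q0 b2 al2 (normc_ge0 _) (normcE2 _) (dweight_gt0 uD) _ (KP _ uD)) => //.
    exact: dweight_le1.
  pose kd u := (plane_kern e (f (complex_of_pair u)) *
    Normc.normc (df (complex_of_pair u)) ^+ 2)%:E.
  have kd0 u : (0 <= kd u)%E.
    by rewrite lee_fin mulr_ge0 ?plane_kern_ge0// exprn_ge0// normc_ge0.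
  have mkd : measurable_fun (@complex_of_pair R @^-1` @unit_disk R) kd.
    by apply/measurable_EFinP; exact: (measurable_density fd (@measurable_plane_kern R e)).
  apply: (@le_lt_trans _ _ (c1%:E * \int[@plane_measure R]_(u in
      @complex_of_pair R @^-1` @unit_disk R) kd u)%E).
    rewrite -ge0_integralZl//.
      apply: ge0_le_integral => //.
      - by move=> u _; rewrite lee_fin energy_fun_ge0.
      - by apply/measurable_EFinP; exact: measurable_energy_fun.
      - by apply: emeasurable_funM => //; exact: measurable_cst.
  apply: lte_mul_pinfty; rewrite ?lee_fin//; apply: (le_lt_trans IA).
  apply: (lte_mul_pinfty _ _ (plane_kern_lty e0)); last by [].
  by rewrite lee_fin; apply: divr_ge0; [exact: ler0n|exact: ltW].
have := hardy_disk fd p0 al1 energy_lty; apply: le_lt_trans.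
have sq_le u : Normc.normc (f u) `^ p <= (1 + Normc.normc (f u) ^+ 2) `^ (p / 2).
  rewrite -powR_sqr_half ?normc_ge0//; apply: ge0_ler_powR.
  - by rewrite divr_ge0// ltW.
  - by rewrite nnegrE sqr_ge0.
  - by rewrite nnegrE addr_ge0// sqr_ge0.
  - by rewrite lerDr.
apply: ge0_le_integral => //.
- by move=> u _; rewrite lee_fin mulr_ge0 ?powR_ge0.
- apply/measurable_EFinP; apply: measurable_funM.
    apply: (measurableT_comp (measurable_powR p)).
    apply: (rcont_measurable_fun (phi := fun z => Normc.normc (f z))).
      exact: unit_disk_open.
    by move=> z /fd/cdiff_ccont/ccont_normc.
  apply: (measurableT_comp (measurable_powR al)).
  apply: (rcont_measurable_fun (phi := @dweight R)); first exact: unit_disk_open.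
  by move=> z _; exact: dweight_rcont.
- by apply/measurable_EFinP; exact: (measurable_growth_fun _ _ fd).
- by move=> u _; rewrite lee_fin; apply: ler_wpM2r; rewrite ?powR_ge0.
Qed.

Theorem corollary1p4 (R : realType) (f : R[i] -> R[i]) (p alpha : R)
    (hf : conformal_mapping f) (hp : 0 < p) (halpha : -1 < alpha) :
  (((p / (alpha + 2))%:E < bergman_number f)%E -> bergman_space p alpha f) /\
  ((bergman_number f < (p / (alpha + 2))%:E)%E -> ~ bergman_space p alpha f).
Proof.
split.
  move=> /ereal_sup_gt[_ [q [b [q0 b1 fq ->]]]]; rewrite lte_fin.
  exact: bergman_space_of_ratio_lt.
rewrite ltNge => /negP H fp; apply: H; apply: ereal_sup_ubound.
by exists p, alpha.
Qed.
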